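(* Let $q\in\mathbb{C}^\times$ be not a root of unity. The assignment $\varphi\mapsto L(\mathbf{u}^{\langle0\rangle}(\varphi))$ gives a bijection between $\mathbb{C}[x]^{\langle0\rangle}$ and the set of isomorphism classes of finite dimensional simple $U_q(\mathfrak{sl}_2^{\langle0\rangle}[x])$-modules.
   Context: $[k]=(q^k-q^{-k})/(q-q^{-1})$, $[x,y]=xy-yx$. $U_q(\mathfrak{sl}_2^{\langle0\rangle}[x])$ is the $\mathbb{C}$-algebra with generators $X^\pm_t,J_t$ ($t\ge0$), $K^\pm$ and relations: $K^+$ and all $J_t$ pairwise commute; $K^+K^-=1=K^-K^+$; $(K^-)^2=1-(q-q^{-1})J_0$; $X^\pm_{t+1}X^\pm_s-q^{\pm2}X^\pm_sX^\pm_{t+1}=q^{\pm2}X^\pm_tX^\pm_{s+1}-X^\pm_{s+1}X^\pm_t$; $K^+X^\pm_tK^-=q^{\pm2}X^\pm_t$; $q^{\pm2}J_0X^\pm_t-q^{\mp2}X^\pm_tJ_0=\pm[2]X^\pm_t$; $[J_{s+1},X^\pm_t]=q^{\pm2}J_sX^\pm_{t+1}-q^{\mp2}X^\pm_{t+1}J_s$; $[X^+_t,X^-_s]=K^+J_{s+t}$. For $\mathbf{u}=(\lambda,(u_t)_{t>0})\in\mathbb{C}^\times\times\prod_{t>0}\mathbb{C}$, $L(\mathbf{u})$ is the simple module generated by $v_0$ with $X^+_tv_0=0$ ($t\ge0$), $K^+v_0=\lambda v_0$, $J_tv_0=u_tv_0$ ($t>0$). $p_t(q)(x_1,\dots,x_k)=\sum_{\lambda\vdash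 t,\ell(\lambda)\le k}q^{-\ell(\lambda)}(q-q^{-1})^{\ell(\lambda)-1}m_\lambda(x_1,\dots,x_k)$ ($m_\lambda$ monomial symmetric). $\mathbb{C}[x]^{\langle0\rangle}$ is the set of polynomials $\varphi=\beta_\varphi(x-\gamma_1)\cdots(x-\gamma_k)$ with leading coefficient $\beta_\varphi=\pm1$, and $\mathbf{u}^{\langle0\rangle}(\varphi)=(\beta_\varphi,(0)_{t>0})$ if $k=0$, $(\beta_\varphi q^k,(p_t(q)(\gamma_1,\dots,\gamma_k))_{t>0})$ if $k>0$. *)

(* Defs.v *)
(* The ground field C is the complex numbers R[i], for R : realType
   (every realType is a complete archimedean ordered field, i.e. a copy of the reals). *)
From mathcomp Require Import all_boot all_order all_algebra.
From mathcomp Require Import complex reals.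
Set Implicit Arguments. Unset Strict Implicit. Unset Printing Implicit Defensive.
Import GRing.Theory.
Local Open Scope ring_scope.

Section Defs.
Variable R : realType.
Local Notation C := (R[i]).

Definition qint (q : C) (k : nat) : C := (q ^+ k - q ^- k) / (q - q^-1).

(* A module structure on the column space C^n is an assignment of n x n matrices to
   the generators X^+_t, X^-_t, J_t (t >= 0), K^+, K^- satisfying the defining
   relations (universal property of an algebra given by generators and relations).
   The action on a column vector v is  v |-> M *m v, so products compose as matrices. *)
Record ops (n : nat) := Ops {
  Xp : nat -> 'M[C]_n;
  Xm : nat -> 'M[C]_n;
  J  : nat -> 'M[C]_n;
  Kp : 'M[C]_n;
  Km : 'M[C]_n }.

Definition comm n (A B : 'M[C]_n) := A *m B - B *m A.

Definition X_rels (q : C) n (r : ops n) (X : nat -> 'M[C]_n) (c sg : C) : Prop :=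
  [/\ (forall t s, X t.+1 *m X s - c *: (X s *m X t.+1)
                   = c *: (X t *m X s.+1) - X s.+1 *m X t),
      (forall t, Kp r *m X t *m Km r = c *: X t),
      (forall t, c *: (J r 0 *m X t) - c^-1 *: (X t *m J r 0) = (sg * qint q 2) *: X t)
    & (forall s t, comm (J r s.+1) (X t)
                   = c *: (J r s *m X t.+1) - c^-1 *: (X t.+1 *m J r s))].

Definition is_module (q : C) n (r : ops n) : Prop :=
  [/\ (forall t, comm (Kp r) (J r t) = 0) /\ (forall s t, comm (J r s) (J r t) = 0),
      Kp r *m Km r = 1%:M /\ Km r *m Kp r = 1%:M,
      Km r *m Km r = 1%:M - (q - q^-1) *: J r 0,
      X_rels q r (Xp r) (q ^+ 2) 1 /\ X_rels q r (Xm r) (q ^- 2) (-1)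
    & (forall t s, comm (Xp r t) (Xm r s) = Kp r *m J r (s + t))].

(* Submodules: a subspace W of column vectors, stable under all generators.  W is
   encoded as the row space of U (the rows of U are the transposes of the vectors of W),
   so "M W <= W" reads (U *m M^T <= U)%MS. *)
Definition stable n (r : ops n) (U : 'M[C]_n) : bool :=
  (U *m (Kp r)^T <= U)%MS && (U *m (Km r)^T <= U)%MS.
Definition submodule n (r : ops n) (U : 'M[C]_n) : Prop :=
  [/\ stable r U,
      (forall t, (U *m (Xp r t)^T <= U)%MS),
      (forall t, (U *m (Xm r t)^T <= U)%MS)
    & (forall t, (U *m (J r t)^T <= U)%MS)].

Definition simple n (r : ops n) : Prop :=
  (0 < n)%N /\ forall U : 'M[C]_n, submodule r U -> (\rank U == 0)%N || row_full U.

Definition iso n1 n2 (r1 : ops n1) (r2 : ops n2) : Prop :=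
  exists (P : 'M[C]_(n2, n1)) (Q : 'M[C]_(n1, n2)),
    [/\ P *m Q = 1%:M /\ Q *m P = 1%:M,
        P *m Kp r1 = Kp r2 *m P /\ P *m Km r1 = Km r2 *m P,
        (forall t, P *m Xp r1 t = Xp r2 t *m P),
        (forall t, P *m Xm r1 t = Xm r2 t *m P)
      & (forall t, P *m J r1 t = J r2 t *m P)].

(* u = (lambda, (u_t)_{t>0}); the t = 0 component of u.2 is irrelevant.
   L(u) is the simple module generated by v0 <> 0 with X^+_t v0 = 0, K^+ v0 = lambda v0,
   J_t v0 = u_t v0 (t > 0).  A simple module containing such a v0 is generated by it. *)
Definition has_hw n (r : ops n) (u : C * (nat -> C)) : Prop :=
  exists v : 'cV[C]_n,
    [/\ v != 0, (forall t, Xp r t *m v = 0), Kp r *m v = u.1 *: v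
      & (forall t, (0 < t)%N -> J r t *m v = u.2 t *: v)].

Definition is_L n (r : ops n) u : Prop := simple r /\ has_hw r u.

Definition is_partition (t : nat) (lam : seq nat) : bool :=
  [&& sorted geq lam, all (fun i => 0 < i)%N lam & sumn lam == t].

(* monomial symmetric polynomial m_lam(x_1,...,x_k): sum of the distinct monomials
   x^alpha whose exponent vector alpha has nonzero entries a rearrangement of lam *)
Definition msym (k : nat) (lam : seq nat) (x : 'I_k -> C) : C :=
  \sum_(a : {ffun 'I_k -> 'I_(sumn lam).+1}
         | perm_eq [seq (val (a i)) | i <- enum 'I_k & (0 < val (a i))%N] lam)
     \prod_(i < k) x i ^+ val (a i).

(* every partition of t has at most t parts; a partition is encoded by its zero-padded
   version of length t, a t-tuple of entries in 0..t *)
Definition ptq (q : C) (t : nat) (k : nat) (x : 'I_k -> C) : C :=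
  \sum_(s : t.-tuple 'I_t.+1
         | sorted geq (map val s) &&
           is_partition t [seq i <- map val s | (0 < i)%N])
    let lam := [seq i <- map val s | (0 < i)%N] in
    if (size lam <= k)%N then
      q^-1 ^+ size lam * (q - q^-1) ^+ (size lam).-1 * msym lam x
    else 0.

Definition in_Cx0 (phi : {poly C}) : bool :=
  (lead_coef phi == 1) || (lead_coef phi == -1).

(* a root sequence: phi = lead_coef phi * prod (x - gamma_i) *)
Definition roots_of (phi : {poly C}) : seq C := projT1 (closed_field_poly_normal phi).

Definition u0 (q : C) (phi : {poly C}) : C * (nat -> C) :=
  let g := roots_of phi in
  let k := size g in
  if k == 0%N then (lead_coef phi, fun _ => 0)
  else (lead_coef phi * q ^+ k, fun t => ptq q t (fun i : 'I_k => g`_i)).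

End Defs.

(* Main.v *)
(* Write c = q^-2, and let psi(z) = 1 + (q - q^-1) sum_{t>0} u_t z^t be the highest weight
   series. The weights u0 phi are the solutions of D(z) psi(z) = D(cz) with
   D(z) = prod_i (1 - gamma_i z); as q is not a root of unity, psi and D determine each
   other once D(0) = 1, which gives injectivity.

   In a highest weight module the lowest weight space is spanned by w = (X^-_0)^k v, by
   sl_2-theory. Polynomials in the J_t act on words of length k in the X^-_t by the
   elementary symmetric functions of the k shifts X^-_t -> X^-_{t+1}, hence by scalars D_j
   on w, and sl_2-theory again gives (X^-_0)^(k-1) X^-_t v = (u_t / u_0) w. Comparing the
   two, with X^-_1 X^-_0 = c X^-_0 X^-_1 and the q-binomial theorem, gives
   D(z) psi(z) = D(cz): this is surjectivity.

   For existence, when the gamma_i are distinct and nonzero there is an explicit module of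
   dimension 2^k with a basis indexed by subsets. Its matrix coefficient of the highest
   weight vector is, on every word in the generators, polynomial in a perturbation
   parameter, so it extends to arbitrary gamma_i; the rank of its Hankel matrix remains at
   most 2^k, and this realizes the limit on a finite dimensional module, of which a
   subquotient is simple. *)
Require Import Defs.
From HB Require Import structures.
From mathcomp Require Import all_boot all_order all_algebra.
From mathcomp Require Import complex reals.
From mathcomp Require Import boolp.
From mathcomp Require Import ring zify.
Set Implicit Arguments. Unset Strict Implicit. Unset Printing Implicit Defensive.
Import Order.TTheory GRing.Theory Num.Theory.
Local Open Scope ring_scope.

(** * Representations as matrices for the generators *)

(* Decides linear identities between matrices, with the products as atoms. *)
Ltac mxlin := repeat match goal with |- context [mulmx ?A ?B] =>
  let x := fresh "x" in set x := (mulmx A B); clearbody x end;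
  let i := fresh "i" in let j := fresh "j" in
  apply/matrixP => i j; rewrite !mxE; ring.

(** The obstacle in the existence part is that the matrices of the explicit module have denominators
    g_i - g_j, so the module cannot be specialised at coinciding parameters. Its matrix coefficient
    can. Reordering a word applied to v uses only the relations, and the outcome involves nothing
    but constants, [lam], its inverse and the scalars [u t]. The equation D(z) psi(z) = D(cz) with
    D(0) = 1 determines the [u t] with t > 0 recursively, dividing only by q - q^-1, and u_0 depends
    on [lam] alone. For this reason relations are stored as lists of scalars and words, which can be
    evaluated in matrices as well as by a functional on words, and spans of words carry a ring of
    admissible coefficients. The same spans serve uniqueness: with constant coefficients, the
    submodule generated by a pair of highest weight vectors has a line as its top weight space. *)

Inductive gen := gX of bool & nat | gJ of nat | gK | gKm.

Section Representations.
Variables (F : numClosedFieldType) (q : F).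
Hypotheses (hq0 : q != 0) (hq : forall m : nat, (0 < m)%N -> q ^+ m != 1).

Definition cX (b : bool) : F := if b then q ^+ 2 else q ^- 2.
Definition sgX (b : bool) : F := if b then 1 else -1.
Definition qtwo : F := (q ^+ 2 - q ^- 2) / (q - q^-1).

Inductive rel : seq (F * seq gen) -> Prop :=
| relKJ t : rel [:: (1, [:: gK; gJ t]); (-1, [:: gJ t; gK])]
| relJJ s t : rel [:: (1, [:: gJ s; gJ t]); (-1, [:: gJ t; gJ s])]
| relKKm : rel [:: (1, [:: gK; gKm]); (-1, [::])]
| relKmK : rel [:: (1, [:: gKm; gK]); (-1, [::])]
| relKm2 : rel [:: (1, [:: gKm; gKm]); (-1, [::]); (q - q^-1, [:: gJ 0])]
| relXX b t s : rel [:: (1, [:: gX b t.+1; gX b s]);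
    (- cX b, [:: gX b s; gX b t.+1]); (- cX b, [:: gX b t; gX b s.+1]);
    (1, [:: gX b s.+1; gX b t])]
| relKX b t : rel [:: (1, [:: gK; gX b t; gKm]); (- cX b, [:: gX b t])]
| relJ0X b t : rel [:: (cX b, [:: gJ 0; gX b t]);
    (- (cX b)^-1, [:: gX b t; gJ 0]); (- (sgX b * qtwo), [:: gX b t])]
| relJX b s t : rel [:: (1, [:: gJ s.+1; gX b t]); (-1, [:: gX b t; gJ s.+1]);
    (- cX b, [:: gJ s; gX b t.+1]); ((cX b)^-1, [:: gX b t.+1; gJ s])]
| relXpXm t s : rel [:: (1, [:: gX true t; gX false s]);
    (-1, [:: gX false s; gX true t]); (-1, [:: gK; gJ (s + t)])].

Definition opw n (rho : gen -> 'M[F]_n) (w : seq gen) : 'M[F]_n :=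
  foldr (fun g M => rho g *m M) 1%:M w.
Definition opl n (rho : gen -> 'M[F]_n) (L : seq (F * seq gen)) : 'M[F]_n :=
  \sum_(p <- L) p.1 *: opw rho p.2.
Definition isrep n (rho : gen -> 'M[F]_n) := forall L, rel L -> opl rho L = 0.

Lemma opw_cat n (rho : gen -> 'M[F]_n) w1 w2 :
  opw rho (w1 ++ w2) = opw rho w1 *m opw rho w2.
Proof. by elim: w1 => [|g w IH] /=; rewrite ?mul1mx // IH mulmxA. Qed.

Lemma q_sq_neq1 : q ^+ 2 != 1. Proof. exact: hq. Qed.

Lemma qqV_neq0 : q - q^-1 != 0.
Proof.
rewrite subr_eq0; apply/eqP => h; have /eqP[] := q_sq_neq1.
by rewrite expr2 {2}h mulfV.
Qed.

Lemma cX_neq0 b : cX b != 0.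
Proof. by case: b; rewrite /cX ?invr_eq0 expf_neq0. Qed.

Lemma qexp_inj m n : q ^+ m = q ^+ n -> m = n.
Proof.
wlog le_mn : m n / (m <= n)%N => [W|].
  by case: (leqP m n) => [/W//|/ltnW/W W' /esym/W' ->].
rewrite -{1}[n](subnK le_mn) exprD => /eqP.
rewrite -subr_eq0 -{1}[q ^+ m]mul1r -mulrBl mulf_eq0 expf_eq0 (negPf hq0) andbF.
rewrite orbF subr_eq0 eq_sym; have [|/hq/negPf->//] := posnP (n - m).
by move=> /eqP; rewrite subn_eq0 => h _; apply/eqP; rewrite eqn_leq le_mn.
Qed.

Lemma cX_exp_inj b m n : cX b ^+ m = cX b ^+ n -> m = n.
Proof.
case: b; rewrite /cX ?exprVn -!exprM.
  by move=> /qexp_inj /eqP; rewrite eqn_pmul2l // => /eqP.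
by move=> /invr_inj /qexp_inj /eqP; rewrite eqn_pmul2l // => /eqP.
Qed.

Lemma cX_exp_neq1 b m : (0 < m)%N -> cX b ^+ m != 1.
Proof.
by move=> m0; apply/eqP; rewrite -(expr0 (cX b)) => /cX_exp_inj m0'; rewrite m0' in m0.
Qed.

Lemma cXN b : (cX b)^-1 = cX (~~ b).
Proof. by case: b; rewrite /cX //= invrK. Qed.

Section Relations.
Variables (n : nat) (rho : gen -> 'M[F]_n).
Hypothesis H : isrep rho.
Local Notation K := (rho gK).
Local Notation Km := (rho gKm).
Local Notation J t := (rho (gJ t)).
Local Notation Xg b t := (rho (gX b t)).

Let relE := (big_cons, big_nil, mulmx1, mulmxA, scale1r, scaleN1r, addr0).

Lemma KKm : K *m Km = 1%:M.
Proof. have := H relKKm; rewrite /opl /= !relE /= !relE => /subr0_eq. by []. Qed.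
Lemma KmK : Km *m K = 1%:M.
Proof. have := H relKmK; rewrite /opl /= !relE /= !relE => /subr0_eq. by []. Qed.
Lemma KJ t : K *m J t = J t *m K.
Proof. have := H (relKJ t); rewrite /opl /= !relE /= !relE => /subr0_eq. by []. Qed.
Lemma JJ s t : J s *m J t = J t *m J s.
Proof. have := H (relJJ s t); rewrite /opl /= !relE /= !relE => /subr0_eq. by []. Qed.
Lemma KX b t : K *m Xg b t = cX b *: (Xg b t *m K).
Proof.
have := H (relKX b t); rewrite /opl /= !relE /= !relE scaleNr => /subr0_eq h.
by rewrite scalemxAl -h -mulmxA KmK mulmx1.
Qed.
Lemma Km2 : Km *m Km = 1%:M - (q - q^-1) *: J 0.
Proof.
have := H relKm2; rewrite /opl /= !relE /= !relE addrA => /eqP.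
by rewrite addr_eq0 subr_eq addrC => /eqP.
Qed.
Lemma XpXm t s : Xg true t *m Xg false s = Xg false s *m Xg true t + K *m J (s + t).
Proof.
have := H (relXpXm t s); rewrite /opl /= !relE /= !relE addrA => /eqP.
by rewrite subr_eq0 subr_eq addrC => /eqP.
Qed.
Lemma JX0 b t : J 0 *m Xg b t =
  (cX b)^-1 ^+ 2 *: (Xg b t *m J 0) + ((cX b)^-1 * (sgX b * qtwo)) *: Xg b t.
Proof.
have := H (relJ0X b t); rewrite /opl /= !relE /= !relE addrA => /eqP.
rewrite !scaleNr subr_eq0 subr_eq => /eqP h.
have -> : J 0 *m Xg b t = (cX b)^-1 *: (cX b *: (J 0 *m Xg b t)).
  by rewrite scalerA mulVf ?cX_neq0 // scale1r.
by rewrite h scalerDr !scalerA addrC expr2.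
Qed.
Lemma JXS b s t : J s.+1 *m Xg b t = Xg b t *m J s.+1 +
  cX b *: (J s *m Xg b t.+1) - (cX b)^-1 *: (Xg b t.+1 *m J s).
Proof.
have := H (relJX b s t); rewrite /opl /= !relE /= !relE => h.
by apply/subr0_eq; rewrite -[RHS]h; mxlin.
Qed.
Lemma XX b t s : Xg b t.+1 *m Xg b s = cX b *: (Xg b s *m Xg b t.+1)
   + cX b *: (Xg b t *m Xg b s.+1) - Xg b s.+1 *m Xg b t.
Proof.
have := H (relXX b t s); rewrite /opl /= !relE /= !relE => h.
by apply/subr0_eq; rewrite -[RHS]h; mxlin.
Qed.
End Relations.
End Representations.
Arguments cX : simpl never.

(** * The span of X^- words applied to highest weight vectors *)

Section HighestWeight.
Variables (F : numClosedFieldType) (q : F).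
Hypotheses (hq0 : q != 0) (hq : forall m : nat, (0 < m)%N -> q ^+ m != 1).
Local Notation c := (cX q false).

(** Unlike in [has_hw], the eigenvalue of J_0 belongs to the data; it is tied to [lam] by the
    relation for the square of K^-. *)
Definition hwvec n (rho : gen -> 'M[F]_n) (v : 'cV_n) (lam : F) (u : nat -> F) :=
  [/\ v != 0, forall t, rho (gX true t) *m v = 0, rho gK *m v = lam *: v &
      forall t, rho (gJ t) *m v = u t *: v].

(* A family of modules indexed by T, with coefficients in a ring of functions on T. It is
   used with T = unit for a single module, with T = bool and constant coefficients for the
   submodule of a direct sum generated by a pair of highest weight vectors, and with
   polynomial coefficients for the matrix coefficients of a one-parameter family. *)
Section Family.
Variables (T : Type) (n : T -> nat) (rho : forall e, gen -> 'M[F]_(n e)).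
Variables (v : forall e, 'cV[F]_(n e)) (lam : T -> F) (u : T -> nat -> F).
Variable (coef : (T -> F) -> Prop).
Hypothesis H : forall e, isrep q (@rho e).
Hypothesis Hv : forall e, hwvec (@rho e) (v e) (lam e) (u e).
Hypothesis coefC : forall a : F, coef (fun=> a).
Hypothesis coefD : forall a b, coef a -> coef b -> coef (fun e => a e + b e).
Hypothesis coefM : forall a b, coef a -> coef b -> coef (fun e => a e * b e).
Hypothesis coef_lam : coef lam.
Hypothesis coef_lamV : coef (fun e => (lam e)^-1).
Hypothesis coef_u : forall t, coef (fun e => u e t).

Definition fam := forall e, 'cV[F]_(n e).
Definition act g (f : fam) : fam := fun e => rho e g *m f e.

(** The index counts the factors X^- and thereby fixes the K-weight lam c^m. Closure under pointwise
    equality stands in for extensionality of dependent families. *)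
Inductive span : nat -> fam -> Prop :=
| span_v : span 0 v
| span_0 m : span m (fun=> 0)
| span_X m t f : span m f -> span m.+1 (act (gX false t) f)
| span_D m f g : span m f -> span m g -> span m (fun e => f e + g e)
| span_Z m a f : coef a -> span m f -> span m (fun e => a e *: f e)
| span_eq m f g : span m f -> (forall e, f e = g e) -> span m g.

Lemma span_C m (a : F) f : span m f -> span m (fun e => a *: f e).
Proof. exact: (@span_Z m (fun=> a)). Qed.

Lemma span_B m f g : span m f -> span m g -> span m (fun e => f e - g e).
Proof.
move=> hf hg; apply: span_eq (span_D hf (span_C (-1) hg)) _ => e /=.
by rewrite scaleN1r.
Qed.

Lemma hw_lam_neq0 e : lam e != 0.
Proof.
case: (Hv e) => v0 _ Kv _; apply: contra v0 => /eqP l0.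
by rewrite -[v e]mul1mx -(KmK (H e)) -mulmxA Kv l0 scale0r mulmx0.
Qed.

Lemma span_weight m f : span m f -> forall e, rho e gK *m f e = (lam e * c ^+ m) *: f e.
Proof.
elim=> {m f} [e|m e|m t f _ IH e|m f g _ IHf _ IHg e|m a f _ _ IH e|m f g _ IH eq e].
- by case: (Hv e) => _ _ -> _; rewrite mulr1.
- by rewrite mulmx0 scaler0.
- rewrite /act mulmxA (KX (H e)) -scalemxAl -mulmxA IH -scalemxAr scalerA.
  by rewrite exprS mulrCA.
- by rewrite mulmxDr IHf IHg scalerDr.
- by rewrite -scalemxAr IH !scalerA mulrC.
- by rewrite -eq IH.
Qed.

Lemma span_K m f : span m f -> span m (act gK f).
Proof.
move=> hf; apply: span_eq (span_Z (coefM coef_lam (coefC (c ^+ m))) hf) _ => e.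
by rewrite /act (span_weight hf).
Qed.

Lemma span_Km m f : span m f -> span m (act gKm f).
Proof.
move=> hf; apply: span_eq (span_Z (coefM coef_lamV (coefC (c ^- m))) hf) _ => e.
rewrite /act -[in LHS](mul1mx (f e)) -(KmK (H e)) -mulmxA (span_weight hf).
rewrite -scalemxAr scalerA mulrACA mulVf ?hw_lam_neq0 // mul1r mulVf ?scale1r //.
by rewrite expf_neq0 // cX_neq0.
Qed.

Lemma span_J m f : span m f -> forall s, span m (act (gJ s) f).
Proof.
elim=> {m f} [s|m s|m t f hf IH s|m f g _ IHf _ IHg s|m a f ha _ IH s|m f g _ IH eq s].
- apply: span_eq (span_Z (coef_u s) span_v) _ => e.
  by rewrite /act; case: (Hv e) => _ _ _ ->.
- by apply: span_eq (span_0 m) _ => e; rewrite /act mulmx0.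
(* Passing J_{s+1} across X^-_t costs a term J_s X^-_{t+1}: s falls while t rises, so t is
   generalised in the inner induction. *)
- elim: s t => [|s IHs] t.
    apply: span_eq (span_D (span_C (c^-1 ^+ 2) (span_X t (IH 0)))
      (span_C (c^-1 * (sgX F false * qtwo q)) (span_X t hf))) _ => e.
    by rewrite /act [RHS]mulmxA (JX0 hq0 (H e)) mulmxDl -!scalemxAl mulmxA.
  apply: span_eq (span_B (span_D (span_X t (IH s.+1)) (span_C c (IHs t.+1)))
    (span_C c^-1 (span_X t.+1 (IH s)))) _ => e.
  by rewrite /act [RHS]mulmxA (JXS (H e)) mulmxBl mulmxDl -!scalemxAl !mulmxA.
- by apply: span_eq (span_D (IHf s) (IHg s)) _ => e; rewrite /act mulmxDr.
- by apply: span_eq (span_Z ha (IH s)) _ => e; rewrite /act -scalemxAr.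
- by apply: span_eq (IH s) _ => e; rewrite /act eq.
Qed.

(** The predecessor is truncated, so vanishing at m = 0 is recorded separately; without it X^-_t
    X^+_s f would land in degree 1 instead of 0 in the inductive step. *)
Lemma span_Xp m f : span m f -> forall s,
  (m = 0%N -> forall e, act (gX true s) f e = 0) /\ span m.-1 (act (gX true s) f).
Proof.
elim=> {m f} [s|m s|m t f hf IH s|m f g _ IHf _ IHg s|m a f ha _ IH s|m f g _ IH eq s].
- have h e : act (gX true s) v e = 0 by rewrite /act; case: (Hv e).
  by split=> // ; apply: span_eq (span_0 0) _.
- have h e : act (gX true s) (fun=> 0) e = 0 by rewrite /act mulmx0.
  by split=> // ; apply: span_eq (span_0 m.-1) _.
- split=> //=; have [IH0 IH1] := IH s.
  have h : span m (act (gX false t) (act (gX true s) f)).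
    case: m hf IH0 IH1 {IH} => [|m] hf IH0 IH1; last exact: span_X IH1.
    by apply: span_eq (span_0 0) _ => e; rewrite {1}/act IH0 // mulmx0.
  apply: span_eq (span_D h (span_K (span_J hf (t + s)))) _ => e.
  by rewrite /act [RHS]mulmxA (XpXm (H e)) mulmxDl !mulmxA.
- have [[f0 f1] [g0 g1]] := (IHf s, IHg s); split=> [m0 e|].
    by move: (f0 m0 e) (g0 m0 e); rewrite /act mulmxDr => -> ->; rewrite addr0.
  by apply: span_eq (span_D f1 g1) _ => e; rewrite /act mulmxDr.
- have [f0 f1] := IH s; split=> [m0 e|].
    by move: (f0 m0 e); rewrite /act -scalemxAr => ->; rewrite scaler0.
  by apply: span_eq (span_Z ha f1) _ => e; rewrite /act -scalemxAr.
- have [f0 f1] := IH s; split=> [m0 e|].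
    by move: (f0 m0 e); rewrite /act eq.
  by apply: span_eq f1 _ => e; rewrite /act eq.
Qed.

Inductive spanT : fam -> Prop :=
| spanT_span m f : span m f -> spanT f
| spanT_D f g : spanT f -> spanT g -> spanT (fun e => f e + g e)
| spanT_eq f g : spanT f -> (forall e, f e = g e) -> spanT g.

Lemma spanT_act g f : spanT f -> spanT (act g f).
Proof.
elim=> {f} [m f hf|f f' _ IH _ IH'|f f' _ IH eq].
- case: g => [[] t|t||].
  + exact: spanT_span (span_Xp hf t).2.
  + exact: spanT_span (span_X t hf).
  + exact: spanT_span (span_J hf t).
  + exact: spanT_span (span_K hf).
  + exact: spanT_span (span_Km hf).
- by apply: spanT_eq (spanT_D IH IH') _ => e; rewrite /act mulmxDr.
- by apply: spanT_eq IH _ => e; rewrite /act eq.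
Qed.

Lemma spanT_Z (a : F) f : spanT f -> spanT (fun e => a *: f e).
Proof.
elim=> {f} [m f hf|f f' _ IH _ IH'|f f' _ IH eq].
- exact: spanT_span (span_C a hf).
- by apply: spanT_eq (spanT_D IH IH') _ => e; rewrite scalerDr.
- by apply: spanT_eq IH _ => e; rewrite eq.
Qed.

Lemma spanT_decomp f : spanT f -> exists (g : nat -> fam) (M : nat),
  [/\ forall i, span i (g i), forall i, (M <= i)%N -> forall e, g i e = 0 &
      forall e, f e = \sum_(i < M) g i e].
Proof.
elim=> {f} [m f hf|f f' _ [g [M [g1 g2 g3]]] _ [g' [M' [g1' g2' g3']]]|f f' _ [g [M [g1 g2 g3]]] eq].
- exists (fun i => if i == m then f else fun=> 0), m.+1; split=> [i|i mi e|e].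
  + by case: eqP => [->//|_]; exact: span_0.
  + by case: eqP mi => // ->; rewrite ltnn.
  + rewrite (bigD1 ord_max) //= eqxx big1 ?addr0 // => i.
    by rewrite -val_eqE /= => /negPf ->.
- have widen N N' (h : nat -> fam) e : (N <= N')%N -> (forall i, (N <= i)%N -> forall e, h i e = 0) ->
      \sum_(i < N) h i e = \sum_(i < N') h i e.
    move=> le h0; rewrite -(subnKC le) big_split_ord /= [X in _ + X]big1 ?addr0 //.
    by move=> i _; rewrite h0 ?leq_addr.
  exists (fun i e => g i e + g' i e), (maxn M M'); split=> [i|i|e].
  + exact: span_D.
  + by rewrite geq_max => /andP[Mi Mi'] e; rewrite g2 // g2' // addr0.
  + rewrite big_split /= g3 g3'; congr (_ + _); apply: widen => //.
      by rewrite leq_maxl.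
    by rewrite leq_maxr.
- by exists g, M; split=> // e; rewrite -eq.
Qed.

Lemma span0P f : span 0 f -> exists2 a, coef a & forall e, f e = a e *: v e.
Proof.
have gen m : span m f -> m = 0%N -> exists2 a, coef a & forall e, f e = a e *: v e.
  elim=> {m f} [|m|m t f hf IH|m f g _ IHf _ IHg|m a f ha _ IH|m f g _ IH eq] // e0.
  + by exists (fun=> 1) => // e; rewrite scale1r.
  + by exists (fun=> 0) => // e; rewrite scale0r.
  + have [[a ca ea] [b cb eb]] := (IHf e0, IHg e0).
    by exists (fun e => a e + b e); [exact: coefD|move=> e; rewrite ea eb scalerDl].
  + have [b cb eb] := IH e0.
    by exists (fun e => a e * b e); [exact: coefM|move=> e; rewrite eb scalerA].
  + by have [b cb eb] := IH e0; exists b => // e; rewrite -eq.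
by move=> /gen; apply.
Qed.

(** Nonempty words in the X^- are killed by l, so l reads off the coefficient of v. Since [spanT] is
    stable under all generators, every matrix coefficient of this kind lies in the ring [coef]. *)
Lemma span_functional (l : forall e, 'rV[F]_(n e)) f :
  (forall e, l e *m v e = 1%:M) -> (forall e t, l e *m rho e (gX false t) = 0) ->
  spanT f -> exists2 a, coef a & forall e, l e *m f e = (a e)%:M.
Proof.
move=> lv lX; elim=> {f} [m f|f f' _ [a ca ea] _ [b cb eb]|f f' _ [a ca ea] eq].
- elim=> {m f} [|m|m t f hf _|m f g _ [a ca ea] _ [b cb eb]|m b f hb _ [a ca ea]|m f g _ [a ca ea] eq] //.
  + by exists (fun=> 1).
  + by exists (fun=> 0) => // e; rewrite mulmx0 raddf0.
  + exists (fun=> 0) => // e; rewrite /act mulmxA lX mul0mx; by rewrite raddf0.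
  + by exists (fun e => a e + b e); [exact: coefD|move=> e; rewrite mulmxDr ea eb raddfD].
  + by exists (fun e => b e * a e); [exact: coefM|move=> e; rewrite -scalemxAr ea scale_scalar_mx].
  + by exists a => // e; rewrite -eq.
- by exists (fun e => a e + b e); [exact: coefD|move=> e; rewrite mulmxDr ea eb raddfD].
- by exists a => // e; rewrite -eq.
Qed.

End Family.

Lemma eigen_indep n (K : 'M[F]_n) (y : nat -> 'cV_n) (mu : nat -> F) M :
  injective mu -> (forall i, K *m y i = mu i *: y i) ->
  \sum_(i < M) y i = 0 -> forall i, (i < M)%N -> y i = 0.
Proof.
move=> mu_inj; elim: M y => [//|M IH] y Ky sum0 i iM.
(* K - mu_M removes the last summand and multiplies the others by nonzero scalars. *)
have yM j : (j < M)%N -> y j = 0.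
  move=> jM; have /eqP : (mu j - mu M) *: y j = 0.
    apply: (IH (fun i => (mu i - mu M) *: y i)) => // [k|].
      by rewrite -scalemxAr Ky !scalerA mulrC.
    have /(congr1 (fun z => K *m z - mu M *: z)) := sum0.
    rewrite mulmx0 scaler0 subr0 mulmx_sumr scaler_sumr -sumrB big_ord_recr /=.
    rewrite Ky subrr addr0 => h; rewrite -[RHS]h; apply: eq_bigr => k _.
      by rewrite Ky scalerBl.
  rewrite scaler_eq0 subr_eq0 => /orP[/eqP/mu_inj e|/eqP//].
  by rewrite e ltnn in jM.
move: sum0; rewrite big_ord_recr /= big1 => [|j _]; last exact: yM.
rewrite add0r => yM0; move: iM; rewrite ltnS leq_eqVlt => /orP[/eqP->//|].
exact: yM.
Qed.

Lemma eigen_component n (K : 'M[F]_n) (x : 'cV_n) (y : nat -> 'cV_n) (mu : nat -> F) M m :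
  injective mu -> (forall i, K *m y i = mu i *: y i) ->
  x = \sum_(i < M) y i -> K *m x = mu m *: x ->
  forall i, (i < M)%N -> i != m -> y i = 0.
Proof.
move=> mu_inj Ky ex Kx i iM im.
have /eqP : (mu i - mu m) *: y i = 0.
  apply: (@eigen_indep n K (fun i => (mu i - mu m) *: y i) mu M) => // [k|].
    by rewrite -scalemxAr Ky !scalerA mulrC.
  transitivity (K *m x - mu m *: x); last by rewrite Kx subrr.
  rewrite {1 2}ex mulmx_sumr scaler_sumr -sumrB; apply: eq_bigr => k _.
  by rewrite Ky scalerBl.
rewrite scaler_eq0 subr_eq0 => /orP[/eqP/mu_inj e|/eqP//].
by rewrite e eqxx in im.
Qed.

Lemma eigen_pick n (K : 'M[F]_n) (x : 'cV_n) (y : nat -> 'cV_n) (mu : nat -> F) M m :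
  injective mu -> (forall i, K *m y i = mu i *: y i) ->
  (forall i, (M <= i)%N -> y i = 0) ->
  x = \sum_(i < M) y i -> K *m x = mu m *: x -> x = y m.
Proof.
move=> mu_inj Ky y0 ex Kx; have h := eigen_component mu_inj Ky ex Kx.
case: (ltnP m M) => [mM|Mm].
  rewrite ex (bigD1 (Ordinal mM)) //= big1 ?addr0 // => i; rewrite -val_eqE /= => im.
  exact: h.
rewrite (y0 m Mm) ex big1 // => i _; apply: h => //.
by apply/eqP => im; rewrite -im leqNgt ltn_ord in Mm.
Qed.

(** The characteristic polynomial cannot have n + 1 distinct roots. This is how finite dimension
    bounds chains of weights. *)
Lemma exists_non_eigenvalue n (K : 'M[F]_n) (mu : nat -> F) : injective mu ->
  exists m, forall x : 'cV_n, K *m x = mu m *: x -> x = 0.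
Proof.
move=> mu_inj; apply: contrapT => no.
have ev m : root (char_poly K^T) (mu m).
  rewrite -eigenvalue_root_char; apply: contrapT => /negP nev.
  apply: no; exists m => x Kx; apply: contrapT => /eqP x0; move/eigenvalueP: nev; apply.
  exists x^T; last by rewrite trmx_eq0.
  by rewrite -trmx_mul Kx linearZ.
have := max_poly_roots (monic_neq0 (char_poly_monic K^T)) (rs := [seq mu i | i <- iota 0 n.+1]).
rewrite size_char_poly size_map size_iota ltnn; move=> h.
have : false; last by []. apply: h; last by rewrite map_inj_uniq ?iota_uniq.
by apply/allP => z /mapP[i _ ->]; exact: ev.
Qed.
End HighestWeight.

(** * Uniqueness of simple highest weight modules *)

Section LinearAlgebra.
Variable F : fieldType.

Lemma subspace_mx n (Q : 'cV[F]_n -> Prop) :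
  Q 0 -> (forall x y, Q x -> Q y -> Q (x + y)) -> (forall a x, Q x -> Q (a *: x)) ->
  exists U : 'M[F]_n, forall x, Q x <-> (x^T <= U)%MS.
Proof.
move=> Q0 QD QZ.
(* The codimension of U, bounded by d, drops whenever a vector of Q outside U is adjoined. *)
have grow d (U : 'M[F]_n) : (forall x, (x^T <= U)%MS -> Q x) -> (n - \rank U <= d)%N ->
    exists U : 'M[F]_n, forall x, Q x <-> (x^T <= U)%MS.
  elim: d U => [|d IH] U QU dU.
    exists U => x; split=> [_|]; last exact: QU.
    apply: submx_full; rewrite /row_full eqn_leq rank_leq_col -subn_eq0; lia.
  case: (EM (forall x, Q x -> (x^T <= U)%MS)) => [UQ|].
    by exists U => x; split; [exact: UQ|exact: QU].
  move=> /existsNP[x] /not_implyP[Qx /negP nx].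
  apply: (IH (U + x^T)%MS) => [y|].
    move=> /sub_addsmxP[[a b] /= ey].
    have -> : y = (a *m U)^T + b 0 0 *: x.
      have eb : b *m x^T = b 0 0 *: x^T by rewrite {1}[b]mx11_scalar mul_scalar_mx.
      by rewrite -[y]trmxK ey eb linearD linearZ /= trmxK.
    apply: QD; last exact: QZ.
    by apply: QU; rewrite trmxK submxMl.
  have : (\rank U < \rank (U + x^T)%MS)%N.
    rewrite ltn_neqAle mxrankS ?addsmxSl // andbT; apply: contra nx => /eqP er.
    have /eqmxP : (U == U + x^T)%MS by rewrite -(mxrank_leqif_eq (addsmxSl _ _)) er.
    by move=> e; rewrite (submx_trans (addsmxSr U _)) // e.
  have := rank_leq_col (U + x^T)%MS; lia.
apply: (grow n 0); last by rewrite leq_subr.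
by move=> x; rewrite submx0 trmx_eq0 => /eqP ->.
Qed.

(** The columns are chosen partners of the basis vectors; linearity of G carries the relation to all
    x. *)
Lemma graph_mx a b (G : 'cV[F]_a -> 'cV[F]_b -> Prop) :
  G 0 0 -> (forall x y x' y', G x y -> G x' y' -> G (x + x') (y + y')) ->
  (forall s x y, G x y -> G (s *: x) (s *: y)) -> (forall x, exists y, G x y) ->
  exists P : 'M[F]_(b, a), forall x, G x (P *m x).
Proof.
move=> G0 GD GZ /choice[f Gf].
exists (\matrix_(i, j) f (delta_mx j 0) i 0) => x.
have -> : \matrix_(i, j) f (delta_mx j 0) i 0 *m x = \sum_j x j 0 *: f (delta_mx j 0).
  apply/matrixP => i j; rewrite (ord1 j) mxE summxE; apply: eq_bigr => k _.
  by rewrite !mxE mulrC.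
have ex : x = \sum_j x j 0 *: delta_mx j 0.
  by rewrite {1}[x]matrix_sum_delta; apply: eq_bigr => i _; rewrite big_ord1.
by rewrite {1}ex; elim/big_ind2: _ => // [* |i _]; [exact: GD|exact: GZ].
Qed.
End LinearAlgebra.

Section Simple.
Variables (F : numClosedFieldType) (q : F).
Hypotheses (hq0 : q != 0) (hq : forall m : nat, (0 < m)%N -> q ^+ m != 1).
Local Notation c := (cX q false).

Definition simplerep n (rho : gen -> 'M[F]_n) :=
  (0 < n)%N /\ forall U : 'M[F]_n,
    (forall g, (U *m (rho g)^T <= U)%MS) -> (\rank U == 0)%N || row_full U.

Lemma simple_dichotomy n (rho : gen -> 'M[F]_n) (Q : 'cV[F]_n -> Prop) :
  simplerep rho ->
  Q 0 -> (forall x y, Q x -> Q y -> Q (x + y)) -> (forall a x, Q x -> Q (a *: x)) ->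
  (forall g x, Q x -> Q (rho g *m x)) ->
  (forall x, Q x -> x = 0) \/ (forall x, Q x).
Proof.
move=> [n0 sim] Q0 QD QZ Qg; have [U QU] := subspace_mx Q0 QD QZ.
have /sim/orP[] : forall g, (U *m (rho g)^T <= U)%MS.
- move=> g; apply/row_subP => i; rewrite row_mul -[_ *m _]trmxK trmx_mul trmxK.
  by apply/QU/Qg/QU; rewrite trmxK row_sub.
- rewrite mxrank_eq0 => /eqP U0; left=> x /QU; rewrite U0 submx0 trmx_eq0.
  by move/eqP.
- by move=> full; right=> x; apply/QU; exact: submx_full.
Qed.

Section Pair.
Variables (n : bool -> nat) (rho : forall e, gen -> 'M[F]_(n e)).
Variables (v : forall e, 'cV[F]_(n e)) (lam : F) (u : nat -> F).
Hypothesis H : forall e, isrep q (@rho e).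
Hypothesis Hv : forall e, hwvec (@rho e) (v e) lam u.
Hypothesis Hs : forall e, simplerep (rho e).

Local Notation cst := (fun a : bool -> F => exists a0, forall e, a e = a0).
Local Notation S := (spanT rho v cst).

Let coefD a b : cst a -> cst b -> cst (fun e => a e + b e).
Proof. by move=> [a0 ea] [b0 eb]; exists (a0 + b0) => e; rewrite ea eb. Qed.
Let coefM a b : cst a -> cst b -> cst (fun e => a e * b e).
Proof. by move=> [a0 ea] [b0 eb]; exists (a0 * b0) => e; rewrite ea eb. Qed.
Let coefC (a : F) : cst (fun=> a). Proof. by exists a. Qed.

Let S_act g f : S f -> S (act rho g f).
Proof.
by apply: (spanT_act hq0 (lam := fun=> lam) (u := fun=> u)); rewrite //=; eauto.
Qed.
Let S_D f g : S f -> S g -> S (fun e => f e + g e). Proof. exact: spanT_D. Qed.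
Let S_Z (a : F) f : S f -> S (fun e => a *: f e). Proof. exact: spanT_Z. Qed.
Let S_0 : S (fun=> 0). Proof. by apply: spanT_span (span_0 _ _ _ 0). Qed.
Let S_v : S v. Proof. by apply: spanT_span (span_v _ _ _). Qed.

Lemma pair_onto e x : exists2 f, S f & f e = x.
Proof.
have [||||h|//] := @simple_dichotomy _ (rho e) (fun x => exists2 f, S f & f e = x) (Hs e).
- by exists (fun=> 0).
- by move=> _ _ [f Sf <-] [g Sg <-]; exists (fun e => f e + g e) => //; exact: S_D.
- by move=> a _ [f Sf <-]; exists (fun e => a *: f e) => //; exact: S_Z.
- by move=> g _ [f Sf <-]; exists (act rho g f) => //; exact: S_act.
- have [] := Hv e; rewrite (h (v e)) ?eqxx //; by exists v.
Qed.

(** The partners of 0 form a submodule of the other simple factor. Were it everything, S would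
    contain the pair of 0 and v; its weight puts it in degree 0, where S has only constant multiples
    of the pair of highest weight vectors, and the zero entry makes the constant zero. *)
Lemma pair_inj e f : S f -> f e = 0 -> f (~~ e) = 0.
Proof.
move=> Sf fe.
have [||||h|h] := @simple_dichotomy _ (rho (~~ e))
   (fun x => exists f, [/\ S f, f e = 0 & f (~~ e) = x]) (Hs (~~ e)).
- by exists (fun=> 0).
- move=> _ _ [f1 [Sf1 e1 <-]] [f2 [Sf2 e2 <-]]; exists (fun e => f1 e + f2 e).
  by split=> //; [exact: S_D|rewrite e1 e2 addr0].
- move=> a _ [f1 [Sf1 e1 <-]]; exists (fun e => a *: f1 e).
  by split=> //; [exact: S_Z|rewrite e1 scaler0].
- move=> g _ [f1 [Sf1 e1 <-]]; exists (act rho g f1).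
  by split=> //; [exact: S_act|rewrite /act e1 mulmx0].
- by apply: h; exists f.
have [g [Sg ge gv]] := h (v (~~ e)).
have [y [M [y1 y2 y3]]] := spanT_decomp Sg.
have mu_inj : injective (fun i => lam * c ^+ i).
  have l0 := @hw_lam_neq0 F q bool n rho v (fun=> lam) (fun=> u) H Hv e.
  by move=> i j /(mulfI l0) /(cX_exp_inj hq0 hq).
have g0 e' : g e' = y 0%N e'.
  apply: (eigen_pick (K := rho e' gK) mu_inj _ (fun i Mi => y2 i Mi e') (y3 e')) => [i|].
    exact: (span_weight (lam := fun=> lam) (u := fun=> u) H Hv (y1 i)).
  rewrite mulr1; case: (eqVneq e' e) => [->|]; first by rewrite ge mulmx0 scaler0.
  move=> ne; have -> : e' = ~~ e by case: e' e ne {ge gv fe h} => [] [].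
  by rewrite gv; case: (Hv (~~ e)).
have [a [a0 ea] ey] := span0P coefC coefD coefM (y1 0%N).
have := ge; rewrite g0 ey => /eqP; rewrite scaler_eq0.
have [/negPf-> _ _ _] := Hv e; rewrite orbF ea => /eqP a00.
have := gv; rewrite g0 ey ea a00 scale0r; have [/eqP h' _ _ _] := Hv (~~ e).
by move/esym.
Qed.

(* The submodule generated by (v true, v false) is the graph of an isomorphism. *)
Lemma pair_iso : exists (P : 'M[F]_(n false, n true)) (Q : 'M[F]_(n true, n false)),
  [/\ P *m Q = 1%:M, Q *m P = 1%:M & forall g, P *m rho true g = rho false g *m P].
Proof.
pose G x y := exists f, [/\ S f, f true = x & f false = y].
have G0 : G 0 0 by exists (fun=> 0).
have GD x y x' y' : G x y -> G x' y' -> G (x + x') (y + y').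
  by move=> [f [Sf <- <-]] [g [Sg <- <-]]; exists (fun e => f e + g e); split=> //; exact: S_D.
have GZ a x y : G x y -> G (a *: x) (a *: y).
  by move=> [f [Sf <- <-]]; exists (fun e => a *: f e); split=> //; exact: S_Z.
have Gg g x y : G x y -> G (rho true g *m x) (rho false g *m y).
  by move=> [f [Sf <- <-]]; exists (act rho g f); split=> //; exact: S_act.
have Gr y : G 0 y -> y = 0 by move=> [f [Sf e <-]]; exact: pair_inj e.
have Gl x : G x 0 -> x = 0 by move=> [f [Sf <- e]]; exact: (pair_inj (e := false)) e.
have [P GP] : exists P : 'M[F]_(n false, n true), forall x, G x (P *m x).
  by apply: graph_mx => // x; have [f Sf <-] := pair_onto x; exists (f false), f.
have [Q GQ] : exists Q : 'M[F]_(n true, n false), forall y, G (Q *m y) y.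
  apply: (graph_mx (G := fun x y => G y x)) => // [x y x' y'|s x y|y].
  - exact: GD.
  - exact: GZ.
  - by have [f Sf <-] := @pair_onto false y; exists (f true), f.
have G_r x y y' : G x y -> G x y' -> y = y'.
  move=> h /(GZ (-1)) h'; apply/subr0_eq/Gr.
  by have := GD _ _ _ _ h h'; rewrite !scaleN1r subrr.
have G_l x x' y : G x y -> G x' y -> x = x'.
  move=> h /(GZ (-1)) h'; apply/subr0_eq/Gl.
  by have := GD _ _ _ _ h h'; rewrite !scaleN1r subrr.
have ext a b (A B : 'M[F]_(a, b)) : (forall x : 'cV_b, A *m x = B *m x) -> A = B.
  by move=> h; apply/trmx_inj/row_matrixP => i; rewrite -!tr_col !colE h.
exists P, Q; split=> [||g]; apply: ext => x.
- by rewrite -mulmxA mul1mx; exact: G_r (GP _) (GQ _).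
- by rewrite -mulmxA mul1mx; exact: G_l (GQ _) (GP _).
- by rewrite -!mulmxA; apply: G_r (GP _) (Gg _ _ _ (GP _)).
Qed.
End Pair.

Lemma hw_simple_iso n1 n2 (rho1 : gen -> 'M[F]_n1) (rho2 : gen -> 'M[F]_n2) v1 v2 lam u :
  isrep q rho1 -> isrep q rho2 -> simplerep rho1 -> simplerep rho2 ->
  hwvec rho1 v1 lam u -> hwvec rho2 v2 lam u ->
  exists (P : 'M[F]_(n2, n1)) (Q : 'M[F]_(n1, n2)),
  [/\ P *m Q = 1%:M, Q *m P = 1%:M & forall g, P *m rho1 g = rho2 g *m P].
Proof.
move=> H1 H2 S1 S2 V1 V2.
pose n (b : bool) := if b then n1 else n2.
pose rho b : gen -> 'M[F]_(n b) := match b with true => rho1 | false => rho2 end.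
pose v b : 'cV[F]_(n b) := match b with true => v1 | false => v2 end.
by apply: (@pair_iso n rho v lam u) => -[].
Qed.
End Simple.

(** * Existence of highest weight vectors; subquotients *)

(** Induction on the rank of U, which handles infinitely many matrices at once: either every A_t is
    scalar on U, or an eigenspace of some A_t meets U in a smaller nonzero subspace, stable because
    the family commutes. *)
Lemma common_eigenvector_sub (F : numClosedFieldType) n (A : nat -> 'M[F]_n) (U : 'M[F]_n) :
  (forall s t, A s *m A t = A t *m A s) -> U != 0 -> (forall t, (U *m A t <= U)%MS) ->
  exists x : 'rV_n, [/\ x != 0, (x <= U)%MS & forall t, exists a, x *m A t = a *: x].
Proof.
move=> AC; have [d] := ubnP (\rank U); elim: d U => // d IH U; rewrite ltnS => dU U0 UA.
have r0 : (0 < \rank U)%N by rewrite lt0n mxrank_eq0.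
case: (EM (forall t, exists a, U *m A t = a *: U)) => [sc|].
  have /rowV0Pn[x xU x0] := U0; exists x; split=> // t; have [a ea] := sc t.
  exists a; have /submxP[y ->] := xU; by rewrite -mulmxA ea scalemxAr.
move=> /existsNP[t nsc].
pose B := row_base U.
have BA : B *m A t = (B *m A t *m pinvmx B) *m B.
  rewrite mulmxKpV // eq_row_base (eqmxMr _ (eq_row_base U)); exact: UA.
have [a /eigenvalueP[z ez z0]] := eigenvalue_closed (B *m A t *m pinvmx B) r0.
pose V := (U :&: eigenspace (A t) a)%MS.
have xV : (z *m B <= V)%MS.
  rewrite sub_capmx (submx_trans (submxMl z B)) ?eq_row_base //=.
  by apply/eigenspaceP; rewrite -mulmxA BA mulmxA ez scalemxAl.
have V0 : V != 0.
  apply: contra z0 => /eqP e; move: xV; rewrite e submx0 mulmx_free_eq0 //.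
  exact: row_base_free.
have VU : (V <= U)%MS by rewrite capmxSl.
have VE : (V <= eigenspace (A t) a)%MS by rewrite capmxSr.
have [|s|x [x0 xVx ex]] := IH V _ V0.
- apply: leq_trans dU; rewrite ltn_neqAle mxrankS // andbT; apply/eqP => er.
  have e : (V == U)%MS by rewrite -(mxrank_leqif_eq VU) er.
  apply: nsc; exists a; apply/eigenspaceP.
  by rewrite -(eqmxP e).
- rewrite sub_capmx (submx_trans (submxMr _ VU) (UA s)) /=.
  apply/eigenspaceP; rewrite -mulmxA AC mulmxA.
  by move/eigenspaceP: VE => ->; rewrite scalemxAl.
by exists x; split=> //; exact: submx_trans xVx VU.
Qed.

Lemma last_true (P : nat -> Prop) m : P 0%N -> ~ P m -> exists2 k, P k & ~ P k.+1.
Proof.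
elim: m => [//|m IH] P0 nP; case: (EM (P m)) => [Pm|/(IH P0)//].
by exists m.
Qed.

Section Modules.
Variables (F : numClosedFieldType) (q : F).
Hypotheses (hq0 : q != 0) (hq : forall m : nat, (0 < m)%N -> q ^+ m != 1).
Local Notation c := (cX q false).

(** X^+_t multiplies K-eigenvalues by q^2. The chain mu q^(2i) contains an eigenvalue whose
    successor is not one; its eigenspace is killed by all X^+_t, and the commuting J_t have a common
    eigenvector there. *)
Lemma exists_hwvec n (rho : gen -> 'M[F]_n) : isrep q rho -> (0 < n)%N ->
  exists v lam u, hwvec rho v lam u.
Proof.
move=> H n0; have [mu /eigenvalueP[x ex x0]] := eigenvalue_closed (rho gK)^T n0.
have Kx : rho gK *m x^T = mu *: x^T by rewrite -[rho gK]trmxK -trmx_mul ex linearZ.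
have mu0 : mu != 0.
  apply: contra x0 => /eqP m0; move: Kx; rewrite m0 scale0r => /(congr1 (mulmx (rho gKm))).
  by rewrite mulmxA (KmK H) mul1mx mulmx0 => /eqP; rewrite trmx_eq0.
pose m i := mu * cX q true ^+ i.
have m_inj : injective m by move=> i j /(mulfI mu0) /(cX_exp_inj hq0 hq).
pose P i := exists2 y : 'cV_n, y != 0 & rho gK *m y = m i *: y.
have [i0 ni0] := exists_non_eigenvalue (rho gK) m_inj.
have [||i [y y0 Ky] nP] := @last_true P i0.
- by exists x^T; rewrite ?trmx_eq0 // /m mulr1.
- by move=> [y y0 /ni0 /eqP]; apply/negP.
pose U := eigenspace (rho gK)^T (m i).
have UE z : (z <= U)%MS -> rho gK *m z^T = m i *: z^T.
  by move=> /eigenspaceP e; rewrite -[rho gK]trmxK -trmx_mul e linearZ.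
have [|||z [z0 zU ez]] := @common_eigenvector_sub F n (fun t => (rho (gJ t))^T) U.
- by move=> s t; rewrite -!trmx_mul (JJ H).
- apply/rowV0Pn; exists y^T; rewrite ?trmx_eq0 //.
  by apply/eigenspaceP; rewrite -trmx_mul Ky linearZ.
- move=> t; apply/eigenspaceP; rewrite -mulmxA -trmx_mul (KJ H) trmx_mul mulmxA.
  have -> : U *m (rho gK)^T = m i *: U by apply/eigenspaceP.
  by rewrite -scalemxAl.
have [u eu] := choice ez.
exists z^T, (m i), u; split=> [|t||t].
- by rewrite trmx_eq0.
- apply: contrapT => /eqP nz; apply: nP; exists (rho (gX true t) *m z^T) => //.
  rewrite mulmxA (KX H) -scalemxAl -mulmxA UE // -scalemxAr scalerA; congr (_ *: _).
  by rewrite /m exprS mulrCA.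
- exact: UE.
- by rewrite -[rho _]trmxK -trmx_mul eu linearZ.
Qed.

Section Single.
Variables (n : nat) (rho : gen -> 'M[F]_n) (v : 'cV[F]_n) (lam : F) (u : nat -> F).
Hypothesis H : isrep q rho.
Hypothesis Hv : hwvec rho v lam u.
Local Notation any := (fun _ : unit -> F => True).

(** The case of a single module and unrestricted coefficients: the combinations of words of length m
    in the X^-_t applied to v. *)
Definition wspace (m : nat) (x : 'cV[F]_n) : Prop :=
  @span F unit (fun=> n) (fun=> rho) (fun=> v) any m (fun=> x).

Lemma weights_inj : injective (fun i => lam * c ^+ i).
Proof.
have l0 := @hw_lam_neq0 F q unit (fun=> n) (fun=> rho) (fun=> v) (fun=> lam) (fun=> u)
  (fun=> H) (fun=> Hv) tt.
by move=> i j /(mulfI l0) /(cX_exp_inj hq0 hq).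
Qed.

Lemma hw_lam0 : lam != 0.
Proof.
exact: @hw_lam_neq0 F q unit (fun=> n) (fun=> rho) (fun=> v) (fun=> lam) (fun=> u)
  (fun=> H) (fun=> Hv) tt.
Qed.

Lemma wspace_weight m x : wspace m x -> rho gK *m x = (lam * c ^+ m) *: x.
Proof.
by move=> h; apply: (span_weight (lam := fun=> lam) (u := fun=> u) _ _ h tt).
Qed.

Lemma wspace_v : wspace 0 v. Proof. exact: span_v. Qed.
Lemma wspace_0 m : wspace m 0. Proof. exact: span_0. Qed.
Lemma wspace_D m x y : wspace m x -> wspace m y -> wspace m (x + y).
Proof. by move=> hx hy; exact: (span_D hx hy). Qed.
Lemma wspace_Z m a x : wspace m x -> wspace m (a *: x).
Proof. by move=> hx; exact: (span_Z (a := fun=> a) I hx). Qed.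
Lemma wspace_X m t x : wspace m x -> wspace m.+1 (rho (gX false t) *m x).
Proof. by move=> hx; exact: (span_X t hx). Qed.
Lemma wspace_J m s x : wspace m x -> wspace m (rho (gJ s) *m x).
Proof.
move=> hx.
by apply: (span_J hq0 (lam := fun=> lam) (u := fun=> u) _ _ _ _ hx s).
Qed.
Lemma wspace_Xp m s x : wspace m.+1 x -> wspace m (rho (gX true s) *m x).
Proof.
move=> hx.
by have [_ h] := span_Xp hq0 (coef := any) (lam := fun=> lam) (u := fun=> u) (fun=> H) (fun=> Hv)
  (fun=> I) (fun _ _ _ _ => I) I (fun=> I) hx s.
Qed.
Lemma wspace_Xp0 s x : wspace 0 x -> rho (gX true s) *m x = 0.
Proof.
move=> hx.
have [h _] := span_Xp hq0 (coef := any) (lam := fun=> lam) (u := fun=> u) (fun=> H) (fun=> Hv)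
  (fun=> I) (fun _ _ _ _ => I) I (fun=> I) hx s.
exact: (h erefl tt).
Qed.
Lemma wspace0P x : wspace 0 x -> exists a, x = a *: v.
Proof.
by move=> hx; have [a _ h] := span0P (coef := any) (fun=> I) (fun _ _ _ _ => I) (fun _ _ _ _ => I) hx; exists (a tt); exact: (h tt).
Qed.

Hypothesis Hs : simplerep rho.

Lemma wspace_decomp x : exists (y : nat -> 'cV_n) (M : nat),
  [/\ forall i, wspace i (y i), forall i, (M <= i)%N -> y i = 0 & x = \sum_(i < M) y i].
Proof.
have [] := @simple_dichotomy F n rho (fun x => @spanT F unit (fun=> n) (fun=> rho)
   (fun=> v) any (fun=> x)) Hs.
- exact: (spanT_span (span_0 (fun=> rho) (fun=> v) any 0)).
- by move=> y z hy hz; exact: (spanT_D hy hz).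
- by move=> a y hy; exact: (spanT_Z _ a hy).
- move=> g y hy.
  by apply: (spanT_act hq0 (lam := fun=> lam) (u := fun=> u) _ _ _ _ _ _ _ g hy).
- move=> h; have [/eqP v0 _ _ _] := Hv; case: v0; apply: h; exact: (spanT_span (span_v (fun=> rho) (fun=> v) any)).
move=> /(_ x) /spanT_decomp[g [M [g1 g2 g3]]].
exists (fun i => g i tt), M; split=> [i|i Mi|].
- by apply: span_eq (g1 i) _ => -[].
- exact: g2.
- exact: (g3 tt).
Qed.

Lemma wspace_of_weight m x : rho gK *m x = (lam * c ^+ m) *: x -> wspace m x.
Proof.
move=> Kx; have [y [M [y1 y2 y3]]] := wspace_decomp x.
rewrite (eigen_pick weights_inj _ y2 y3 Kx) // => i; exact: wspace_weight.
Qed.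

Lemma weight_shape (x : 'cV_n) mu : x != 0 -> rho gK *m x = mu *: x ->
  exists m, mu = lam * c ^+ m.
Proof.
move=> x0 Kx; have [y [M [y1 y2 y3]]] := wspace_decomp x.
apply: contrapT => no; case/eqP: x0; rewrite y3 big1 // => i _.
have /eqP : (lam * c ^+ i - mu) *: y i = 0.
  apply: (@eigen_indep F n (rho gK) (fun j => (lam * c ^+ j - mu) *: y j) _ M weights_inj).
  - by move=> j; rewrite -scalemxAr (wspace_weight (y1 j)) !scalerA mulrC.
  - transitivity (rho gK *m x - mu *: x); last by rewrite Kx subrr.
    rewrite {1 2}y3 mulmx_sumr scaler_sumr -sumrB; apply: eq_bigr => j _.
    by rewrite (wspace_weight (y1 j)) scalerBl.
  - by [].
rewrite scaler_eq0 subr_eq0 => /orP[/eqP e|/eqP//].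
by case: no; exists i.
Qed.
End Single.

(** Each highest weight lies in the chain of the other, lam' = lam c^m and lam = lam' c^m', so m +
    m' = 0. The top weight space being a line, the two vectors are proportional. *)
Lemma hw_unique n (rho : gen -> 'M[F]_n) v lam u v' lam' u' :
  isrep q rho -> simplerep rho -> hwvec rho v lam u -> hwvec rho v' lam' u' ->
  lam = lam' /\ forall t, u t = u' t.
Proof.
move=> H Hs V V'; have [v0 Xv Kv Jv] := V; have [v0' Xv' Kv' Jv'] := V'.
have [m em] := weight_shape H V Hs v0' Kv'.
have [m' em'] := weight_shape H V' Hs v0 Kv.
have l0 := hw_lam0 H V.
have mm0 : (m' + m)%N = 0%N.
  apply: (weights_inj H V); rewrite expr0 mulr1 {2}em' em -mulrA -exprD addnC //.
have m0 : m = 0%N by lia.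
have el : lam = lam' by rewrite em m0 mulr1.
split=> // t; have Kv2 : rho gK *m v' = (lam * c ^+ 0) *: v' by rewrite mulr1 el.
have [a ea] := wspace0P (wspace_of_weight H V Hs Kv2).
have := Jv' t; rewrite {1}ea -scalemxAr Jv scalerA mulrC -scalerA -ea => /eqP.
by rewrite -subr_eq0 -scalerBl scaler_eq0 (negPf v0') orbF subr_eq0 => /eqP.
Qed.

Lemma opw_intertwine n1 n2 (rho1 : gen -> 'M[F]_n1) (rho2 : gen -> 'M[F]_n2)
    (P : 'M[F]_(n2, n1)) : (forall g, P *m rho1 g = rho2 g *m P) ->
  forall w, P *m opw rho1 w = opw rho2 w *m P.
Proof.
move=> h; elim=> [|g w IH] /=; first by rewrite mulmx1 mul1mx.
by rewrite mulmxA h -!mulmxA IH.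
Qed.

Lemma opl_intertwine n1 n2 (rho1 : gen -> 'M[F]_n1) (rho2 : gen -> 'M[F]_n2)
    (P : 'M[F]_(n2, n1)) : (forall g, P *m rho1 g = rho2 g *m P) ->
  forall L, P *m opl rho1 L = opl rho2 L *m P.
Proof.
move=> h L; rewrite /opl mulmx_sumr mulmx_suml; apply: eq_bigr => p _.
by rewrite -scalemxAr (opw_intertwine h) scalemxAl.
Qed.

Lemma hw_restrict n (rho : gen -> 'M[F]_n) v lam u (U : 'M[F]_n) :
  isrep q rho -> hwvec rho v lam u -> (forall g, (U *m (rho g)^T <= U)%MS) ->
  (v^T <= U)%MS ->
  exists (rho' : gen -> 'M[F]_(\rank U)) v', isrep q rho' /\ hwvec rho' v' lam u.
Proof.
move=> H [v0 Xv Kv Jv] inv vU; pose B := row_base U.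
pose rho' g := (B *m (rho g)^T *m pinvmx B)^T.
have free : row_free B := row_base_free U.
have h g : B^T *m rho' g = rho g *m B^T.
  rewrite -trmx_mul mulmxKpV ?trmx_mul ?trmxK // eq_row_base (eqmxMr _ (eq_row_base U)).
  exact: inv.
have inj m (A A' : 'M_(_, m)) : B^T *m A = B^T *m A' -> A = A'.
  move=> /(congr1 trmx); rewrite !trmx_mul !trmxK => /(row_free_inj free).
  exact: trmx_inj.
have /submxP[w ew] : (v^T <= B)%MS by rewrite eq_row_base.
have ev : v = B^T *m w^T by rewrite -trmx_mul -ew trmxK.
exists rho', w^T; split=> [L RL|].
  by apply: inj; rewrite (opl_intertwine h) H // mul0mx mulmx0.
split=> [|t||t].
- by apply: contra v0 => /eqP e; rewrite ev e mulmx0.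
- by apply: inj; rewrite mulmxA h -mulmxA -ev Xv mulmx0.
- by apply: inj; rewrite mulmxA h -mulmxA -scalemxAr -ev.
- by apply: inj; rewrite mulmxA h -mulmxA -scalemxAr -ev.
Qed.

Lemma hw_quotient n (rho : gen -> 'M[F]_n) v lam u (U : 'M[F]_n) :
  isrep q rho -> hwvec rho v lam u -> (forall g, (U *m (rho g)^T <= U)%MS) ->
  ~~ (v^T <= U)%MS ->
  exists (rho' : gen -> 'M[F]_(\rank (cokermx U))) v', isrep q rho' /\ hwvec rho' v' lam u.
Proof.
(* Right multiplication by [B] projects row vectors onto the quotient by U; its section [L] gives
   the induced action. *)
move=> H [v0 Xv Kv Jv] inv vU; pose B := col_base (cokermx U).
have full : row_full B := col_base_full _.
have UB m (A : 'M_(m, n)) : (A <= U)%MS = (A *m B == 0).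
  have eB : B *m row_base (cokermx U) = cokermx U by exact: mulmx_base.
  have -> : (A <= U)%MS = (A *m (B *m row_base (cokermx U)) == 0) by rewrite eB submxE.
  by rewrite mulmxA mulmx_free_eq0 // row_base_free.
pose L := pinvmx B.
have LB : L *m B = 1%:M by rewrite mulVpmx.
pose rho' g := (L *m (rho g)^T *m B)^T.
have h g : B^T *m rho g = rho' g *m B^T.
  rewrite -[rho g]trmxK -!trmx_mul; congr trmx.
  have : ((1%:M - B *m L) *m (rho g)^T <= U)%MS.
    apply: submx_trans (inv g); apply: submxMr.
    by rewrite UB mulmxBl mul1mx -mulmxA LB mulmx1 subrr.
  by rewrite UB !mulmxBl mul1mx subr_eq0 -!mulmxA => /eqP.
have sur m (A A' : 'M_(m, _)) : A *m B^T = A' *m B^T -> A = A'.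
  move=> /(congr1 (fun Z => Z *m L^T)); rewrite -!mulmxA -!trmx_mul LB trmx1.
  by rewrite !mulmx1.
exists rho', (B^T *m v); split=> [W RW|].
  by apply: sur; rewrite -(opl_intertwine h) H // mul0mx mulmx0.
split=> [|t||t].
- apply: contra vU => /eqP e; rewrite UB -[_ *m _]trmxK trmx_mul trmxK e.
  by rewrite trmx0.
- by rewrite mulmxA -h -mulmxA Xv mulmx0.
- by rewrite mulmxA -h -mulmxA Kv scalemxAr.
- by rewrite mulmxA -h -mulmxA Jv scalemxAr.
Qed.

(** Induction on the dimension: a proper nonzero submodule is kept if it contains v and divided out
    otherwise; both preserve the highest weight. *)
Lemma simple_of_hw n (rho : gen -> 'M[F]_n) v lam u :
  isrep q rho -> hwvec rho v lam u ->
  exists n' (rho' : gen -> 'M[F]_n') v', [/\ isrep q rho', simplerep rho' & hwvec rho' v' lam u].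
Proof.
have [d] := ubnP n; elim: d n rho v => // d IH n rho v; rewrite ltnS => nd H V.
have [v0 _ _ _] := V.
case: (EM (simplerep rho)) => [Hs|ns]; first by exists n, rho, v.
have n0 : (0 < n)%N.
  by case: (posnP n) v v0 {V} => // -> v; rewrite [v]flatmx0 eqxx.
have [U [inv ur uf]] : exists U : 'M[F]_n, [/\ forall g, (U *m (rho g)^T <= U)%MS,
    \rank U != 0%N & ~~ row_full U].
  apply: contrapT => no; apply: ns; split=> // U inv; apply: contrapT => /negP.
  by rewrite negb_or => /andP[a b]; apply: no; exists U.
have rn : (\rank U < n)%N by rewrite ltn_neqAle uf rank_leq_col.
case: (boolP (v^T <= U)%MS) => vU.
- have [rho' [v' [H' V']]] := hw_restrict H V inv vU.
  exact: IH (leq_trans rn nd) H' V'.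
- have [rho' [v' [H' V']]] := hw_quotient H V inv vU.
  apply: IH H' V'; rewrite mxrank_coker; lia.
Qed.
End Modules.

(** * The Drinfeld polynomial of a simple module *)

(** Since [Phi f r] looks only below r, the r-th value is stable after r + 1 iterations. *)
Lemma strong_recursion (X : Type) (x0 : X) (Phi : (nat -> X) -> nat -> X) :
  (forall f g r, (forall i, (i < r)%N -> f i = g i) -> Phi f r = Phi g r) ->
  exists E, forall r, E r = Phi E r.
Proof.
move=> loc; pose f n := iter n Phi (fun=> x0).
have st r : forall n, (r < n)%N -> f n r = f r.+1 r.
  have [d] := ubnP r; elim: d r => // d IH r; rewrite ltnS => rd [//|n] rn.
  apply: loc => i ir; transitivity (f i.+1 i); [|symmetry]; apply: IH; lia.
exists (fun r => f r.+1 r) => r; rewrite [LHS]/=; apply: loc => i ir.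
exact: st.
Qed.

(** The coefficients of z a(z). *)
Definition shift (V : zmodType) (a : nat -> V) (r : nat) : V :=
  if r is r'.+1 then a r' else 0.

(** A factor z may be moved from one factor of a product of series to the other. *)
Lemma conv_shift (V W U : zmodType) (f : V -> W -> U) (a : nat -> V) (b : nat -> W) r :
  (forall y, f 0 y = 0) -> (forall x, f x 0 = 0) ->
  \sum_(j < r.+1) f (a j) (shift b (r - j)) = \sum_(j < r.+1) f (shift a j) (b (r - j)%N).
Proof.
move=> f0 f0'; rewrite big_ord_recr /= subnn f0' addr0 big_ord_recl f0 add0r.
by apply: eq_bigr => i _; rewrite /bump /= -[(r - i)%N]prednK ?subn_gt0 //= subnS.
Qed.

Section HighestWeights.
Variables (F : numClosedFieldType) (q : F).
Hypotheses (hq0 : q != 0) (hq : forall m : nat, (0 < m)%N -> q ^+ m != 1).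
Local Notation c := (cX q false).

(** * sl_2-theory for X^+_0, X^-_0 and K *)

Section Sl2.
Variables (n : nat) (rho : gen -> 'M[F]_n).
Hypothesis H : isrep q rho.

Fixpoint xpow (b : bool) (m : nat) (y : 'cV[F]_n) : 'cV[F]_n :=
  if m is m'.+1 then rho (gX b 0) *m xpow b m' y else y.

Lemma xpowD b m x y : xpow b m (x + y) = xpow b m x + xpow b m y.
Proof. by elim: m => //= m ->; rewrite mulmxDr. Qed.
Lemma xpowZ b m a x : xpow b m (a *: x) = a *: xpow b m x.
Proof. by elim: m => //= m ->; rewrite -scalemxAr. Qed.
Lemma xpow0 b m : xpow b m 0 = 0.
Proof. by elim: m => //= m ->; rewrite mulmx0. Qed.

Lemma xpow_weight b m (y : 'cV[F]_n) mu : rho gK *m y = mu *: y ->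
  rho gK *m xpow b m y = (mu * cX q b ^+ m) *: xpow b m y.
Proof.
move=> Ky; elim: m => [|m IH] /=; first by rewrite mulr1.
rewrite mulmxA (KX H) -scalemxAl -mulmxA IH -scalemxAr scalerA exprS.
by rewrite mulrCA.
Qed.

Lemma Km_weight (y : 'cV[F]_n) mu : mu != 0 -> rho gK *m y = mu *: y -> rho gKm *m y = mu^-1 *: y.
Proof.
move=> mu0 Ky; rewrite -[in RHS](mul1mx y) -(KmK H) -(mulmxA _ (rho gK)) Ky.
by rewrite -scalemxAr scalerA mulVf // scale1r.
Qed.

Lemma J0_weight (y : 'cV[F]_n) mu : mu != 0 -> rho gK *m y = mu *: y ->
  (q - q^-1) *: (rho (gJ 0) *m y) = (1 - mu^-1 ^+ 2) *: y.
Proof.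
move=> mu0 Ky; rewrite scalemxAl.
have -> : (q - q^-1) *: rho (gJ 0) = 1%:M - rho gKm *m rho gKm.
  by rewrite (Km2 H) subKr.
rewrite mulmxBl mul1mx -mulmxA (Km_weight mu0 Ky) -scalemxAr (Km_weight mu0 Ky).
by rewrite scalerA scalerBl scale1r expr2.
Qed.

Lemma KJ0_weight (y : 'cV[F]_n) mu : mu != 0 -> rho gK *m y = mu *: y ->
  (q - q^-1) *: (rho gK *m (rho (gJ 0) *m y)) = (mu - mu^-1) *: y.
Proof.
move=> mu0 Ky; rewrite scalemxAr (J0_weight mu0 Ky) -scalemxAr Ky scalerA.
by congr (_ *: _); field.
Qed.

(** The usual product of quantum integers for E F^(m+1) y, with denominators cleared; [b] covers
    both the lowering and the raising orientation. *)
Lemma sl2_string b m (y : 'cV[F]_n) mu : mu != 0 -> rho gK *m y = mu *: y ->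
  rho (gX (~~ b) 0) *m y = 0 ->
  ((q - q^-1) * (1 - cX q b)) *: (rho (gX (~~ b) 0) *m xpow b m.+1 y) =
  (- sgX F b * ((1 - cX q b ^+ m.+1) * (mu - mu^-1 * (cX q b)^-1 ^+ m))) *: xpow b m y.
Proof.
move=> mu0 Ky Xy; have d0 := cX_neq0 hq0 b; set d := cX q b in d0 *.
have swap : rho (gX (~~ b) 0) *m rho (gX b 0) = rho (gX b 0) *m rho (gX (~~ b) 0)
     - sgX F b *: (rho gK *m rho (gJ 0)).
  have := XpXm H 0 0; rewrite add0n; case: (b) => /= ->.
    by rewrite scale1r addrK.
  by rewrite scaleN1r opprK.
have step (z : 'cV[F]_n) (nu : F) : nu != 0 -> rho gK *m z = nu *: z ->
    ((q - q^-1) * (1 - d)) *: (rho (gX (~~ b) 0) *m (rho (gX b 0) *m z)) =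
    rho (gX b 0) *m (((q - q^-1) * (1 - d)) *: (rho (gX (~~ b) 0) *m z)) +
    (- sgX F b * (1 - d) * (nu - nu^-1)) *: z.
  move=> nu0 Kz; rewrite mulmxA swap mulmxBl scalerBr -scalemxAr -mulmxA; congr (_ + _).
  rewrite -scalemxAl scalerA -mulmxA -scaleNr.
  rewrite (_ : - _ = (- sgX F b * (1 - d)) * (q - q^-1)); last by ring.
  by rewrite -[LHS]scalerA (KJ0_weight nu0 Kz) scalerA.
elim: m => [|m IH].
  rewrite [xpow b 1 y]/= (step _ _ mu0 Ky) Xy scaler0 mulmx0 add0r /=; congr (_ *: _).
  by rewrite !expr0 expr1 mulr1 mulrA.
have nu0 : mu * d ^+ m.+1 != 0 by rewrite mulf_neq0 ?expf_neq0.
rewrite [xpow b m.+2 y]/= (step _ _ nu0); last exact: (xpow_weight b m.+1 Ky).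
rewrite IH -scalemxAr -[rho _ *m _]/(xpow b m.+1 y) -scalerDl; congr (_ *: _).
by rewrite !exprVn !exprS; field; rewrite d0 mu0 expf_neq0.
Qed.

(** At the first power that kills y, the left side of the string formula vanishes while its factor 1
    - c_b^(m+1) does not; so the other factor mu - mu^-1 c_b^-m is zero. *)
Lemma sl2_weight b N (y : 'cV[F]_n) mu : mu != 0 -> rho gK *m y = mu *: y ->
  rho (gX (~~ b) 0) *m y = 0 -> y != 0 -> xpow b N y = 0 ->
  exists2 m, (m < N)%N & [/\ xpow b m y != 0, xpow b m.+1 y = 0 & mu ^+ 2 = (cX q b)^-1 ^+ m].
Proof.
move=> mu0 Ky Xy y0 yN.
have [||m /eqP ym yS] := @last_true (fun m => xpow b m y <> 0) N; [exact/eqP|by []|].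
have yS0 : xpow b m.+1 y = 0 by apply: contrapT.
exists m.
  rewrite ltnNge; apply: contra ym => Nm; apply/eqP.
  by rewrite -(subnK Nm); elim: (m - N)%N => //= k ->; rewrite mulmx0.
split=> //; have := sl2_string m mu0 Ky Xy; rewrite yS0 mulmx0 scaler0 => /esym/eqP.
rewrite scaler_eq0 (negPf ym) orbF mulf_eq0 oppr_eq0.
have -> : (sgX F b == 0) = false by case: b {Xy yN ym yS yS0}; rewrite /sgX ?oppr_eq0 oner_eq0.
rewrite mulf_eq0 subr_eq0 eq_sym (negPf (cX_exp_neq1 hq0 hq b (ltn0Sn m))) /=.
by rewrite subr_eq0 => /eqP e; rewrite expr2 {2}e mulrA mulfV // mul1r.
Qed.
End Sl2.

Section PsiOperators.
Variables (n : nat) (rho : gen -> 'M[F]_n) (u : nat -> F).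
Hypothesis H : isrep q rho.
Local Notation Xm t := (rho (gX false t)).

Definition psi_seq (s : nat) : F := if s is _.+1 then (q - q^-1) * u s else 1.
Definition psi_op (s : nat) : 'M[F]_n := if s is _.+1 then (q - q^-1) *: rho (gJ s) else 1%:M.

(** As series, Psi(z) (X_t - c z X_{t+1}) = (X_t - c^-1 z X_{t+1}) Psi(z). The constant term 1 of
    Psi merges the relations of all J_s into one: at j = 1 the relation of J_0 turns into (c - c^-1)
    X_{t+1}. *)
Lemma PsiX j t : psi_op j *m Xm t - c *: (shift psi_op j *m Xm t.+1) =
  Xm t *m psi_op j - c^-1 *: (Xm t.+1 *m shift psi_op j).
Proof.
case: j => [|j] /=; first by rewrite mul0mx mulmx0 !scaler0 mul1mx mulmx1.
rewrite -scalemxAl (JXS H) -scalemxAr.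
case: j => [|j] /=; last by rewrite -scalemxAl -scalemxAr; mxlin.
rewrite mul1mx mulmx1 (JX0 hq0 H) /sgX /qtwo.
set A := _ *m _; set B := _ *m _; set X := rho _.
have c0 := cX_neq0 hq0 false; have k0 := qqV_neq0 hq0 hq.
have ec : c^-1 = q ^+ 2 by rewrite /cX invrK.
have ec' : c = q ^- 2 by [].
have -> : (q - q^-1) *: (A + c *: (c^-1 ^+ 2 *: B + (c^-1 * (-1 * ((q ^+ 2 - q ^- 2) / (q - q^-1)))) *: X) - c^-1 *: B)
  = (q - q^-1) *: A + (c - c^-1) *: X.
  clearbody A B X; apply/matrixP => i j; rewrite !mxE ec ec'; field.
  by rewrite hq0 /= -[_ - 1]/(_); apply: contra k0 => /eqP h; rewrite -(mulfK hq0 (q - q^-1)) mulrBl mulVf // -expr2 h mul0r.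
by clearbody A X; mxlin.
Qed.
End PsiOperators.
End HighestWeights.

(** * Powers of X_0 - z X_1 for q-commuting matrices *)

Section QBinomial.
Variables (F : fieldType) (n : nat) (X0 X1 : 'M[F]_n).

(* The coefficient of z^j in (X0 - z X1)^m. *)
Fixpoint beta (m j : nat) : 'M[F]_n :=
  if m is m'.+1 then X0 *m beta m' j - X1 *m shift (beta m') j
  else (j == 0%N)%:R%:M.

Lemma beta_big m j : (m < j)%N -> beta m j = 0.
Proof.
elim: m j => [|m IH] [|j] //= mj; first by rewrite raddf0.
by rewrite !IH ?mulmx0 ?subr0 //; lia.
Qed.

Variable c : F.
Hypothesis X10 : X1 *m X0 = c *: (X0 *m X1).

Lemma beta_X0 m j : beta m j *m X0 = c ^+ j *: (X0 *m beta m j).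
Proof.
elim: m j => [|m IH] [|j] /=.
- by rewrite mul1mx mulmx1 scale1r.
- by rewrite raddf0 mul0mx mulmx0 scaler0.
- by rewrite mulmx0 subr0 -mulmxA IH !scale1r.
have X10' : X1 *m (X0 *m beta m j) = c *: (X0 *m (X1 *m beta m j)).
  by rewrite mulmxA X10 -scalemxAl -mulmxA.
rewrite mulmxBl -!mulmxA !IH -!scalemxAr X10' scalerA.
by rewrite mulmxBr scalerBr -exprSr.
Qed.

(** The ratio of consecutive q-binomial coefficients in a form without division. *)
Lemma beta_shift m j :
  (c ^+ m.+1 * (1 - c ^+ j)) *: (X0 *m beta m j) =
  (c ^+ m.+1 - c ^+ j) *: (X1 *m shift (beta m) j).
Proof.
elim: m j => [|m IH] [|j].
- by rewrite /= !subrr mulr0 scale0r mulmx0 scaler0.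
- have z : (0 : F)%:M = 0 :> 'M[F]_n by exact: raddf0.
  case: j => [|j] /=; first by rewrite expr1 subrr scale0r z mulmx0 scaler0.
  by rewrite !z !mulmx0 !scaler0.
- by rewrite /= !subrr mulr0 scale0r mulmx0 scaler0.
have IH1 := IH j.+1; rewrite /= in IH1; have IH2 := IH j.
rewrite /=.
set Y := beta m j in IH1 IH2 *; set Z := shift (beta m) j in IH2 *.
have -> : (c ^+ m.+2 * (1 - c ^+ j.+1)) *: (X0 *m (X0 *m beta m j.+1 - X1 *m Y)) =
   (c ^+ j.+2 * (c ^+ m.+1 - 1)) *: (X0 *m (X1 *m Y)).
  have e A : (c ^+ m.+2 * (1 - c ^+ j.+1)) *: (X0 *m A) =
      c *: (X0 *m ((c ^+ m.+1 * (1 - c ^+ j.+1)) *: A)).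
    by rewrite -scalemxAr scalerA exprS mulrA.
  rewrite mulmxBr scalerBr e IH1 -scalemxAr scalerA -scalerBl.
  by congr (_ *: _); rewrite !exprS; ring.
have -> : (c ^+ m.+2 - c ^+ j.+1) *: (X1 *m (X0 *m Y - X1 *m Z)) =
   (c ^+ j.+1 * (c ^+ m.+1 - 1)) *: (X1 *m (X0 *m Y)).
  have -> : c ^+ m.+2 - c ^+ j.+1 = c * (c ^+ m.+1 - c ^+ j) by rewrite !exprS; ring.
  have -> : (c * (c ^+ m.+1 - c ^+ j)) *: (X1 *m (X0 *m Y - X1 *m Z)) =
      c *: (X1 *m ((c ^+ m.+1 - c ^+ j) *: (X0 *m Y - X1 *m Z))).
    by rewrite -scalemxAr scalerA.
  rewrite scalerBr -IH2 -scalerBl -scalemxAr scalerA.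
  by congr (_ *: _); rewrite !exprS; ring.
by rewrite !mulmxA X10 -scalemxAl scalerA; congr (_ *: _); rewrite !exprS; ring.
Qed.

(** Both sides are multiples of X_0^(m+1-j) X_1^j. The scalars express the ratio of the q-binomial
    coefficients m over j and m+1 over j, together with c^j for moving X_0 to the left. *)
Lemma beta_qbinomial m j :
  (1 - c ^+ m.+1) *: (beta m j *m X0) = (c ^+ j - c ^+ m.+1) *: beta m.+1 j.
Proof.
rewrite beta_X0 scalerA [beta m.+1 j]/= scalerBr.
have -> : (c ^+ j - c ^+ m.+1) *: (X1 *m shift (beta m) j) =
   - ((c ^+ m.+1 * (1 - c ^+ j)) *: (X0 *m beta m j)).
  by rewrite beta_shift -scaleNr opprB.
by rewrite opprK -scalerDl; congr (_ *: _); ring.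
Qed.
End QBinomial.

Arguments psi_seq : simpl never.
Arguments psi_op : simpl never.

(** * The lowest weight space and the equation for D *)

Section DrinfeldPolynomial.
Variables (F : numClosedFieldType) (q : F).
Hypotheses (hq0 : q != 0) (hq : forall m : nat, (0 < m)%N -> q ^+ m != 1).
Local Notation c := (cX q false).
Variables (n : nat) (rho : gen -> 'M[F]_n) (v : 'cV[F]_n) (lam : F) (u : nat -> F).
Hypothesis H : isrep q rho.
Hypothesis Hv : hwvec rho v lam u.
Local Notation Xm t := (rho (gX false t)).
Local Notation ws := (wspace rho v).
Local Notation psi := (psi_seq q u).
Local Notation Psi := (psi_op q rho).

Lemma psi_0 : psi 0 = 1. Proof. by []. Qed.
Lemma Psi_0 : Psi 0 = 1%:M. Proof. by []. Qed.

Lemma Psi_v j : Psi j *m v = psi j *: v.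
Proof.
case: j => [|j]; first by rewrite Psi_0 mul1mx scale1r.
rewrite /psi_op /psi_seq; by case: Hv => _ _ _ Jv; rewrite -scalemxAl Jv scalerA.
Qed.

Lemma wspace_Psi m j x : ws m x -> ws m (Psi j *m x).
Proof.
case: j => [|j] wx; first by rewrite Psi_0 mul1mx.
by rewrite /psi_op -scalemxAl; apply: wspace_Z; apply: (wspace_J hq0 H Hv).
Qed.

Lemma wspace_sum (I : Type) (s : seq I) (P : pred I) m (f : I -> 'cV[F]_n) :
  (forall i, P i -> ws m (f i)) -> ws m (\sum_(i <- s | P i) f i).
Proof.
by move=> h; elim/big_ind: _ => //; [exact: wspace_0|exact: wspace_D].
Qed.

Lemma cpow_diff r : (0 < r)%N -> c^-1 ^+ r - c ^+ r != 0.
Proof.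
move=> r0; have c0 := cX_neq0 hq0 false.
rewrite subr_eq0 -(inj_eq (mulfI (expf_neq0 r c0))) -exprMn mulfV // expr1n.
by rewrite -exprD eq_sym cX_exp_neq1 // addn_gt0 r0.
Qed.

(* The coefficients of the series E(z) with E(z/c) psi(z) = Psi(z) E(cz). On a word of
   length m in the X^-_t applied to v, E_r acts as the r-th elementary symmetric
   function (up to sign) in the m shift operators. *)
Lemma exists_E : exists E : nat -> 'M[F]_n, [/\ E 0%N = 1%:M,
  forall r, \sum_(j < r.+1) (psi j * c^-1 ^+ (r - j)) *: E (r - j)%N =
            \sum_(j < r.+1) Psi j *m (c ^+ (r - j) *: E (r - j)%N) &
  forall m x, ws m x -> forall r, ws m (E r *m x)].
Proof.
(* The r-th coefficient of the equation solved for E_r, which occurs there with the factor c^-r -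
   c^r, nonzero for r > 0. *)
pose Phi (f : nat -> 'M[F]_n) r := if r is r'.+1 then (c^-1 ^+ r - c ^+ r)^-1 *:
  \sum_(j < r) (Psi j.+1 *m (c ^+ (r - j.+1) *: f (r - j.+1)%N)
    - (psi j.+1 * c^-1 ^+ (r - j.+1)) *: f (r - j.+1)%N) else 1%:M.
have [|E eE] := @strong_recursion _ 0 Phi.
  move=> f g [//|r] fg; congr (_ *: _); apply: eq_bigr => j _.
  by rewrite fg //; lia.
exists E; split=> [|r|m x wx r].
- by rewrite eE.
- case: r => [|r]; first by rewrite !big_ord1 /= psi_0 Psi_0 !expr0 !scale1r mulr1 scale1r mul1mx.
  rewrite big_ord_recl [RHS]big_ord_recl /= subn0 psi_0 Psi_0 mul1r mul1mx.
  apply/eqP; rewrite -subr_eq0 opprD addrACA -scalerBl {1}eE /Phi scalerA.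
  rewrite mulfV ?cpow_diff // scale1r sumrB; apply/eqP.
  rewrite /bump /=; under [X in _ + (X - _)]eq_bigr => j _ do rewrite add1n.
  under [X in _ + (_ - X)]eq_bigr => j _ do rewrite add1n.
  by mxlin.
- have [d] := ubnP r; elim: d r => // d IH [|r] rd; first by rewrite eE mul1mx.
  rewrite eE /Phi -scalemxAl mulmx_suml; apply/wspace_Z/wspace_sum => j _.
  have wE : ws m (E (r.+1 - j.+1)%N *m x) by apply: IH; lia.
  rewrite mulmxBl; apply: wspace_D; last by rewrite -scalemxAl -scaleNr; exact: wspace_Z.
  by rewrite -mulmxA; apply: wspace_Psi; rewrite -scalemxAl; exact: wspace_Z.
Qed.

Section EOperators.
Variable E : nat -> 'M[F]_n.
Hypothesis E0 : E 0%N = 1%:M.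
Hypothesis HE : forall r, \sum_(j < r.+1) (psi j * c^-1 ^+ (r - j)) *: E (r - j)%N =
            \sum_(j < r.+1) Psi j *m (c ^+ (r - j) *: E (r - j)%N).

(** Psi acts on v by psi, and there the recursion has the constant series 1 as its only solution. *)
Lemma Ev r : E r *m v = (r == 0%N)%:R *: v.
Proof.
have [d] := ubnP r; elim: d r => // d IH [|r] rd; first by rewrite E0 mul1mx scale1r.
have /(congr1 (mulmx^~ v)) := HE r.+1.
rewrite !mulmx_suml big_ord_recl [RHS]big_ord_recl /= subn0 psi_0 Psi_0 mul1r mul1mx.
have -> : \sum_(i < r.+1) (psi (bump 0 i) * c^-1 ^+ (r.+1 - bump 0 i)) *:
   E (r.+1 - bump 0 i)%N *m v = \sum_(i < r.+1) Psi (bump 0 i) *m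
    (c ^+ (r.+1 - bump 0 i) *: E (r.+1 - bump 0 i)%N) *m v.
  apply: eq_bigr => j _; have := Psi_v (bump 0 j); move: (Psi _) => P Pv.
  rewrite -mulmxA -!scalemxAl IH; last by rewrite /bump; lia.
  rewrite -!scalemxAr Pv !scalerA /bump add1n subSS.
  by case: (r - j)%N => [|k] /=; rewrite ?mulr0 ?mul0r // !mulr1 mul1r.
move=> /addIr; rewrite -!scalemxAl => /eqP; rewrite -subr_eq0 -scalerBl.
by rewrite scaler_eq0 (negPf (cpow_diff _)) //= => /eqP ->; rewrite scale0r.
Qed.

(** As series, E(z) X_t = (X_t - z X_{t+1}) E(z). By [PsiX] the difference D(z) of the two sides
    satisfies the equation D(z/c) psi(z) = Psi(z) D(cz) of E, but with D(0) = 0, and the recursion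
    forces D = 0. *)
Lemma E_X r t : E r *m Xm t = Xm t *m E r - Xm t.+1 *m shift E r.
Proof.
pose D s := E s *m Xm t - (Xm t *m E s - Xm t.+1 *m shift E s).
suff: D r = 0 by move/subr0_eq.
have c0 := cX_neq0 hq0 false.
have key s : \sum_(j < s.+1) (psi j * c^-1 ^+ (s - j)) *: D (s - j)%N =
             \sum_(j < s.+1) Psi j *m (c ^+ (s - j) *: D (s - j)%N).
  have LX : \sum_(j < s.+1) (psi j * c^-1 ^+ (s - j)) *: (E (s - j)%N *m Xm t) =
            \sum_(j < s.+1) Psi j *m (c ^+ (s - j) *: (E (s - j)%N *m Xm t)).
    have /(congr1 (mulmx^~ (Xm t))) := HE s; rewrite !mulmx_suml => e.
    etransitivity; [|etransitivity; [exact: e|]]; apply: eq_bigr => j _.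
      by rewrite scalemxAl.
    by rewrite -mulmxA scalemxAl.
  have shL : \sum_(j < s.+1) (psi j * c^-1 ^+ (s - j)) *: shift E (s - j)%N =
       c^-1 *: shift (fun s => \sum_(j < s.+1) (psi j * c^-1 ^+ (s - j)) *: E (s - j)%N) s.
    case: s {LX} => [|s]; first by rewrite big_ord1 /= !scaler0.
    rewrite big_ord_recr /= subnn /= scaler0 addr0 scaler_sumr.
    apply: eq_bigr => j _; have -> : (s.+1 - j = (s - j).+1)%N by have := ltn_ord j; lia.
    by rewrite /= scalerA exprS mulrCA.
  have shR : \sum_(j < s.+1) Psi j *m (Xm t.+1 *m (c ^+ (s - j) *: shift E (s - j)%N)) =
       c *: \sum_(j < s.+1) shift Psi j *m (Xm t.+1 *m (c ^+ (s - j) *: E (s - j)%N)).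
    rewrite -(conv_shift (f := fun A B => A *m (Xm t.+1 *m B)) Psi (fun i => c ^+ i *: E i));
      [|by move=> ?; rewrite mul0mx|by move=> ?; rewrite !mulmx0].
    rewrite scaler_sumr; apply: eq_bigr => j _.
    case: (s - j)%N => [|k] /=; first by rewrite scaler0 !mulmx0 scaler0.
    by rewrite exprS -scalerA -!scalemxAr.
  have shR' : \sum_(j < s.+1) Xm t.+1 *m (shift Psi j *m (c ^+ (s - j) *: E (s - j)%N)) =
     Xm t.+1 *m shift (fun s => \sum_(j < s.+1) Psi j *m (c ^+ (s - j) *: E (s - j)%N)) s.
    rewrite -mulmx_sumr; congr (_ *m _).
    case: s {LX shL shR} => [|s]; first by rewrite big_ord1 /= mul0mx.
    by rewrite big_ord_recl /= mul0mx add0r.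
  have XL : \sum_(j < s.+1) (psi j * c^-1 ^+ (s - j)) *:
       (Xm t *m E (s - j)%N - Xm t.+1 *m shift E (s - j)%N) =
     \sum_(j < s.+1) Psi j *m (c ^+ (s - j) *:
       (Xm t *m E (s - j)%N - Xm t.+1 *m shift E (s - j)%N)).
    transitivity (Xm t *m (\sum_(j < s.+1) (psi j * c^-1 ^+ (s - j)) *: E (s - j)%N)
       - Xm t.+1 *m (\sum_(j < s.+1) (psi j * c^-1 ^+ (s - j)) *: shift E (s - j)%N)).
      rewrite !mulmx_sumr -sumrB; apply: eq_bigr => j _.
      by rewrite -!scalemxAr -scalerBr.
    rewrite shL; transitivity (Xm t *m (\sum_(j < s.+1) Psi j *m (c ^+ (s - j) *: E (s - j)%N))
       - c^-1 *: \sum_(j < s.+1) Xm t.+1 *m (shift Psi j *m (c ^+ (s - j) *: E (s - j)%N))).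
      rewrite shR' HE -scalemxAr; congr (_ - _ *: (_ *m _)).
      by case: s {LX shL shR shR'} => [//|s] /=; exact: HE.
    transitivity (\sum_(j < s.+1) Psi j *m (Xm t *m (c ^+ (s - j) *: E (s - j)%N))
      - \sum_(j < s.+1) Psi j *m (Xm t.+1 *m (c ^+ (s - j) *: shift E (s - j)%N))); last first.
      rewrite -sumrB; apply: eq_bigr => j _.
      by rewrite -mulmxBr; congr (_ *m _); rewrite -!scalemxAr scalerBr.
    rewrite shR mulmx_sumr !scaler_sumr -!sumrB; apply: eq_bigr => j _.
    have := PsiX hq0 hq H j t => /(congr1 (mulmx^~ (c ^+ (s - j) *: E (s - j)%N))).
    by rewrite !mulmxBl -!scalemxAl -!mulmxA => ->.
  transitivity (\sum_(j < s.+1) (psi j * c^-1 ^+ (s - j)) *: (E (s - j)%N *m Xm t)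
    - \sum_(j < s.+1) (psi j * c^-1 ^+ (s - j)) *:
       (Xm t *m E (s - j)%N - Xm t.+1 *m shift E (s - j)%N)).
    by rewrite -sumrB; apply: eq_bigr => j _; rewrite -scalerBr.
  rewrite LX XL -sumrB; apply: eq_bigr => j _.
  by rewrite -mulmxBr -scalerBr.
have [d] := ubnP r; elim: d r => // d IH [|r] rd.
  by rewrite /D E0 mul1mx mulmx1 mulmx0 subr0 subrr.
have := key r.+1; rewrite big_ord_recl [RHS]big_ord_recl /= subn0 psi_0 Psi_0 mul1r mul1mx.
rewrite !big1 ?addr0; first last.
- by move=> j _; rewrite IH ?scaler0 // /bump; lia.
- by move=> j _; rewrite IH ?scaler0 ?mulmx0 // /bump; lia.
move=> /eqP; rewrite -subr_eq0 -scalerBl.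
by rewrite scaler_eq0 (negPf (cpow_diff _)) //= => /eqP ->.
Qed.
End EOperators.
Local Notation lower := (xpow rho false).
Local Notation raise := (xpow rho true).

Lemma hw_u0 : (q - q^-1) * u 0 = 1 - lam^-1 ^+ 2.
Proof.
have [v0 _ Kv Jv] := Hv.
have := J0_weight H (hw_lam0 H Hv) Kv; rewrite Jv scalerA => /eqP.
by rewrite -subr_eq0 -scalerBl scaler_eq0 (negPf v0) orbF subr_eq0 => /eqP.
Qed.

Lemma wspace_lower m i x : ws m x -> ws (i + m) (lower i x).
Proof. by move=> wx; elim: i => //= i IH; apply: wspace_X. Qed.

Lemma wspace_raise m i x : ws (i + m) x -> ws m (raise i x).
Proof.
elim: i x => [//|i IH] x; rewrite addSnnS => /= wx.
suff -> : rho (gX true 0) *m raise i x = raise i (rho (gX true 0) *m x).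
  by apply: IH; apply: (wspace_Xp hq0 H Hv); rewrite -addnS.
by elim: i {IH wx} => //= i ->.
Qed.

(** k is a degree whose weight space is nonzero while the next one vanishes. The string down from v
    has length m1 <= k, a string up from degree k has length m <= k, and comparing weights gives m1
    + m = 2k. So both are k, and (X^+_0)^k is injective from degree k into the line of v. *)
Lemma lowest_weight : exists k, [/\ lam ^+ 2 = c^-1 ^+ k, lower k v != 0,
  forall x, ws k x -> exists a, x = a *: lower k v & forall x, ws k.+1 x -> x = 0].
Proof.
have [v0 Xv Kv Jv] := Hv; have l0 := hw_lam0 H Hv.
have c0 := cX_neq0 hq0 false.
have [m0 nm0] := exists_non_eigenvalue (rho gK) (weights_inj hq0 hq H Hv).
have [||k [w w0 wk] nk] := @last_true (fun m => exists2 x, x != 0 & ws m x) m0.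
- by exists v => //; exact: wspace_v.
- by move=> [x x0 /(wspace_weight H Hv) /nm0 /eqP]; rewrite (negPf x0).
have zk x : ws k.+1 x -> x = 0.
  by move=> wx; apply: contrapT => /eqP x0; apply: nk; exists x.
have Xk x : ws k x -> forall t, Xm t *m x = 0 by move=> wx t; apply/zk/wspace_X.
have v1 : lower k.+1 v = 0.
  by apply: zk; rewrite -{1}[k.+1]addn0; apply: wspace_lower; exact: wspace_v.
have r1 x : ws k x -> raise k.+1 x = 0.
  move=> wx; have : ws 0 (raise k x) by apply: wspace_raise; rewrite addn0.
  exact: (wspace_Xp0 hq0 H Hv).
have up x : ws k x -> x != 0 -> exists2 m, (m < k.+1)%N &
    [/\ raise m x != 0, raise m.+1 x = 0 & (lam * c ^+ k) ^+ 2 = (cX q true)^-1 ^+ m].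
  move=> wx x0; apply: (sl2_weight hq0 hq H (b := true)) => //.
  - by rewrite mulf_neq0 ?expf_neq0.
  - exact: wspace_weight H Hv _ _ wx.
  - exact: Xk.
  - exact: r1.
have [m1 m1k [y1 y2 y3]] := sl2_weight hq0 hq H (b := false) l0 Kv (Xv 0%N) v0 v1.
have full m : (m < k.+1)%N -> (lam * c ^+ k) ^+ 2 = (cX q true)^-1 ^+ m -> m = k /\ m1 = k.
  move=> mk; rewrite cXN /= exprMn y3 => e.
  have e2 : c ^+ (k * 2) = c ^+ (m1 + m).
    by rewrite exprM exprD -e mulrA -exprMn mulfV // expr1n mul1r.
  by have := cX_exp_inj hq0 hq e2; lia.
have m1k' : m1 = k.
  by have [m mk [_ _ e]] := up w wk w0; have [_ ->] := full m mk e.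
rewrite m1k' in y1 y3; exists k; split=> // x wx.
have wl : ws k (lower k v) by rewrite -{1}[k]addn0; apply: wspace_lower; exact: wspace_v.
have top z : ws k z -> exists a, raise k z = a *: v.
  by move=> wz; apply: (wspace0P (rho := rho)); apply: wspace_raise; rewrite addn0.
have [b eb] := top _ wl; have [a ea] := top _ wx.
have nz z : ws k z -> z != 0 -> raise k z != 0.
  by move=> wz z0; have [m mk [h _ e]] := up z wz z0; have [<- _] := full m mk e.
have b0 : b != 0.
  by apply: contra (nz _ wl y1) => /eqP b0; rewrite eb b0 scale0r.
have wd : ws k (x + (- (a / b)) *: lower k v) by apply: wspace_D => //; exact: wspace_Z.
exists (a / b); apply/subr0_eq/eqP; rewrite -scaleNr; apply: contrapT => /negP.
move=> /(nz _ wd); rewrite xpowD xpowZ ea eb scalerA mulNr divfK // scaleNr subrr.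
by rewrite eqxx.
Qed.

Lemma drinfeld_data : exists k (D : nat -> F), [/\ lam ^+ 2 = c^-1 ^+ k, D 0%N = 1,
  forall j, (k < j)%N -> D j = 0 &
  forall r, \sum_(j < r.+1) D j * psi (r - j) = c ^+ r * D r].
Proof.
have [v0 Xv Kv Jv] := Hv; have l0 := hw_lam0 H Hv.
have c0 := cX_neq0 hq0 false.
have k0 := qqV_neq0 hq0 hq.
have [k [lamk w0 wk zk]] := lowest_weight.
have [E [E0 HE EW]] := exists_E.
have EX := E_X E0 HE; have Ev' := Ev E0 HE.
have wl : ws k (lower k v) by rewrite -{1}[k]addn0; apply: wspace_lower; exact: wspace_v.
have [D eD] := choice (fun r => wk _ (EW _ _ wl r)).
have cancel a b : a *: lower k v = b *: lower k v -> a = b.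
  move=> /eqP; rewrite -subr_eq0 -scalerBl scaler_eq0 (negPf w0) orbF subr_eq0.
  by move/eqP.
have D0 : D 0%N = 1 by apply: cancel; rewrite -eD E0 mul1mx scale1r.
(* At t = s = 0 the relation contains each of the two products twice. *)
have X10 : Xm 1 *m Xm 0 = c *: (Xm 0 *m Xm 1).
  have e := XX H false 0 0.
  have : 2%:R *: (Xm 1 *m Xm 0) = 2%:R *: (c *: (Xm 0 *m Xm 1)).
    by rewrite !scaler_nat !mulr2n {2}e; mxlin.
  by move/(scalerI); apply; rewrite pnatr_eq0.
pose be := beta (Xm 0) (Xm 1).
have Elow m x : (forall r, E r *m x = be 0%N r *m x) -> forall r,
    E r *m lower m x = be m r *m x.
  move=> h; elim: m => [//|m IH] r /=.
  rewrite mulmxA EX mulmxBl -!mulmxA IH [in RHS]mulmxBl -!mulmxA; congr (_ - _ *m _).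
  by case: r => [|r] /=; rewrite ?mul0mx ?IH.
have Ev0 r : E r *m v = be 0%N r *m v.
  by rewrite Ev' /be /= mul_scalar_mx.
have Dbe r : D r *: lower k v = be k r *m v by rewrite -eD Elow.
have Dbig j : (k < j)%N -> D j = 0.
  by move=> kj; apply: cancel; rewrite Dbe /be beta_big // mul0mx scale0r.
exists k, D; split=> // r.
(* For k = 0 the polynomial is 1, and psi = 1 too, because X^-_0 v = 0 gives K J_t v = 0. The
   quotient u_t / u_0 below relies on k > 0, which makes u_0 nonzero. *)
case: k lamk w0 wk zk wl eD cancel Dbe Dbig => [|k] lamk w0 wk zk wl eD cancel Dbe Dbig.
  have u00 t : u t = 0.
    have X0v : Xm 0 *m v = 0.
      by apply: zk; apply: wspace_X; exact: wspace_v.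
    have := XpXm H t 0; rewrite add0n => /(congr1 (mulmx^~ v)).
    rewrite mulmxDl -!mulmxA Xv X0v !mulmx0 add0r Jv -scalemxAr Kv scalerA.
    move/esym/eqP; rewrite scaler_eq0 (negPf v0) orbF mulf_eq0 (negPf l0) orbF.
    by move/eqP.
  rewrite big_ord_recr /= subnn /psi_seq mulr1 big1 ?add0r.
    by case: r => [|r]; rewrite ?mul1r // Dbig ?mulr0.
  move=> j _; case e : (r - j)%N => [|s]; first by have := ltn_ord j; lia.
  by rewrite u00 !mulr0.
have ck : 1 - c ^+ k.+1 != 0 by rewrite subr_eq0 eq_sym cX_exp_neq1.
have eu0 : (q - q^-1) * u 0 = 1 - c ^+ k.+1.
  by rewrite hw_u0 exprVn lamk exprVn invrK.
have u00 : u 0 != 0 by apply: contra ck => /eqP e; rewrite -eu0 e mulr0.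
pose th t := u t / u 0.
have th_w t : lower k (Xm t *m v) = th t *: lower k.+1 v.
  (* X^+_0 kills [y] because X^+_0 X^-_t v = lam u_t v. A nonzero [y] starts a string of weight lam
     c, two steps shorter than that of v, so k lowerings already kill it. *)
  pose y := Xm t *m v + (- th t) *: (Xm 0 *m v).
  have lowS : lower k.+1 v = lower k (Xm 0 *m v).
    by rewrite /=; elim: (k) => //= i ->.
  have wy : ws 1 y by apply: wspace_D; [|apply: wspace_Z]; apply: wspace_X; exact: wspace_v.
  suff /eqP : lower k y = 0.
    by rewrite /y xpowD xpowZ -lowS scaleNr subr_eq0 => /eqP.
  case: (eqVneq y 0) => [->|y0]; first exact: xpow0.
  have Xy : rho (gX true 0) *m y = 0.
    rewrite /y mulmxDr -scalemxAr !mulmxA !(XpXm H) !addn0 !mulmxDl -!mulmxA Xv !mulmx0.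
    rewrite !add0r !Jv -!scalemxAr Kv !scalerA -scalerDl.
    by rewrite (_ : _ + _ = 0) ?scale0r // /th; field.
  have yN : lower k.+1 y = 0.
    by apply: zk; rewrite -[k.+2]addn1; exact: wspace_lower.
  have [||m mk [_ yS e]] := sl2_weight hq0 hq H (b := false) (mu := lam * c ^+ 1) _ _ Xy y0 yN.
  - by rewrite mulf_neq0 ?expf_neq0.
  - exact: wspace_weight H Hv _ _ wy.
  have e2 : c ^+ (m + 2) = c ^+ k.+1.
    move: e; rewrite exprMn lamk -exprM mul1n => e.
    have c1 i : c ^+ i * c^-1 ^+ i = 1 by rewrite -exprMn mulfV // expr1n.
    rewrite exprD -[RHS]mulr1 -(c1 m) -e.
    by rewrite [RHS]mulrCA; congr (_ * _); rewrite mulrA c1 mul1r.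
  have -> : k = m.+1 by have := cX_exp_inj hq0 hq e2; lia.
  exact: yS.
(* The coefficient of z^j in (X_0 - z X_1)^k (X_t - z X_{t+1}) v, that is, in E(z) applied to X_0^k
   X_t v. *)
pose Y t j := be k j *m (Xm t *m v) - shift (be k) j *m (Xm t.+1 *m v).
have DY t j : (D j * th t) *: lower k.+1 v = Y t j.
  rewrite mulrC -scalerA -eD scalemxAr -th_w /Y.
  elim: (k) j => [|m IH] j.
    rewrite [lower 0 _]/= mulmxA EX mulmxBl -!mulmxA Ev0; congr (_ - _).
      by rewrite /be /= !mul_scalar_mx -scalemxAr.
    case: j => [|j]; first by rewrite /= !mul0mx mulmx0.
    by rewrite [shift E _]/= Ev0 /be /= !mul_scalar_mx -scalemxAr.
  rewrite [lower m.+1 _]/= mulmxA EX mulmxBl -!mulmxA IH.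
  have -> : shift E j *m lower m (Xm t *m v) =
      shift (be m) j *m (Xm t *m v) - shift (shift (be m)) j *m (Xm t.+1 *m v).
    by case: j => [|j]; [rewrite /= !mul0mx subrr|exact: IH].
  have -> : shift (be m.+1) j = Xm 0 *m shift (be m) j - Xm 1 *m shift (shift (be m)) j.
    by case: j => [|j] //=; rewrite !mulmx0 subrr.
  rewrite [be m.+1 j]/= -/(be m) !mulmxBl !mulmxBr !mulmxA.
  by rewrite !opprB !addrA addrAC [in RHS]addrAC; congr (_ + _); rewrite addrAC.
have conv : \sum_(j < r.+1) D j * th (r - j)%N = (c ^+ r - c ^+ k.+1) / (1 - c ^+ k.+1) * D r.
  apply: cancel; rewrite scaler_suml.
  under eq_bigr => j _ do rewrite DY.
  pose G j := shift (be k) j *m (Xm (r.+1 - j)%N *m v).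
  (* The second half of each [Y] cancels the first half of its predecessor; only the term ending in
     X_0 v survives, ready for the q-binomial identity. *)
  transitivity (\sum_(0 <= j < r.+1) (G j.+1 - G j)).
    rewrite big_mkord; apply: eq_bigr => j _; rewrite /Y /G /= subSS subSn //.
    by rewrite -ltnS.
  rewrite telescope_sumr // /G /= mul0mx subr0 subSS subnn.
  have := beta_qbinomial X10 k r => /(congr1 (mulmx^~ v)).
  rewrite -!scalemxAl -mulmxA -/be -Dbe => /(congr1 (fun x => (1 - c ^+ k.+1)^-1 *: x)).
  by rewrite !scalerA mulVf // scale1r mulrA => ->; rewrite [_^-1 * _]mulrC.
(* The correction at s = 0 reflects that psi has constant term 1 and not (q - q^-1) u_0 = 1 -
   c^(k+1). *)
have psiE s : psi s = (1 - c ^+ k.+1) * th s + c ^+ k.+1 * (s == 0%N)%:R.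
  case: s => [|s]; first by rewrite /th mulfV // !mulr1 subrK.
  by rewrite mulr0 addr0 -eu0 /th /psi_seq; field; rewrite u00 hq0.
under eq_bigr => j _ do rewrite psiE mulrDr mulrCA.
rewrite big_split /= -mulr_sumr conv.
rewrite big_ord_recr /= subnn eqxx mulr1 big1 ?add0r; last first.
  by move=> j _; rewrite subn_eq0 leqNgt ltn_ord !mulr0.
by field.
Qed.
End DrinfeldPolynomial.

(** * Series solutions of D(z) psi(z) = D(cz) *)

Section QDifference.
Variable F : fieldType.
Implicit Types (c : F) (D psi : nat -> F) (s : seq F).

(* The series identity D(z) psi(z) = D(cz). *)
Definition qdiff c D psi :=
  forall r, \sum_(j < r.+1) D j * psi (r - j)%N = c ^+ r * D r.

Lemma qdiff_psi_unique c D psi psi' : D 0%N = 1 -> qdiff c D psi -> qdiff c D psi' ->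
  psi =1 psi'.
Proof.
move=> D0 h h' r; have [d] := ubnP r; elim: d r => // d IH r rd.
have := h r; rewrite -h' big_ord_recl [RHS]big_ord_recl /= D0 !mul1r subn0.
rewrite (eq_bigr (fun i : 'I_r => D (bump 0 i) * psi' (r - bump 0 i)%N)); first by move/addIr.
by move=> i _; rewrite IH // /bump; have := ltn_ord i; lia.
Qed.

Lemma qdiff_D_unique c D D' psi : (forall r, (0 < r)%N -> c ^+ r != 1) -> psi 0%N = 1 ->
  D 0%N = 1 -> D' 0%N = 1 -> qdiff c D psi -> qdiff c D' psi -> D =1 D'.
Proof.
move=> c1 p0 D0 D0' h h' r; have [d] := ubnP r; elim: d r => // d IH [|r] rd.
  by rewrite D0.
have E : \sum_(i < r.+1) D i * psi (r.+1 - i)%N = \sum_(i < r.+1) D' i * psi (r.+1 - i)%N.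
  by apply: eq_bigr => i _; rewrite IH //; have := ltn_ord i; lia.
have := h r.+1; rewrite big_ord_recr /= subnn p0 mulr1 => e.
have := h' r.+1; rewrite big_ord_recr /= subnn p0 mulr1 -E => e'.
have : (1 - c ^+ r.+1) * (D r.+1 - D' r.+1) = 0.
  rewrite mulrBl mul1r mulrBr -e -e'; ring.
by move/eqP; rewrite mulf_eq0 subr_eq0 eq_sym (negPf (c1 _ _)) //= subr_eq0 => /eqP.
Qed.

Definition revpoly s : {poly F} := \prod_(x <- s) (1 - x *: 'X).

Lemma revpoly_cons x s i : (revpoly (x :: s))`_i = (revpoly s)`_i - x * shift (fun j => (revpoly s)`_j) i.
Proof.
rewrite /revpoly big_cons mulrBl mul1r coefB -scalerAl coefZ coefXM.
by case: i.
Qed.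

Lemma revpoly0 s : (revpoly s)`_0 = 1.
Proof.
elim: s => [|x s IH]; first by rewrite /revpoly big_nil coef1.
by rewrite revpoly_cons IH mulr0 subr0.
Qed.

Lemma revpoly_big s j : (size s < j)%N -> (revpoly s)`_j = 0.
Proof.
elim: s j => [|x s IH] [|j] //= sj; first by rewrite /revpoly big_nil coef1.
by rewrite revpoly_cons /= !IH ?mulr0 ?subr0 //; lia.
Qed.

Lemma revpolyE s j : (j <= size s)%N ->
  (revpoly s)`_j = (\prod_(x <- s) ('X - x%:P))`_(size s - j).
Proof.
elim: s j => [|x s IH] j.
  by rewrite leqn0 => /eqP ->; rewrite /revpoly !big_nil coef1.
rewrite big_cons [size _]/= => js.
have sz : size (\prod_(y <- s) ('X - y%:P)) = (size s).+1 by rewrite size_prod_XsubC.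
rewrite revpoly_cons mulrBl coefB coefXM coefCM.
case: j js => [|j] js /=.
  by rewrite mulr0 subr0 subn0 /= IH // subn0 [X in _ - _ * X]nth_default ?mulr0 ?subr0 // sz.
rewrite subSS [(revpoly s)`_j]IH //; congr (_ - _).
case: (leqP j.+1 (size s)) => h.
  by rewrite IH //; case e : (size s - j)%N => [|i] /=; [lia|congr (_`_ _); lia].
by have -> : j = size s; [lia|rewrite subnn /= revpoly_big].
Qed.

(** The sizes must be known to agree: a root 0 contributes only the factor 1 to [revpoly]. *)
Lemma revpoly_inj s s' : size s = size s' -> (forall j, (revpoly s)`_j = (revpoly s')`_j) ->
  \prod_(x <- s) ('X - x%:P) = \prod_(x <- s') ('X - x%:P).
Proof.
move=> es e; apply/polyP => i; case: (leqP i (size s)) => h.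
  by rewrite -(subKn h) -revpolyE ?leq_subr // {2}es -revpolyE ?e // -es leq_subr.
by rewrite !nth_default // size_prod_XsubC // -es.
Qed.

Definition eqX N (p p' : {poly F}) := forall i, (i <= N)%N -> p`_i = p'`_i.

Lemma eqX_M N p1 p2 p1' p2' : eqX N p1 p1' -> eqX N p2 p2' -> eqX N (p1 * p2) (p1' * p2').
Proof.
move=> h1 h2 i iN; rewrite !coefM; apply: eq_bigr => j _.
by rewrite h1 ?h2 //; have := ltn_ord j; lia.
Qed.

Lemma eqX_prod (I : Type) (r : seq I) N (f g : I -> {poly F}) :
  (forall i, eqX N (f i) (g i)) -> eqX N (\prod_(i <- r) f i) (\prod_(i <- r) g i).
Proof.
move=> h; elim: r => [|i r IH]; first by rewrite !big_nil.
by rewrite !big_cons; exact: eqX_M.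
Qed.

Lemma revpoly_scale c s i : (\prod_(x <- s) (1 - (c * x) *: 'X) : {poly F})`_i = c ^+ i * (revpoly s)`_i.
Proof.
elim: s i => [|x s IH] i.
  by rewrite /revpoly !big_nil coef1; case: i => [|i]; rewrite ?mulr1 ?mulr0.
rewrite revpoly_cons big_cons mulrBl mul1r coefB -scalerAl coefZ coefXM IH.
case: i => [|i] /=; first by rewrite !mulr0 !subr0.
by rewrite IH exprS; ring.
Qed.

(** The coefficients of (1 - c x z) / (1 - x z). [wpoly] truncates this series so that products stay
    among polynomials. *)
Definition wcoef c (x : F) (m : nat) : F := if m is _.+1 then (1 - c) * x ^+ m else 1.
Definition wpoly c x N : {poly F} := \poly_(m < N.+1) wcoef c x m.
Definition wseries c s N : F := (\prod_(x <- s) wpoly c x N)`_N.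

Lemma wpoly_coef c x N i : (i <= N)%N -> (wpoly c x N)`_i = wcoef c x i.
Proof. by move=> iN; rewrite coef_poly ltnS iN. Qed.

Lemma wseriesE c s N M : (N <= M)%N -> (\prod_(x <- s) wpoly c x M)`_N = wseries c s N.
Proof.
move=> NM; apply: (@eqX_prod _ s N) => // x i iN.
by rewrite !wpoly_coef // (leq_trans iN).
Qed.

Lemma qdiff_wseries c s : qdiff c (fun j => (revpoly s)`_j) (wseries c s).
Proof.
move=> r; rewrite -revpoly_scale.
transitivity (revpoly s * \prod_(x <- s) wpoly c x r)`_r.
  by rewrite coefM; apply: eq_bigr => j _; rewrite wseriesE // leq_subr.
rewrite /revpoly -big_split /=; apply: (@eqX_prod _ s r) => // x i ir.
rewrite mulrBl mul1r coefB -scalerAl coefZ coefXM wpoly_coef //.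
rewrite coefB coefZ coefX coef1.
case: i ir => [|i] ir /=; first by rewrite !mulr0.
rewrite wpoly_coef; last by lia.
by case: i ir => [|i] ir /=; rewrite ?mulr1 ?mulr0 ?expr1 ?exprS; ring.
Qed.
End QDifference.

(** * Monomial symmetric functions and the numbers [ptq] *)

Lemma sorted_geq_split (l : seq nat) : sorted geq l ->
  l = [seq i <- l | (0 < i)%N] ++ nseq (size l - size [seq i <- l | (0 < i)%N]) 0%N.
Proof.
elim: l => //= x l IH sl; have sl' := path_sorted sl.
case: (posnP x) => [x0|x0] /=; last by rewrite subSS {1}(IH sl').
have all0 : all (geq x) l.
  by apply: order_path_min sl => ? ? ? /= h1 h2; exact: leq_trans h2 h1.
have e0 : [seq i <- l | (0 < i)%N] = [::].
  apply/eqP; rewrite -(negbK (_ == _)) -has_filter -all_predC; apply: sub_all all0 => y /=.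
  by rewrite x0 leqn0 => /eqP ->.
by move: (IH sl'); rewrite e0 /= !subn0 => {1}->; rewrite x0.
Qed.

Section Monomials.
Variables (R : realType) (q : R[i]) (hq0 : q != 0) (k : nat) (x : 'I_k -> R[i]).
Local Notation c := (q ^- 2).

Definition nzparts N (a : {ffun 'I_k -> 'I_N.+1}) : seq nat :=
  [seq (val (a i)) | i <- enum 'I_k & (0 < val (a i))%N].

Lemma sumn_nzparts N (a : {ffun 'I_k -> 'I_N.+1}) : sumn (nzparts a) = (\sum_i val (a i))%N.
Proof.
rewrite sumnE big_map big_filter -big_enum /= [RHS](bigID (fun i => 0 < val (a i))%N) /=.
by rewrite [X in (_ + X)%N]big1 ?addn0 // => i; rewrite -eqn0Ngt => /eqP.
Qed.

Lemma wcoef_nzparts N (a : {ffun 'I_k -> 'I_N.+1}) :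
  \prod_i wcoef c (x i) (a i) = (1 - c) ^+ size (nzparts a) * \prod_i x i ^+ val (a i).
Proof.
have -> : (1 - c) ^+ size (nzparts a) = \prod_i (if (0 < val (a i))%N then 1 - c else 1).
  by rewrite -big_mkcond /= size_map size_filter -sum1_count big_enum_cond /= -prodrXr.
rewrite -big_split /=; apply: eq_bigr => i _.
by case: (a i) => [[|m] /= _]; rewrite ?mul1r.
Qed.

Lemma msymE t lam : sumn lam = t -> msym lam x =
  \sum_(a : {ffun 'I_k -> 'I_t.+1} | perm_eq (nzparts a) lam) \prod_i x i ^+ val (a i).
Proof. by move=> <-. Qed.

Lemma wseries_monomials t : wseries c [seq x i | i <- enum 'I_k] t =
  \sum_(a : {ffun 'I_k -> 'I_t.+1} | (\sum_i val (a i) == t)%N) \prod_i wcoef c (x i) (a i).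
Proof.
rewrite /wseries big_map big_enum /=.
under eq_bigr => i _ do rewrite /wpoly poly_def.
rewrite bigA_distr_bigA /= coef_sum [RHS]big_mkcond /=; apply: eq_bigr => a _.
have -> : \prod_i (wcoef c (x i) (a i) *: 'X^(a i)) =
    (\prod_i wcoef c (x i) (a i)) *: 'X^(\sum_i val (a i)) :> {poly R[i]}.
  elim/big_rec3: _ => [|i y1 y2 y3 _ ->]; first by rewrite scale1r.
  by rewrite -scalerAl -scalerAr scalerA exprD.
by rewrite coefZ coefXn eq_sym; case: eqP; rewrite ?mulr1 ?mulr0.
Qed.

(** In the expanded product an exponent vector with l nonzero entries has weight (1 - c)^l, and 1 -
    q^-2 = q^-1 (q - q^-1) turns this into the coefficient in [ptq]. As t > 0 gives l > 0, the
    exponent l - 1 is not truncated. *)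
Lemma ptq_wseries t : (0 < t)%N ->
  (q - q^-1) * ptq q t x = wseries c [seq x i | i <- enum 'I_k] t.
Proof.
move=> t0; rewrite wseries_monomials /ptq mulr_sumr.
pose lam (s : t.-tuple 'I_t.+1) := [seq i <- map val s | (0 < i)%N].
pose good (s : t.-tuple 'I_t.+1) := sorted geq (map val s) && is_partition t (lam s).
pose G (a : {ffun 'I_k -> 'I_t.+1}) := \prod_i wcoef c (x i) (a i).
transitivity (\sum_(s : t.-tuple 'I_t.+1 | good s) \sum_(a | perm_eq (nzparts a) (lam s)) G a).
  apply: eq_bigr => s /andP[_ /and3P[_ _ /eqP sl]]; rewrite /= -/(lam s).
  have {}sl : sumn (lam s) = t := sl.
  rewrite (msymE sl) mulr_sumr; case: ifP => [_|sk].
    rewrite mulr_sumr; apply: eq_bigr => a pa.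
    rewrite /G wcoef_nzparts (perm_size pa) mulrA; congr (_ * _).
    have : (0 < size (lam s))%N by move: sl; case: (lam s) => //= t0'; lia.
    case: (size (lam s)) => // m _ /=.
    have -> : 1 - c = q^-1 * (q - q^-1) by rewrite mulrBr mulVf // -invfM -expr2.
    by rewrite exprMn [(q - q^-1) ^+ _.+1]exprS mulrCA.
  (* An exponent vector in k variables has at most k nonzero entries. *)
  rewrite mulr0 big_pred0 // => a; apply: contraFF sk => /perm_size <-.
  by rewrite size_map size_filter (leq_trans (count_size _ _)) // size_enum_ord.
rewrite (exchange_big_dep xpredT) //= [RHS]big_mkcond /=; apply: eq_bigr => a _.
case: eqP => [sa|nsa]; last first.
  rewrite big_pred0 // => s; apply/negP => /andP[/andP[_ /and3P[_ _ /eqP sl]] pa].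
  by apply: nsa; rewrite -sumn_nzparts (perm_sumn pa).
(* Each exponent vector of degree t is counted for exactly one padded partition: its sorted nonzero
   entries followed by zeros. *)
pose l := sort geq (nzparts a).
have pl : perm_eq (nzparts a) l by rewrite perm_sym perm_sort.
have sl : sumn l = t by rewrite -(perm_sumn pl) sumn_nzparts.
have al : all (fun i => 0 < i)%N l.
  by rewrite -(perm_all _ pl) /nzparts all_map; apply/allP => i; rewrite mem_filter => /andP[].
have geq_trans : transitive geq by move=> ? ? ? /= h1 h2; exact: leq_trans h2 h1.
have geq_total : total geq by move=> m n /=; exact: leq_total.
have geq_anti : antisymmetric geq by move=> m n /= /andP[h1 h2]; apply/eqP; rewrite eqn_leq h1 h2.
have sol : sorted geq l by exact: sort_sorted.
have szl : (size l <= t)%N.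
  by rewrite -sl; elim: (l) al => //= y r IH /andP[y0 /IH]; lia.
pose z := l ++ nseq (t - size l) 0%N.
have szz : size z == t by rewrite size_cat size_nseq subnKC.
have zt : all (fun i => i <= t)%N z.
  rewrite all_cat all_nseq orbT andbT -sl; elim: (l) => //= y r IH; rewrite leq_addr /=.
  by apply: sub_all IH => y'; rewrite /= => h; rewrite (leq_trans h) // leq_addl.
pose s0 := map_tuple inord (Tuple szz) : t.-tuple 'I_t.+1.
have vs0 : map val s0 = z.
  rewrite -map_comp -[RHS]map_id; apply/eq_in_map => i iz /=.
  by rewrite inordK // ltnS; exact: (allP zt).
have fz : [seq i <- z | (0 < i)%N] = l.
  by rewrite filter_cat (all_filterP al) (eq_in_filter (a2 := pred0)) ?filter_pred0 ?cats0 // => i /nseqP[->].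
rewrite (big_pred1 s0) // => s; apply/andP/eqP => [[/andP[so pa] pe]|->].
  apply: val_inj; apply: (inj_map val_inj); rewrite vs0 (sorted_geq_split so) -/(lam s).
  have -> : lam s = l.
    apply: (sorted_eq geq_trans geq_anti) => //; first by case/and3P: pa.
    by rewrite perm_sym (perm_trans _ pe) // perm_sym.
  by rewrite size_map size_tuple.
rewrite /good /lam vs0 fz; split=> //; rewrite /is_partition sol al sl eqxx !andbT.
rewrite /z; move: sol al; case: (l) => [|y r] //= so al.
  by elim: (t - 0)%N => //= -[|m].
by rewrite cat_path so /=; elim: (t - _)%N (last y r) => //= m IH y'.
Qed.
End Monomials.

(** * Modules with generic parameters *)

Lemma size_mul_le2 (F : fieldType) (p p' : {poly F}) m :
  (size p <= 2)%N -> (size p' <= m)%N -> (size (p * p')%R <= m.+1)%N.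
Proof.
move=> h h'; apply: leq_trans (size_polyMleq _ _) _.
by rewrite -subn1 leq_subLR add1n (leq_trans (leq_add h h')).
Qed.

(** * Partial fractions *)

Section Lagrange.
Variables (F : fieldType) (k : nat) (g d : 'I_k -> F).
Hypotheses (g_inj : injective g) (g0 : forall i, g i != 0).

(** The coefficient of 1 / (1 - g_l z) in the partial fraction expansion of prod_j (1 - d_j g_j z) /
    (1 - g_j z). *)
Definition residue (l : 'I_k) : F :=
  (1 - d l) * \prod_(j | j != l) ((g l - d j * g j) / (g l - g j)).

Lemma size_prod_diff (r : seq 'I_k) (a a' b : 'I_k -> F) :
  (size (\prod_(j <- r) ((a j)%:P + b j *: 'X) - \prod_(j <- r) ((a' j)%:P + b j *: 'X))%R <= size r)%N.
Proof.
have sz1 x y : (size (x%:P + y *: 'X : {poly F})%R <= 2)%N.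
  apply: leq_trans (size_polyD _ _) _; rewrite geq_max (leq_trans (size_polyC_leq1 _)) //.
  by apply: leq_trans (size_scale_leq _ _) _; rewrite size_polyX.
have sz x : (size (\prod_(j <- r) ((x j)%:P + b j *: 'X))%R <= (size r).+1)%N.
  elim: (r) => [|j s IH]; first by rewrite big_nil size_poly1.
  by rewrite big_cons; exact: size_mul_le2.
elim: r sz => [|j s IH] sz; first by rewrite !big_nil subrr size_poly0.
have sz' x : (size (\prod_(j <- s) ((x j)%:P + b j *: 'X))%R <= (size s).+1)%N.
  elim: (s) => [|i s' IH']; first by rewrite big_nil size_poly1.
  by rewrite big_cons; exact: size_mul_le2.
rewrite !big_cons; set A := \prod_(j <- s) _; set A' := \prod_(j <- s) _.
have -> : ((a j)%:P + b j *: 'X) * A - ((a' j)%:P + b j *: 'X) * A' =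
  ((a j)%:P + b j *: 'X) * (A - A') + (a j - a' j) *: A'.
  by rewrite -[(_ - _) *: A']mul_polyC polyCB; ring.
apply: leq_trans (size_polyD _ _) _; rewrite geq_max /=; apply/andP; split.
  by apply: size_mul_le2 => //; exact: IH.
by apply: leq_trans (size_scale_leq _ _) _; exact: sz'.
Qed.

(** The expansion with denominators cleared. The terms of degree k of the first two products cancel,
    so the difference of the sides has degree below k; it vanishes at the k points 1 / g_l. *)
Lemma lagrange : \prod_j (1 - (d j * g j) *: 'X) =
  (\prod_j d j) *: \prod_j (1 - g j *: 'X) +
  \sum_l residue l *: \prod_(j | j != l) (1 - g j *: 'X).
Proof.
apply/eqP; rewrite -subr_eq0 opprD addrA; apply/eqP.
apply: (roots_geq_poly_eq0 (rs := [seq (g l)^-1 | l <- enum 'I_k])).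
- apply/allP => _ /mapP[l _ ->]; rewrite rootE !hornerE !horner_prod /=.
  have z0 : (1 - g l *: 'X).[(g l)^-1] = 0 by rewrite !hornerE mulfV // subrr.
  have z : \prod_(i < k) (1 - g i *: 'X).[(g l)^-1] = 0.
    by rewrite (bigD1 l) //= z0 mul0r.
  rewrite z mulr0 subr0.
  have zs : (\sum_l0 residue l0 *: \prod_(j | j != l0) (1 - g j *: 'X)).[(g l)^-1] =
      residue l * \prod_(j | j != l) (1 - g j *: 'X).[(g l)^-1].
    rewrite horner_sum (bigD1 l) //= hornerZ horner_prod [X in _ + X]big1 ?addr0 // => l' l'l.
    by rewrite hornerZ horner_prod (bigD1 l) 1?eq_sym //= z0 mul0r mulr0.
  rewrite zs (bigD1 l) //= !hornerE mulfK //.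
  rewrite /residue -mulrA -big_split /= subr_eq0; apply/eqP; congr (_ * _).
  apply: eq_bigr => j jl; rewrite !hornerE.
  have gjl : g l - g j != 0 by rewrite subr_eq0 (inj_eq g_inj) eq_sym.
  by field; rewrite gjl g0.
- rewrite map_inj_uniq ?enum_uniq // => x y /invr_inj; exact: g_inj.
- rewrite size_map size_enum_ord.
  apply: leq_trans (size_polyD _ _) _; rewrite geq_max size_polyN; apply/andP; split.
    have := @size_prod_diff (enum 'I_k) (fun=> 1) d (fun j => - (d j * g j)).
    rewrite !big_enum /= size_enum_ord; congr (leq (size (polyseq (_ - _)%R)) _).
      by apply: eq_bigr => j _; rewrite scaleNr.
    rewrite -mul_polyC rmorph_prod -big_split /=; apply: eq_bigr => j _.
    by rewrite mulrBr mulr1 mul_polyC scalerA scaleNr.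
  apply: leq_trans (size_sum _ _ _) _; apply/bigmax_leqP => l _.
  apply: leq_trans (size_scale_leq _ _) _; rewrite -big_filter.
  have h (s : seq 'I_k) : (size (\prod_(j <- s) (1 - g j *: 'X : {poly F}))%R <= (size s).+1)%N.
    elim: s => [|i s' IH']; first by rewrite big_nil size_poly1.
    rewrite big_cons; apply: size_mul_le2 => //.
    apply: leq_trans (size_polyD _ _) _; rewrite geq_max size_poly1 size_polyN.
    by apply: leq_trans (size_scale_leq _ _) _; rewrite size_polyX.
  apply: leq_trans (h _) _.
  rewrite size_filter -sum1_count big_mkcond /=; rewrite -big_mkcond sum1_card.
  by rewrite cardC1 card_ord prednK // (leq_ltn_trans _ (ltn_ord l)).
Qed.

Lemma sum_residue : \sum_l residue l = 1 - \prod_j d j.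
Proof.
have z (P : pred 'I_k) (f : 'I_k -> F) : \prod_(j | P j) (1 - f j *: 'X).[0] = 1.
  by rewrite big1 // => j _; rewrite !hornerE ?mulr0 ?subr0.
have := congr1 (fun p => p.[0]) lagrange.
rewrite hornerD hornerZ horner_sum !horner_prod !z mulr1 => h.
rewrite [X in _ = X - _]h addrC addKr; apply: eq_bigr => l _.
by rewrite hornerZ horner_prod z mulr1.
Qed.
End Lagrange.

Lemma geom_conv (F : fieldType) (p : {poly F}) x r :
  \sum_(j < r.+1) ((1 - x *: 'X) * p)`_j * x ^+ (r - j) = p`_r.
Proof.
have E j : ((1 - x *: 'X) * p)`_j = p`_j - x * (if j is i.+1 then p`_i else 0).
  by rewrite mulrBl mul1r coefB -scalerAl coefZ coefXM; case: j.
elim: r => [|r IH]; first by rewrite big_ord1 E /= mulr0 subr0 mulr1.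
rewrite big_ord_recr /= subnn mulr1 E.
rewrite (eq_bigr (fun i : 'I_r.+1 => x * (((1 - x *: 'X) * p)`_i * x ^+ (r - i)))).
  by rewrite -mulr_sumr IH addrC subrK.
by move=> i _; rewrite subSn ?exprS 1?mulrCA // -ltnS.
Qed.

(** The hypothesis on psi is the partial fraction form of prod_j (1 - c g_j z) / (1 - g_j z), whose
    constant part is c^k. *)
Lemma qdiff_residue (F : fieldType) (k : nat) (g : 'I_k -> F) (c : F) (psi : nat -> F) :
  injective g -> (forall i, g i != 0) ->
  (forall t, psi t = (t == 0%N)%:R * c ^+ k + \sum_l g l ^+ t * residue g (fun=> c) l) ->
  qdiff c (fun j => (revpoly [seq g i | i <- enum 'I_k])`_j) psi.
Proof.
move=> gi g0 epsi r; rewrite -revpoly_scale.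
have -> : revpoly [seq g i | i <- enum 'I_k] = \prod_j (1 - g j *: 'X).
  by rewrite /revpoly big_map big_enum.
rewrite big_map big_enum /= (lagrange (fun=> c) gi g0) coefD coefZ coef_sum.
rewrite prodr_const card_ord.
under eq_bigr => j _ do rewrite epsi mulrDr.
rewrite big_split /=; congr (_ + _).
  rewrite big_ord_recr /= subnn mul1r mulrC big1 ?add0r // => j _.
  by rewrite subn_eq0 leqNgt ltn_ord mul0r mulr0.
under eq_bigr => j _ do rewrite mulr_sumr.
rewrite exchange_big /=; apply: eq_bigr => l _; rewrite coefZ -(geom_conv _ (g l)) mulr_sumr.
by apply: eq_bigr => j _; rewrite [in LHS](bigD1 l) //= mulrA mulrC.
Qed.

Section GenericModule.
Variables (F : numClosedFieldType) (q : F).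
Hypotheses (hq0 : q != 0) (hq : forall m : nat, (0 < m)%N -> q ^+ m != 1).
Local Notation c := (cX q false).
Variables (k : nat) (g : 'I_k -> F) (be : F).
Hypotheses (g_inj : injective g) (g0 : forall i, g i != 0) (be2 : be ^+ 2 = 1).
Local Notation ST := {set 'I_k}.
Local Notation N := #|{: ST}|.
Implicit Types (S : ST) (i j l : 'I_k).

(* An explicit model of the tensor product of the two-dimensional evaluation modules at the
   points g i: S is the set of factors in their lowest weight vector. *)
Definition bvec S : 'cV[F]_N := delta_mx (enum_rank S) 0.
Definition cols (f : ST -> 'cV[F]_N) : 'M[F]_N := \matrix_(i, j) f (enum_val j) i 0.

Lemma cols_bvec f S : cols f *m bvec S = f S.
Proof.
apply/matrixP => i j; rewrite (ord1 j) -colE !mxE enum_rankK //.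
Qed.

Lemma bvec_ext m (A B : 'M[F]_(m, N)) : (forall S, A *m bvec S = B *m bvec S) -> A = B.
Proof.
move=> h; apply/trmx_inj/row_matrixP => i; rewrite -!tr_col !colE.
by have := h (enum_val i); rewrite /bvec enum_valK => ->.
Qed.

Definition kval S : F := be * q ^+ k * c ^+ #|S|.
Definition shiftc S j : F := if j \in S then c^-1 else c.
(** For t > 0, (q - q^-1) times this is the coefficient of z^t in prod_j (1 - d_j g_j z) / (1 - g_j
    z) with d = [shiftc S]: the product of the weight series of the tensor factors. *)
Definition jval t S : F := (\sum_l g l ^+ t * residue g (shiftc S) l) / (q - q^-1).
Definition acoef i S : F := \prod_(j in S) ((g j - c * g i) / (g j - g i)).
(** Together with [acoef] this splits the term kval residue / (q - q^-1) of the commutator into two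
    factors; 1 / q is the value of (1 - c) / (q - q^-1). *)
Definition bcoef i S : F :=
  be * q ^+ k / q * \prod_(j | (j \notin S) && (j != i)) ((c * g j - g i) / (g j - g i)).

Definition grho (x : gen) : 'M[F]_N :=
  match x with
  | gX false t => cols (fun S => \sum_(i | i \notin S) (g i ^+ t * acoef i S) *: bvec (i |: S))
  | gX true t => cols (fun S => \sum_(i in S) (g i ^+ t * bcoef i (S :\ i)) *: bvec (S :\ i))
  | gJ t => cols (fun S => jval t S *: bvec S)
  | gK => cols (fun S => kval S *: bvec S)
  | gKm => cols (fun S => (kval S)^-1 *: bvec S)
  end.

Lemma grho_Xm t S : grho (gX false t) *m bvec S =
  \sum_(i | i \notin S) (g i ^+ t * acoef i S) *: bvec (i |: S).
Proof. exact: cols_bvec. Qed.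
Lemma grho_Xp t S : grho (gX true t) *m bvec S =
  \sum_(i in S) (g i ^+ t * bcoef i (S :\ i)) *: bvec (S :\ i).
Proof. exact: cols_bvec. Qed.
Lemma grho_J t S : grho (gJ t) *m bvec S = jval t S *: bvec S.
Proof. exact: cols_bvec. Qed.
Lemma grho_K S : grho gK *m bvec S = kval S *: bvec S.
Proof. exact: cols_bvec. Qed.
Lemma grho_Km S : grho gKm *m bvec S = (kval S)^-1 *: bvec S.
Proof. exact: cols_bvec. Qed.

Lemma be_neq0 : be != 0.
Proof. by apply/eqP => b0; move/eqP: be2; rewrite b0 expr0n eq_sym oner_eq0. Qed.

Lemma kval_neq0 S : kval S != 0.
Proof. by rewrite !mulf_neq0 ?expf_neq0 ?be_neq0 ?cX_neq0. Qed.

Lemma gdiff i j : i != j -> g i - g j != 0.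
Proof. by move=> ij; rewrite subr_eq0 (inj_eq g_inj). Qed.

Lemma acoef_U i j S : j \notin S -> acoef i (j |: S) = (g j - c * g i) / (g j - g i) * acoef i S.
Proof. by move=> jS; rewrite /acoef big_setU1. Qed.

Lemma bcoef_U i j S : j \notin S -> j != i ->
  bcoef i S = (c * g j - g i) / (g j - g i) * bcoef i (j |: S).
Proof.
move=> jS ji; rewrite /bcoef (bigD1 j) ?jS //= mulrCA; congr (_ * (_ * _)).
by apply: eq_bigl => l; rewrite !inE negb_or; case: (l \in S); case: (l == i); case: (l == j).
Qed.

(** Switching the shift at i from c to c^-1 changes one factor of the residue, for l = i the factor
    1 - d_i. The uniform cleared form gives the relation between J and X. *)
Lemma residue_U i l S : i \notin S ->
  residue g (shiftc (i |: S)) l * (g l - c * g i) = residue g (shiftc S) l * (g l - c^-1 * g i).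
Proof.
have c0 := cX_neq0 hq0 false.
move=> iS; rewrite /residue /shiftc; case: (eqVneq l i) => [->|li].
  rewrite setU11 (negPf iS).
  rewrite (eq_bigr (fun j => (g i - (if j \in S then c^-1 else c) * g j) / (g i - g j))).
    set P := \prod_(_ | _) _; field; exact: c0.
  by move=> j /negPf ji; rewrite !inE ji.
have lE : (l \in i |: S) = (l \in S) by rewrite !inE (negPf li).
have il : i != l by rewrite eq_sym.
rewrite lE (bigD1 i) //= setU11 [in RHS](bigD1 i) //= (negPf iS).
rewrite (eq_bigr (fun j => (g l - (if j \in S then c^-1 else c) * g j) / (g l - g j))).
  by set P := \prod_(_ | _) _; field; rewrite c0 gdiff.
by move=> j /andP[_ /negPf ji]; rewrite !inE ji.
Qed.

Lemma jval_U s i S : i \notin S ->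
  jval s.+1 (i |: S) - jval s.+1 S = g i * (c * jval s (i |: S) - c^-1 * jval s S).
Proof.
move=> iS; rewrite /jval !mulrA -!mulrBl mulrA; congr (_ / _).
rewrite !mulr_sumr -!sumrB mulr_sumr; apply: eq_bigr => l _.
have h := residue_U l iS; apply/eqP; rewrite -subr_eq0; apply/eqP.
rewrite !exprS -[RHS](mulr0 (g l ^+ s)) -(subrr (residue g (shiftc S) l * (g l - c^-1 * g i))) -{1}h.
ring.
Qed.

Lemma prod_shiftc S : \prod_j shiftc S j = c ^+ k * c^-1 ^+ (2 * #|S|).
Proof.
have c0 := cX_neq0 hq0 false.
rewrite (bigID (mem S)) /= (eq_bigr (fun=> c^-1)); last by move=> j jS; rewrite /shiftc jS.
rewrite [X in _ * X](eq_bigr (fun=> c)); last by move=> j /negPf jS; rewrite /shiftc jS.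
rewrite !prodr_const.
have -> : #|[pred i | i \notin mem S]| = (k - #|S|)%N.
  by have := cardC (mem S); rewrite card_ord => e; rewrite -[X in (X - _)%N]e addKn.
have Sk : (#|S| <= k)%N by have := max_card (mem S); rewrite card_ord.
move: #|S| Sk => s sk; have e : c ^+ s * c^-1 ^+ s = 1 by rewrite -exprMn mulfV // expr1n.
have -> : c ^+ k = c ^+ (k - s) * c ^+ s by rewrite -exprD subnK.
by rewrite mul2n -addnn exprD -mulrA [c ^+ s * _]mulrA e mul1r mulrC.
Qed.

Lemma kval_J0 S : (q - q^-1) * jval 0 S = 1 - (kval S)^-1 ^+ 2.
Proof.
have c0 := cX_neq0 hq0 false; have k0 := qqV_neq0 hq0 hq.
rewrite /jval mulrC divfK //.
under eq_bigr => l _ do rewrite mul1r.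
rewrite (sum_residue _ g_inj g0) prod_shiftc; congr (_ - _).
have -> : (kval S)^-1 ^+ 2 = (q ^+ (2 * k) * c ^+ (2 * #|S|))^-1.
  by rewrite exprVn /kval !exprMn be2 mul1r -!exprM ![(2 * _)%N]mulnC.
by rewrite invfM -!exprVn; congr (_ * _); rewrite /cX [RHS]exprM exprVn.
Qed.

Lemma residue_notin l S : l \notin S ->
  kval S * residue g (shiftc S) l / (q - q^-1) = acoef l S * bcoef l S.
Proof.
have c0 := cX_neq0 hq0 false; have k0 := qqV_neq0 hq0 hq.
move=> lS; rewrite /residue /shiftc (negPf lS) /acoef /bcoef /kval.
rewrite [in LHS](bigID (mem S)) /=.
rewrite (eq_bigr (fun j => c^-1 * ((g j - c * g l) / (g j - g l)))); last first.
  move=> j /andP[jl jS]; rewrite jS; have h := gdiff jl; have h' : g l - g j != 0 by apply: gdiff; rewrite eq_sym.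
  by field; rewrite h h' c0.
rewrite big_split /= prodr_const.
have -> : #|[pred i | i != l & i \in mem S]| = #|S|.
  by apply: eq_card => x; rewrite !inE; case: eqP => // ->; rewrite (negPf lS).
rewrite (eq_bigl (mem S)); last first.
  by move=> x; rewrite !inE; case: eqP => // ->; rewrite (negPf lS).
rewrite [X in _ * (_ * (_ * X)) / _](eq_bigr (fun j => (c * g j - g l) / (g j - g l))); last first.
  move=> j /andP[jl /negPf jS]; rewrite jS; have h := gdiff jl; have h' : g l - g j != 0 by apply: gdiff; rewrite eq_sym.
  by field; rewrite h h'.
rewrite [X in _ * (_ * (_ * X)) / _](eq_bigl (fun j => (j \notin S) && (j != l))); last first.
  by move=> x; rewrite andbC.
set A := \prod_(j in S) _; set B := \prod_(_ | _) _.
have e : (1 - c) / (q - q^-1) = q^-1.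
  by apply: (mulIf k0); rewrite divfK // mulrBr mulVf // -invfM -expr2.
have e2 : c ^+ #|S| * c^-1 ^+ #|S| = 1 by rewrite -exprMn mulfV // expr1n.
transitivity (((1 - c) / (q - q^-1)) * (c ^+ #|S| * c^-1 ^+ #|S|) * (be * q ^+ k) * A * B).
  by rewrite exprVn; ring.
by rewrite e e2; ring.
Qed.

Lemma residue_in l S : l \in S ->
  kval S * residue g (shiftc S) l / (q - q^-1) = - (acoef l (S :\ l) * bcoef l (S :\ l)).
Proof.
have c0 := cX_neq0 hq0 false; move=> lS.
have nl : l \notin S :\ l by rewrite !inE eqxx.
rewrite -(residue_notin nl); have := residue_U l nl; rewrite setD1K // => h.
have eS : kval S = c * kval (S :\ l).
  by rewrite /kval (cardsD1 l S) lS exprS; ring.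
have -> : residue g (shiftc S) l = - c^-1 * residue g (shiftc (S :\ l)) l.
  have c1 : g l - c * g l != 0.
    rewrite -{1}[g l]mul1r -mulrBl mulf_neq0 // subr_eq0 eq_sym.
    by have := cX_exp_neq1 hq0 hq false (ltn0Sn 0); rewrite expr1.
  by apply: (mulIf c1); rewrite h; field.
by rewrite eS; move: (q - q^-1) (qqV_neq0 hq0 hq) => d d0; field; rewrite c0 d0.
Qed.

Lemma grho_XX (b : bool) t s S :
  grho (gX b t.+1) *m (grho (gX b s) *m bvec S)
  - cX q b *: (grho (gX b s) *m (grho (gX b t.+1) *m bvec S))
  - cX q b *: (grho (gX b t) *m (grho (gX b s.+1) *m bvec S))
  + grho (gX b s.+1) *m (grho (gX b t) *m bvec S) = 0.
Proof.
have c0 := cX_neq0 hq0 false.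
(* Changing S at i and j is reached in two orders; the relation says that the two contributions are
   opposite. *)
have antisym (P : 'I_k -> 'I_k -> bool) (G : 'I_k -> 'I_k -> 'cV[F]_N) :
    (forall i j, P i j = P j i) -> (forall i j, P i j -> G i j = - G j i) ->
    \sum_i \sum_(j | P i j) G i j = 0.
  move=> Ps Ga; have e : \sum_i \sum_(j | P i j) G i j = - \sum_i \sum_(j | P i j) G i j.
    rewrite [in LHS](exchange_big_dep xpredT) //= -sumrN; apply: eq_bigr => j _.
    by rewrite -sumrN; apply: eq_big => i; [rewrite Ps|move=> /Ga ->].
  move: e; set S' := \sum_i _ => e; have : 2%:R *: S' = 0.
    by rewrite scaler_nat mulr2n; apply/eqP; rewrite addr_eq0 -e.
  by move=> /eqP; rewrite scaler_eq0 pnatr_eq0 /= => /eqP.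
case: b.
- have E x y : grho (gX true x) *m (grho (gX true y) *m bvec S) =
     \sum_i \sum_(j | [&& i \in S, j \in S & i != j]) 
       (g i ^+ y * g j ^+ x * (bcoef i (S :\ i) * bcoef j (S :\ i :\ j))) *: bvec (S :\ i :\ j).
    rewrite grho_Xp mulmx_sumr [LHS]big_mkcond /=; apply: eq_bigr => i _.
    case: ifP => iS; last by rewrite big_pred0.
    rewrite -scalemxAr grho_Xp scaler_sumr; apply: eq_big => [j|j _].
      by rewrite !inE andbC eq_sym.
    by rewrite scalerA; congr (_ *: _); ring.
  rewrite !E !scaler_sumr -!sumrB -big_split /=.
  under eq_bigr => i _ do rewrite !scaler_sumr -!sumrB -big_split /=.
  apply: antisym => [i j|i j /and3P[iS jS ij]].
    by rewrite eq_sym; case: (i \in S); case: (j \in S).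
  have -> : S :\ j :\ i = S :\ i :\ j by apply/setP => x; rewrite !inE andbCA.
  have hi : i \notin S :\ i :\ j by rewrite !inE eqxx andbF.
  have hj : j \notin S :\ i :\ j by rewrite !inE eqxx.
  have ei : i |: (S :\ i :\ j) = S :\ j.
    by apply/setP => x; rewrite !inE; case: eqP => // ->; rewrite iS ij.
  have ej : j |: (S :\ i :\ j) = S :\ i.
    by apply/setP => x; rewrite !inE; case: eqP => // ->; rewrite jS eq_sym ij.
  have ji : j != i by rewrite eq_sym.
  rewrite (bcoef_U hi ij) (bcoef_U hj ji) ei ej !scalerA -!scalerBl -!scalerDl -scaleNr.
  congr (_ *: _); rewrite (_ : cX q true = c^-1); last by rewrite cXN.
  move: (bcoef i _) (bcoef j _) (gdiff ij) (gdiff ji) => B B' d1 d2.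
  by rewrite !exprS; field; rewrite c0 d1 d2.
- have E x y : grho (gX false x) *m (grho (gX false y) *m bvec S) =
     \sum_i \sum_(j | [&& i \notin S, j \notin S & i != j]) 
       (g i ^+ y * g j ^+ x * (acoef i S * acoef j (i |: S))) *: bvec (j |: (i |: S)).
    rewrite grho_Xm mulmx_sumr [LHS]big_mkcond /=; apply: eq_bigr => i _.
    case: ifP => iS; last by rewrite big_pred0.
    rewrite -scalemxAr grho_Xm scaler_sumr; apply: eq_big => [j|j _].
      by rewrite !inE negb_or andbC eq_sym.
    by rewrite scalerA; congr (_ *: _); ring.
  rewrite !E !scaler_sumr -!sumrB -big_split /=.
  under eq_bigr => i _ do rewrite !scaler_sumr -!sumrB -big_split /=.
  apply: antisym => [i j|i j /and3P[iS jS ij]].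
    by rewrite eq_sym; case: (i \in S); case: (j \in S).
  have -> : i |: (j |: S) = j |: (i |: S) by rewrite setUCA.
  have ji : j != i by rewrite eq_sym.
  rewrite (acoef_U _ iS) (acoef_U _ jS) !scalerA -!scalerBl -!scalerDl -scaleNr.
  congr (_ *: _).
  move: (acoef i _) (acoef j _) (gdiff ij) (gdiff ji) => B B' d1 d2.
  by rewrite !exprS; field; rewrite d1 d2.
Qed.

Lemma kval_U i S : i \notin S -> kval (i |: S) = c * kval S.
Proof. by move=> iS; rewrite /kval cardsU1 iS exprS; ring. Qed.

Lemma kval_D i S : i \in S -> kval S = c * kval (S :\ i).
Proof. by move=> iS; rewrite /kval (cardsD1 i S) iS exprS; ring. Qed.

Lemma grho_XpXm t s S :
  grho (gX true t) *m (grho (gX false s) *m bvec S) =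
  grho (gX false s) *m (grho (gX true t) *m bvec S) + (kval S * jval (s + t) S) *: bvec S.
Proof.
have c0 := cX_neq0 hq0 false.
(* [O] collects the terms that change S and agrees for both orders of the operators. The remaining
   multiples of [bvec S] are the residues at i outside S and, with opposite sign, inside S; their
   difference is the full sum in [jval]. *)
pose O := \sum_(i | i \notin S) \sum_(j in S) (g i ^+ s * g j ^+ t * (acoef i S * bcoef j ((i |: S) :\ j))) *: bvec ((i |: S) :\ j).
have E1 : grho (gX true t) *m (grho (gX false s) *m bvec S) = O +
   (\sum_(i | i \notin S) g i ^+ (s + t) * (acoef i S * bcoef i S)) *: bvec S.
  rewrite grho_Xm mulmx_sumr scaler_suml -big_split /=; apply: eq_bigr => i iS.
  rewrite -scalemxAr grho_Xp scaler_sumr (bigD1 i) ?setU11 //= setU1K // addrC; congr (_ + _).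
    apply: eq_big => [j|j _]; last by rewrite scalerA; congr (_ *: _); ring.
    rewrite !inE; case: eqP => [->|] //=; [by rewrite (negPf iS)|by rewrite andbT].
  by rewrite scalerA exprD; congr (_ *: _); ring.
have E2 : grho (gX false s) *m (grho (gX true t) *m bvec S) = O +
   (\sum_(i in S) g i ^+ (s + t) * (acoef i (S :\ i) * bcoef i (S :\ i))) *: bvec S.
  rewrite grho_Xp mulmx_sumr /O (exchange_big_dep (mem S)) //= scaler_suml -big_split /=.
  apply: eq_bigr => j jS; rewrite -scalemxAr grho_Xm scaler_sumr.
  rewrite (bigD1 j) ?inE ?eqxx //= setD1K // addrC; congr (_ + _); last first.
    by rewrite scalerA exprD; congr (_ *: _); ring.
  apply: eq_big => [i|i]; rewrite !inE.
    by case: eqP => [->|] //=; rewrite jS ?andbT ?andbF.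
  move=> /andP[h ij]; have iS : i \notin S by move: h; rewrite ij.
  have ji : j != i by rewrite eq_sym.
  have nj : j \notin S :\ j by rewrite !inE eqxx.
  have ni : i \notin S :\ j by rewrite !inE negb_and iS orbT.
  have -> : (i |: S) :\ j = i |: (S :\ j).
    by apply/setP => x; rewrite !inE; case: eqP => // ->; rewrite eq_sym (negPf ij).
  have eS : S = j |: (S :\ j) by rewrite setD1K.
  have -> : acoef i S = (g j - c * g i) / (g j - g i) * acoef i (S :\ j).
    by rewrite {1}eS acoef_U.
  rewrite (bcoef_U ni ij) scalerA; congr (_ *: _).
  by field; rewrite !gdiff.
rewrite E1 E2 -addrA; congr (_ + _); rewrite -scalerDl; congr (_ *: _).
rewrite /jval mulrA mulr_sumr mulr_suml [X in _ = _ + X](bigID (mem S)) /= addrA.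
rewrite -big_split /= [X in X + _]big1 ?add0r => [|i iS].
  apply: eq_bigr => i iS; rewrite -residue_notin //; ring.
have := residue_in iS; move: (acoef _ _ * _) => A h.
by have -> : A = - (kval S * residue g (shiftc S) i / (q - q^-1)); [rewrite h opprK|ring].
Qed.

End GenericModule.
Arguments grho : simpl never.

Section GenericModuleRelations.
Variables (F : numClosedFieldType) (q : F).
Hypotheses (hq0 : q != 0) (hq : forall m : nat, (0 < m)%N -> q ^+ m != 1).
Local Notation c := (cX q false).
Variables (k : nat) (g : 'I_k -> F) (be : F).
Hypotheses (g_inj : injective g) (g0 : forall i, g i != 0) (be2 : be ^+ 2 = 1).
Local Notation rho := (grho q g be).
Local Notation lamS := (kval q be).
Local Notation jS := (jval q g).

(** X sends [bvec S] to sets differing from S in one element, so a relation linear in X can be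
    checked on each of them. *)
Lemma grho_X_map (b : bool) t (f : 'cV[F]_#|{: {set 'I_k}}| -> 'cV[F]_#|{: {set 'I_k}}|) (S : {set 'I_k}) :
  (forall x y, f (x + y) = f x + f y) -> (forall a x, f (a *: x) = a *: f x) ->
  (forall i, i \notin S -> ~~ b -> f (bvec F (i |: S)) = 0) ->
  (forall i, i \in S -> b -> f (bvec F (S :\ i)) = 0) ->
  f (rho (gX b t) *m bvec F S) = 0.
Proof.
move=> fD fZ h1 h2; have f0 : f 0 = 0 by have := fZ 0 0; rewrite !scale0r.
case: b h1 h2 => h1 h2; rewrite ?grho_Xp ?grho_Xm.
  by elim/big_ind: _ => // [x y fx fy|i iS]; rewrite ?fD ?fx ?fy ?addr0 // fZ h2 ?scaler0.
by elim/big_ind: _ => // [x y fx fy|i iS]; rewrite ?fD ?fx ?fy ?addr0 // fZ h1 ?scaler0.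
Qed.

Lemma grho_rep : isrep q rho.
Proof.
have c0 := cX_neq0 hq0 false; have k0 := qqV_neq0 hq0 hq.
have l0 (S : {set 'I_k}) : lamS S != 0 by exact: kval_neq0.
have ct : cX q true = c^-1 by rewrite cXN.
have J0 S : jS 0 S = (1 - (lamS S)^-1 ^+ 2) / (q - q^-1).
  by rewrite -(kval_J0 hq0 hq g_inj g0 be2) mulrC mulKf.
have two : qtwo q = (c^-1 - c) / (q - q^-1) by rewrite -ct.
pose E := (big_cons, big_nil, mulmx1, mul1mx, scale1r, scaleN1r, mul0mx, addr0, mulmxDl, mulNmx).
move=> L RL; apply: bvec_ext => S; rewrite mul0mx /opl.
case: RL => [t|s t||||b t s|b t|b t|b s t|t s] /=; rewrite !E /= !E -?scalemxAl -?mulmxA.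
- by rewrite !grho_J grho_K -!scalemxAr grho_J grho_K !scalerA mulrC subrr.
- by rewrite !grho_J -!scalemxAr !grho_J !scalerA mulrC subrr.
- by rewrite grho_Km -scalemxAr grho_K scalerA mulVf // scale1r subrr.
- by rewrite grho_K -scalemxAr grho_Km scalerA mulfV // scale1r subrr.
- rewrite grho_Km -scalemxAr grho_Km scalerA grho_J scalerA -scaleN1r -!scalerDl J0.
  by rewrite (_ : _ + _ = 0) ?scale0r //; move: (q - q^-1) k0 => d d0; field; rewrite d0 l0.
- by rewrite -[RHS](grho_XX hq0 be g_inj b t s S) !scaleNr !addrA.
- rewrite grho_Km -!scalemxAr.
  apply: (@grho_X_map b t (fun x => (lamS S)^-1 *: (rho gK *m x) + - cX q b *: x)).
  + by move=> x y; rewrite mulmxDr !scalerDr addrACA.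
  + by move=> a x; rewrite -scalemxAr; mxlin.
  + move=> i iS /negPf ->; rewrite grho_K kval_U // scalerA -scalerDl.
    by rewrite (_ : _ + _ = 0) ?scale0r //; field.
  + move=> i iS ->; rewrite grho_K (kval_D _ _ iS) ct scalerA -scalerDl.
    by rewrite (_ : _ + _ = 0) ?scale0r //; field; rewrite c0 l0.
- rewrite grho_J -!scalemxAr addrA.
  apply: (@grho_X_map b t (fun x => cX q b *: (rho (gJ 0) *m x) +
     - (cX q b)^-1 *: (jS 0 S *: x) + - (sgX F b * qtwo q) *: x)).
  + by move=> x y; rewrite mulmxDr; mxlin.
  + by move=> a x; rewrite -scalemxAr; mxlin.
  + move=> i iS /negPf ->; rewrite grho_J !scalerA -!scalerDl !J0 kval_U // two /sgX.
    by rewrite (_ : _ + _ = 0) ?scale0r //; move: (q - q^-1) k0 (lamS S) (l0 S) => d d0 z z0; field; rewrite d0 c0 z0.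
  + move=> i iS ->; rewrite grho_J !scalerA -!scalerDl !J0 (kval_D _ _ iS) ct two /sgX.
    by rewrite (_ : _ + _ = 0) ?scale0r //; move: (q - q^-1) k0 (lamS (S :\ i)) (l0 (S :\ i)) => d d0 z z0; field; rewrite d0 c0 z0.
- rewrite !grho_J -!scalemxAr; case: b.
    rewrite !grho_Xp !mulmx_sumr !scaler_sumr -sumrN -!big_split /= big1 // => i iS.
    rewrite -!scalemxAr !grho_J -scaleN1r !scalerA -!scalerDl.
    rewrite (_ : _ + _ = 0) ?scale0r // ct invrK.
    have nS : i \notin S :\ i by rewrite !inE eqxx.
    have := jval_U hq0 g_inj s nS; rewrite setD1K // => /(canRL (subrK _)).
    move=> /(canLR (addKr _)) h.
    transitivity ((g i ^+ t * bcoef q g be i (S :\ i)) * (jS s.+1 (S :\ i) - jS s.+1 S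
       + g i * (c * jS s S - c^-1 * jS s (S :\ i)))); first by rewrite exprS; ring.
    by rewrite -h; ring.
  rewrite !grho_Xm !mulmx_sumr !scaler_sumr -sumrN -!big_split /= big1 // => i iS.
  rewrite -!scalemxAr !grho_J -scaleN1r !scalerA -!scalerDl.
  rewrite (_ : _ + _ = 0) ?scale0r //.
  have h := jval_U hq0 g_inj s iS.
  transitivity ((g i ^+ t * acoef q g i S) * (jS s.+1 (i |: S) - jS s.+1 S
     - g i * (c * jS s (i |: S) - c^-1 * jS s S))); first by rewrite exprS; ring.
  by rewrite h; ring.
- rewrite grho_J -scalemxAr grho_K scalerA (grho_XpXm hq0 hq be g_inj).
  by rewrite -opprD [jS _ _ * _]mulrC subrr.
exact: g0.
Qed.

Lemma grho_hw : hwvec rho (bvec F (@set0 'I_k)) (be * q ^+ k) (fun t => jS t set0).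
Proof.
split=> [|t||t].
- apply/eqP => /(congr1 (fun A => (bvec F (@set0 'I_k))^T *m A)); rewrite mulmx0 /bvec.
  by rewrite trmx_delta mul_delta_mx => /matrixP/(_ 0 0)/eqP; rewrite !mxE oner_eq0.
- by rewrite grho_Xp big_pred0 // => i; rewrite inE.
- by rewrite grho_K /kval cards0 mulr1.
- exact: grho_J.
Qed.

Lemma grho_functional : (bvec F (@set0 'I_k))^T *m bvec F (@set0 'I_k) = 1%:M /\
  forall t, (bvec F (@set0 'I_k))^T *m rho (gX false t) = 0.
Proof.
split=> [|t].
  rewrite /bvec trmx_delta mul_delta_mx; apply/matrixP => i j.
  by rewrite !mxE !ord1.
apply: bvec_ext => S; rewrite -mulmxA grho_Xm mul0mx mulmx_sumr big1 // => i iS.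
rewrite -scalemxAr /bvec trmx_delta mul_delta_mx_0 ?scaler0 //.
rewrite (inj_eq enum_rank_inj); apply/eqP => /setP/(_ i).
by rewrite !inE eqxx.
Qed.

Lemma grho_qdiff :
  qdiff c (fun j => (revpoly [seq g i | i <- enum 'I_k])`_j) (psi_seq q (fun t => jS t set0)).
Proof.
have k0 := qqV_neq0 hq0 hq.
have e t : (q - q^-1) * jS t set0 = \sum_l g l ^+ t * residue g (fun=> c) l.
  rewrite /jval mulrC divfK //; apply: eq_bigr => l _; congr (_ * (_ * _)).
    by rewrite /shiftc inE.
  by apply: eq_bigr => j _; rewrite /shiftc inE.
apply: qdiff_residue => // -[|t].
  rewrite /psi_seq mul1r (eq_bigr (residue g (fun=> c))); last by move=> l _; rewrite mul1r.
  by rewrite (sum_residue _ g_inj g0) prodr_const card_ord addrC subrK.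
by rewrite mul0r add0r -e.
Qed.
End GenericModuleRelations.

(** * Degeneration to arbitrary parameters *)

Section Realization.
Variables (F : numClosedFieldType) (q : F).
Variables (om : seq gen -> F) (N : nat) (lam : F) (u : nat -> F).
Hypothesis om_rel : forall L, rel q L -> forall x y, \sum_(p <- L) p.1 * om (x ++ p.2 ++ y) = 0.
Hypothesis om_rank : forall x y : 'I_N.+1 -> seq gen, \det (\matrix_(i, j) om (x i ++ y j)) = 0.
Hypothesis om_nil : om [::] = 1.
Hypothesis om_X : forall x t, om (x ++ [:: gX true t]) = 0.
Hypothesis om_K : forall x, om (x ++ [:: gK]) = lam * om x.
Hypothesis om_J : forall x t, om (x ++ [:: gJ t]) = u t * om x.

(* The Hankel matrix (om(xy)) over words x, y has finite rank r; words x_i, y_j with an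
   invertible r x r minor give a realization of om by r x r matrices. *)
Lemma realization : exists n (rho : gen -> 'M[F]_n) v, isrep q rho /\ hwvec rho v lam u.
Proof.
pose P r := exists x y : 'I_r -> seq gen, \det (\matrix_(i, j) om (x i ++ y j)) != 0.
have [||r [x [y M0u]] nP] := @last_true P N.+1.
- by exists (fun=> [::]), (fun=> [::]); rewrite det_mx00 oner_neq0.
- by move=> [x [y /eqP[]]]; exact: om_rank.
pose M0 := \matrix_(i < r, j < r) om (x i ++ y j).
have unitM : M0 \in unitmx by rewrite unitmxE unitfE.
pose row z : 'rV[F]_r := \row_j om (z ++ y j).
pose col w : 'cV[F]_r := \col_i om (x i ++ w).
(* Schur complement: bordering the invertible [M0] by one row and one column gives determinant zero,
   as all minors of size r + 1 vanish. *)
have key z w : row z *m invmx M0 *m col w = (om (z ++ w))%:M.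
  pose A := block_mx (om (z ++ w))%:M (row z) (col w) M0.
  have detA : \det A = 0.
    apply: contrapT => /eqP dA; apply: nP.
    pose x' (i : 'I_(1 + r)) := match split i with inl _ => z | inr j => x j end.
    pose y' (i : 'I_(1 + r)) := match split i with inl _ => w | inr j => y j end.
    exists x', y'; rewrite (_ : \matrix_(i, j) _ = A) //.
    apply/matrixP => i j; rewrite !mxE /x' /y'.
    by case: (split i) => a; rewrite mxE; case: (split j) => b; rewrite !mxE // !ord1 eqxx mulr1n.
  have : A *m block_mx 1%:M 0 (- (invmx M0 *m col w)) 1%:M =
     block_mx ((om (z ++ w))%:M - row z *m invmx M0 *m col w) (row z) 0 M0.
    rewrite mulmx_block !mulmx1 !mulmx0 !add0r !mulmxN !mulmxA mulmxV // mul1mx subrr.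
    by [].
  move=> /(congr1 (fun B => \det B)); rewrite det_mulmx detA mul0r det_ublock.
  move/esym/eqP; rewrite mulf_eq0 [\det M0 == 0](negPf M0u) orbF det_mx11 => /eqP h.
  by apply/esym/subr0_eq; rewrite [LHS]mx11_scalar h; apply/matrixP => i j; rewrite !mxE mul0rn.
have key00 z w : (row z *m invmx M0 *m col w) 0 0 = om (z ++ w).
  by rewrite key mxE eqxx mulr1n.
pose M w := \matrix_(i < r, j < r) om (x i ++ w ++ y j).
pose rho g := invmx M0 *m M [:: g].
(* Taking x_i w1 and w2 y_j in [key] shows that w -> M0^-1 M(w) is multiplicative. *)
have key2 w1 w2 : M w1 *m invmx M0 *m M w2 = M (w1 ++ w2).
  apply/matrixP => i j; have := key00 (x i ++ w1) (w2 ++ y j).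
  rewrite -catA => h; rewrite [RHS]mxE -catA -h [LHS]mxE [RHS]mxE.
  apply: eq_bigr => m _; congr (_ * _).
    by rewrite !mxE; apply: eq_bigr => m' _; rewrite !mxE -catA.
  by rewrite !mxE.
have opwE w : opw rho w = invmx M0 *m M w.
  elim: w => [|g w IH] /=; last by rewrite IH /rho -!mulmxA [M [:: g] *m _]mulmxA key2.
  by rewrite (_ : M [::] = M0) ?mulVmx.
pose v := invmx M0 *m col [::].
have key3 g : rho g *m v = invmx M0 *m col [:: g].
  rewrite /rho /v -mulmxA; congr (_ *m _); rewrite mulmxA; apply/matrixP => i j.
  have := key00 (x i ++ [:: g]) [::]; rewrite cats0 => h; rewrite (ord1 j) [RHS]mxE -h.
  rewrite [LHS]mxE [RHS]mxE; apply: eq_bigr => m _; congr (_ * _).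
  by rewrite !mxE; apply: eq_bigr => m' _; rewrite !mxE -catA.
exists r, rho, v; split=> [L RL|].
  rewrite /opl; transitivity (invmx M0 *m \sum_(p <- L) p.1 *: M p.2).
    by rewrite mulmx_sumr; apply: eq_bigr => p _; rewrite opwE scalemxAr.
  rewrite (_ : \sum_(_ <- _) _ = 0) ?mulmx0 //; apply/matrixP => i j.
  rewrite summxE [RHS]mxE -[RHS](om_rel RL (x i) (y j)); apply: eq_bigr => p _.
  by rewrite !mxE.
have colg g a : (forall z, om (z ++ [:: g]) = a * om z) -> col [:: g] = a *: col [::].
  by move=> h; apply/matrixP => i j; rewrite !mxE h cats0.
split=> [|t||t].
- apply/eqP => v0; have := key [::] [::]; rewrite -mulmxA -/v v0 mulmx0 => /matrixP/(_ 0 0).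
  by rewrite !mxE eqxx om_nil => /esym/eqP; rewrite oner_eq0.
- rewrite key3 (colg _ 0) ?scale0r ?mulmx0 // => z; rewrite om_X mul0r //.
- by rewrite key3 (colg _ lam) // -scalemxAr.
- by rewrite key3 (colg _ (u t)) // -scalemxAr.
Qed.
End Realization.

(** * Specialisation of a polynomial family of modules *)

Section Limit.
Variables (F : numClosedFieldType) (q : F).
Hypothesis hq0 : q != 0.
Variables (b : {poly F}).
Hypothesis b0 : b != 0.
Local Notation T := {e : F | b.[e] != 0}.

(** p b vanishes at every point, and characteristic 0 provides more points than its degree. *)
Lemma poly_eq0_on (p : {poly F}) : (forall e : T, p.[val e] = 0) -> p = 0.
Proof.
move=> h; have pb0 : p * b = 0.
  apply: (roots_geq_poly_eq0 (rs := [seq i%:R | i <- iota 0 (size (p * b)%R)])).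
  - apply/allP => x _; rewrite rootE hornerM; case: (eqVneq b.[x] 0) => [->|bx].
      by rewrite mulr0.
    by rewrite (h (exist _ x bx)) mul0r.
  - rewrite map_inj_uniq ?iota_uniq // => i j /eqP; rewrite eqr_nat.
    by move/eqP.
  - by rewrite size_map size_iota.
by move/eqP: pb0; rewrite mulf_eq0 (negPf b0) orbF => /eqP.
Qed.

Lemma poly_eq_on (p p' : {poly F}) : (forall e : T, p.[val e] = p'.[val e]) -> p = p'.
Proof.
move=> h; apply/subr0_eq/poly_eq0_on => e.
by rewrite hornerD hornerN h subrr.
Qed.

Lemma det_mul_rect n (A : 'M[F]_(n.+1, n)) (B : 'M[F]_(n, n.+1)) : \det (A *m B) = 0.
Proof.
apply/eqP; apply: contraT; rewrite -unitfE -unitmxE -row_free_unit => /eqP h.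
have := leq_trans (mxrankM_maxl A B) (rank_leq_col A).
by rewrite h ltnn.
Qed.

Variables (N : nat) (rho : T -> gen -> 'M[F]_N) (v : T -> 'cV[F]_N) (l : T -> 'rV[F]_N).
Variables (lam : F) (Pu : nat -> {poly F}).
Hypothesis H : forall e, isrep q (rho e).
Hypothesis Hv : forall e, hwvec (rho e) (v e) lam (fun t => (Pu t).[val e]).
Hypothesis lv : forall e, l e *m v e = 1%:M.
Hypothesis lX : forall e t, l e *m rho e (gX false t) = 0.

(** All that [realization] asks of the matrix coefficient, including vanishing minors of size N + 1,
    consists of polynomial identities in e; they pass from the good parameters to any e0, even a bad
    one. *)
Lemma limit_hw (e0 : F) : exists n' (rho' : gen -> 'M[F]_n') v',
  isrep q rho' /\ hwvec rho' v' lam (fun t => (Pu t).[e0]).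
Proof.
pose pol (f : T -> F) := exists p : {poly F}, forall e, f e = p.[val e].
have polC a : pol (fun=> a) by exists a%:P => e; rewrite hornerC.
have polD f g : pol f -> pol g -> pol (fun e => f e + g e).
  by move=> [p ep] [p' ep']; exists (p + p') => e; rewrite hornerD ep ep'.
have polM f g : pol f -> pol g -> pol (fun e => f e * g e).
  by move=> [p ep] [p' ep']; exists (p * p') => e; rewrite hornerM ep ep'.
have polu t : pol (fun e => (Pu t).[val e]) by exists (Pu t).
have sp w : @spanT F T (fun=> N) rho v pol (fun e => opw (rho e) w *m v e).
  elim: w => [|g w IH].
    by apply: (spanT_eq (spanT_span (span_v _ _ _))) => e; rewrite /= mul1mx.
  have := spanT_act hq0 (lam := fun=> lam) (u := fun e t => (Pu t).[val e])
    H Hv polC polM (polC lam) (polC lam^-1) polu g IH.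
  by move/spanT_eq; apply => e; rewrite /act /= mulmxA.
have /choice[p ep] : forall w, exists pw : {poly F}, forall e,
    l e *m opw (rho e) w *m v e = (pw.[val e])%:M.
  move=> w; have [a [p ea] h] := span_functional polC polD polM lv lX (sp w).
  by exists p => e; rewrite -ea -mulmxA h.
have sc (a a' : F) : a%:M = a'%:M :> 'M_1 -> a = a'.
  by move=> /matrixP/(_ 0 0); rewrite !mxE eqxx.
apply: (@realization F q (fun w => (p w).[e0]) N).
- move=> L RL x y; have : \sum_(r <- L) r.1 *: p (x ++ r.2 ++ y) = 0.
    apply: poly_eq0_on => e; apply: sc.
    transitivity (l e *m opw (rho e) x *m opl (rho e) L *m (opw (rho e) y *m v e)); last first.
      by rewrite H // mulmx0 mul0mx raddf0.
    rewrite /opl mulmx_sumr mulmx_suml horner_sum raddf_sum; apply: eq_bigr => r _.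
    rewrite /= hornerZ -scale_scalar_mx -ep !opw_cat -scalemxAr -scalemxAl; congr (_ *: _).
    by rewrite !mulmxA.
  move=> /(congr1 (fun P => P.[e0])); rewrite horner_sum horner0 => h.
  by rewrite -[RHS]h; apply: eq_bigr => r _; rewrite hornerZ.
- move=> x y; pose A := \matrix_(i, j) p (x i ++ y j).
  have ev e : \det (\matrix_(i, j) (p (x i ++ y j)).[e]) = (\det A).[e].
    rewrite -[RHS]/(horner_eval e (\det A)) -det_map_mx; congr (\det _).
    by apply/matrixP => i j; rewrite !mxE.
  rewrite ev (_ : \det A = 0) ?horner0 //; apply: poly_eq0_on => e; rewrite -ev.
  (* At a good parameter the Hankel matrix factors through the N-dimensional module. *)
  pose B := \matrix_(i < N.+1, j < N) (l e *m opw (rho e) (x i)) 0 j.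
  pose C := \matrix_(i < N, j < N.+1) (opw (rho e) (y j) *m v e) i 0.
  rewrite (_ : \matrix_(i, j) _ = B *m C) ?det_mul_rect //.
  apply/matrixP => i j; rewrite [LHS]mxE; have := ep (x i ++ y j) e.
  rewrite opw_cat mulmxA -[_ *m _ *m v e]mulmxA => /matrixP/(_ 0 0).
  rewrite [in X in _ = X -> _]mxE eqxx mulr1n => <-; rewrite [LHS]mxE [RHS]mxE.
  by apply: eq_bigr => m _; rewrite !mxE.
- rewrite (_ : p [::] = 1) ?hornerC //; apply: poly_eq_on => e; apply: sc.
  by rewrite -ep /= mulmx1 lv hornerC.
- move=> x t; rewrite (_ : p _ = 0) ?horner0 //; apply: poly_eq0_on => e; apply: sc.
  rewrite -ep opw_cat /= mulmx1 -!mulmxA; have [_ -> _ _] := Hv e.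
  by rewrite !mulmx0 raddf0.
- move=> x; rewrite (_ : p _ = lam *: p x) ?hornerZ //; apply: poly_eq_on => e; apply: sc.
  rewrite -ep opw_cat /= mulmx1 -!mulmxA; have [_ _ -> _] := Hv e.
  by rewrite -!scalemxAr mulmxA ep hornerZ scale_scalar_mx.
- move=> x t; rewrite (_ : p _ = Pu t * p x) ?hornerM //; apply: poly_eq_on => e; apply: sc.
  rewrite -ep opw_cat /= mulmx1 -!mulmxA; have [_ _ _ ->] := Hv e.
  by rewrite -!scalemxAr mulmxA ep hornerM scale_scalar_mx.
Qed.
End Limit.

Section Existence.
Variables (F : numClosedFieldType) (q : F).
Hypotheses (hq0 : q != 0) (hq : forall m : nat, (0 < m)%N -> q ^+ m != 1).
Local Notation c := (cX q false).
Variables (k : nat) (ga : 'I_k -> F) (be : F).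
Hypothesis be2 : be ^+ 2 = 1.

(* For all but finitely many e, the points gline e i are distinct and nonzero. *)
Definition gline (e : F) (i : 'I_k) : F := ga i + i.+1%:R * e.
Definition gpoly (i : 'I_k) : {poly F} := (ga i)%:P + i.+1%:R *: 'X.

Lemma gpolyE e i : (gpoly i).[e] = gline e i.
Proof. by rewrite /gpoly !hornerE. Qed.

Definition bad : {poly F} :=
  (\prod_i \prod_(j | j != i) (gpoly i - gpoly j)) * \prod_i gpoly i.

(** The slopes i + 1 are distinct and nonzero, so neither a difference of two points nor a point
    vanishes identically. *)
Lemma bad_neq0 : bad != 0.
Proof.
rewrite mulf_neq0 //; apply/prodf_neq0 => i _.
  apply/prodf_neq0 => j ji; apply/eqP => /(congr1 (fun p : {poly F} => p`_1)).
  rewrite /gpoly !(coefD, coefN, coefC, coefZ, coefX, coef0) /= !mulr1 !add0r => /eqP.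
  by rewrite subr_eq0 eqr_nat eqSS eq_sym => /eqP/val_inj/eqP; rewrite (negPf ji).
apply/eqP => /(congr1 (fun p : {poly F} => p`_1)).
rewrite /gpoly !(coefD, coefC, coefZ, coefX, coef0) /= mulr1 add0r => /eqP.
by rewrite pnatr_eq0.
Qed.

Lemma bad_good e : bad.[e] != 0 -> injective (gline e) /\ forall i, gline e i != 0.
Proof.
rewrite hornerM !horner_prod mulf_eq0 negb_or => /andP[/prodf_neq0 h1 /prodf_neq0 h2].
split=> [i j ij|i]; last by rewrite -gpolyE h2.
apply/eqP; apply: contraT => ne; have := h1 i isT; rewrite horner_prod => /prodf_neq0 /(_ j).
by rewrite eq_sym ne hornerD hornerN !gpolyE ij subrr eqxx => /(_ isT).
Qed.

Definition Dpoly (j : nat) : {poly F} := (\prod_i (1 - gpoly i *: 'X) : {poly {poly F}})`_j.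

Lemma DpolyE e j : (Dpoly j).[e] = (revpoly [seq gline e i | i <- enum 'I_k])`_j.
Proof.
have h i : map_poly (horner_eval e) (1 - gpoly i *: 'X) = 1 - gline e i *: 'X.
  rewrite rmorphB rmorph1 /= -mul_polyC rmorphM /= map_polyC map_polyX /=.
  by rewrite /horner_eval gpolyE mul_polyC.
rewrite -[LHS]/(horner_eval e (Dpoly j)) /Dpoly -coef_map rmorph_prod /=.
rewrite (eq_bigr _ (fun i _ => h i)) /revpoly big_map big_enum /=.
by [].
Qed.

Lemma exists_hw_module : exists n (rho : gen -> 'M[F]_n) v u, [/\ isrep q rho,
  hwvec rho v (be * q ^+ k) u &
  qdiff c (fun j => (revpoly [seq ga i | i <- enum 'I_k])`_j) (psi_seq q u)].
Proof.
have k0 := qqV_neq0 hq0 hq.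
pose T := {e : F | bad.[e] != 0}.
have good (e : T) := bad_good (valP e).
pose ue (e : T) t := jval q (gline (val e)) t set0.
have qd (e : T) : qdiff c (fun j => (Dpoly j).[val e]) (psi_seq q (ue e)).
  have [gi g0] := good e; move=> r; rewrite DpolyE -(grho_qdiff hq0 hq gi g0).
  by apply: eq_bigr => j _; rewrite DpolyE.
have Dp0 e : (Dpoly 0).[e] = 1 by rewrite DpolyE revpoly0.
have pp r : exists p : {poly F}, forall e : T, psi_seq q (ue e) r = p.[val e].
  have [d] := ubnP r; elim: d r => // d IH r rd.
  have /choice[p ep] : forall i : 'I_r, exists p : {poly F}, forall e : T, psi_seq q (ue e) (r - i.+1)%N = p.[val e].
    by move=> i; apply: IH; have := ltn_ord i; lia.
  exists (c ^+ r *: Dpoly r - \sum_(i < r) Dpoly i.+1 * p i) => e.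
  rewrite hornerD hornerN hornerZ -(qd e) big_ord_recl /= Dp0 mul1r subn0 horner_sum.
  by rewrite -addrA [X in _ + X](_ : _ = 0) ?addr0 // -sumrB big1 // => i _; rewrite hornerM -ep subrr.
have /choice[Pu ePu] : forall t, exists p : {poly F}, forall e : T, ue e t = p.[val e].
  move=> t; have [p ep] := pp t.+1; have [p0 ep0] := pp 0%N.
  case: t p ep => [|t] p ep; last first.
    have [p' ep'] := pp t.+1; exists ((q - q^-1)^-1 *: p') => e.
    by rewrite hornerZ -ep' /psi_seq mulKf.
  (* psi does not record u_0, which is constant because the K-weight be q^k does not depend on e. *)
  exists ((1 - (be * q ^+ k)^-1 ^+ 2) / (q - q^-1))%:P => e; rewrite hornerC.
  have [gi g0] := good e; have := kval_J0 hq0 hq gi g0 be2 set0.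
  by rewrite /kval cards0 mulr1 => <-; rewrite mulrC mulKf.
have [||||n [rho [v [H V]]]] := @limit_hw F q hq0 bad bad_neq0 _
  (fun e : T => grho q (gline (val e)) be) (fun=> bvec F (@set0 'I_k))
  (fun=> (bvec F (@set0 'I_k))^T) (be * q ^+ k) Pu _ _ _ _ 0.
- by move=> e; have [gi g0] := good e; exact: grho_rep.
- move=> e; have [e1 e2 e3 e4] := grho_hw q (gline (val e)) be.
  by split=> // t; rewrite e4 -ePu.
- by move=> e; have [] := grho_functional q (gline (val e)) be.
- by move=> e; have [] := grho_functional q (gline (val e)) be.
exists n, rho, v, (fun t => (Pu t).[0]); split=> // r.
pose pPsi s : {poly F} := if s is _.+1 then (q - q^-1) *: Pu s else 1.
have pPsiE (e : T) s : psi_seq q (ue e) s = (pPsi s).[val e].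
  by case: s => [|s]; rewrite /psi_seq /pPsi ?hornerC // hornerZ -ePu.
have pPsi0 s : psi_seq q (fun t => (Pu t).[0]) s = (pPsi s).[0].
  by case: s => [|s]; rewrite /psi_seq /pPsi ?hornerC // hornerZ.
have g0 : gline 0 = ga by apply/funext => i; rewrite /gline mulr0 addr0.
have E : \sum_(j < r.+1) Dpoly j * pPsi (r - j)%N = c ^+ r *: Dpoly r.
  apply: (poly_eq_on bad_neq0) => e; rewrite horner_sum hornerZ -(qd e).
  by apply: eq_bigr => j _; rewrite hornerM pPsiE.
have := congr1 (fun P : {poly F} => P.[0]) E; rewrite /= horner_sum hornerZ DpolyE g0 => <-.
by apply: eq_bigr => j _; rewrite hornerM DpolyE g0 pPsi0.
Qed.
End Existence.

(** * The bijection *)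

Section Bridge.
Variables (R : realType) (q : R[i]).
Hypotheses (hq0 : q != 0) (hq : forall m : nat, (0 < m)%N -> q ^+ m != 1).
Local Notation c := (cX q false).

Definition rep_of n (r : ops R n) (g : gen) : 'M[R[i]]_n :=
  match g with
  | gX true t => Xp r t | gX false t => Xm r t | gJ t => J r t
  | gK => Kp r | gKm => Km r
  end.

Definition ops_of n (rho : gen -> 'M[R[i]]_n) : ops R n :=
  Ops (fun t => rho (gX true t)) (fun t => rho (gX false t)) (fun t => rho (gJ t))
    (rho gK) (rho gKm).

Lemma rep_of_ops n (rho : gen -> 'M[R[i]]_n) : rep_of (ops_of rho) = rho.
Proof. by apply/funext => -[[] t|t||]. Qed.

Lemma is_module_rep n (r : ops R n) : is_module q r <-> isrep q (rep_of r).
Proof.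
pose E := (big_cons, big_nil, mulmx1, mulmxA, scale1r, scaleN1r, addr0).
split.
  case=> [[h1 h2] [h3 h4] h5 [[a1 a2 a3 a4] [b1 b2 b3 b4]] h6] L [t|s t||||b t s|b t|b t|b s t|t s];
    rewrite /opl /= !E /= !E.
  - exact: h1.
  - exact: h2.
  - by rewrite h3 subrr.
  - by rewrite h4 subrr.
  - by rewrite h5; mxlin.
  - case: b; [have := a1 t s|have := b1 t s] => /eqP; rewrite -subr_eq0 => /eqP h;
      rewrite /= -[RHS]h /cX; mxlin.
  - case: b; [have := a2 t|have := b2 t] => h; rewrite /= h /cX; mxlin.
  - case: b; [have := a3 t|have := b3 t] => /eqP; rewrite -subr_eq0 => /eqP h;
      rewrite /= -[RHS]h /cX /sgX /qtwo /qint; mxlin.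
  - case: b; [have := a4 s t|have := b4 s t] => /eqP; rewrite -subr_eq0 => /eqP h;
      rewrite /= -[RHS]h /cX /comm; mxlin.
  - by have := h6 t s; rewrite /comm addrA => ->; rewrite subrr.
move=> H.
have X b : X_rels q r (fun t => rep_of r (gX b t)) (cX q b) (sgX _ b).
  split=> [t s|t|t|s t].
  - by rewrite (XX H b t s); mxlin.
  - by rewrite (KX H) -scalemxAl -mulmxA (KKm H) mulmx1.
  - have := JX0 hq0 H b t; rewrite /= => ->; rewrite scalerDr !scalerA addrAC.
    rewrite expr2 mulrA mulfV ?cX_neq0 // mul1r mulrA mulfV ?cX_neq0 // mul1r.
    by rewrite subrr add0r.
  - by have := JXS H b s t; rewrite /comm /= => ->; mxlin.
split.
- by split=> [t|s t]; rewrite /comm; [have := KJ H t|have := JJ H s t] => /= ->; rewrite subrr.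
- by split; [have := KKm H|have := KmK H].
- by have := Km2 H.
- by split; [exact: (X true)|exact: (X false)].
- by move=> t s; have := XpXm H t s; rewrite /comm /= => ->; rewrite addrAC subrr add0r.
Qed.

Lemma simple_rep n (r : ops R n) : simple r <-> simplerep (rep_of r).
Proof.
split=> -[n0 h]; split=> // U inv; apply: h.
  split=> [|t|t|t].
  - by apply/andP; split; [have := inv gK|have := inv gKm].
  - exact: (inv (gX true t)).
  - exact: (inv (gX false t)).
  - exact: (inv (gJ t)).
by case: inv => /andP[iK iKm] iXp iXm iJ [[] t|t||] /=.
Qed.

(* J_0 is determined by K on a highest weight vector, so the entry u.2 0 is ignored. *)
Definition full_weight (u : R[i] * (nat -> R[i])) (t : nat) : R[i] :=
  if t is _.+1 then u.2 t else (1 - u.1^-1 ^+ 2) / (q - q^-1).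

Lemma has_hwP n (r : ops R n) u : is_module q r ->
  has_hw r u <-> exists v, hwvec (rep_of r) v u.1 (full_weight u).
Proof.
move=> /is_module_rep H; split=> -[v].
  case=> v0 Xv Kv Jv; exists v; split=> // -[|t]; last exact: Jv.
  have l0 : u.1 != 0.
    apply: contra v0 => /eqP l0; move: Kv; rewrite l0 scale0r => /(congr1 (mulmx (Km r))).
    by rewrite mulmxA mulmx0; have := KmK H => /= ->; rewrite mul1mx => ->.
  have := J0_weight H l0 Kv => /= /(congr1 (fun x => (q - q^-1)^-1 *: x)).
  rewrite scalerA mulVf ?(qqV_neq0 hq0 hq) // scale1r => ->.
  by rewrite scalerA mulrC.
case=> v0 Xv Kv Jv; exists v; split=> // -[//|t] _; exact: (Jv t.+1).
Qed.

Lemma hwvec_ext n (rho : gen -> 'M[R[i]]_n) v lam u lam' u' :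
  lam = lam' -> u =1 u' -> hwvec rho v lam u -> hwvec rho v lam' u'.
Proof. by move=> <- e [v0 Xv Kv Jv]; split=> // t; rewrite -e. Qed.

Lemma hwvec_full n (rho : gen -> 'M[R[i]]_n) v lam u (w : R[i] * (nat -> R[i])) :
  isrep q rho -> hwvec rho v lam u -> lam = w.1 -> psi_seq q u =1 psi_seq q w.2 ->
  hwvec rho v w.1 (full_weight w).
Proof.
move=> H V el eu; apply: (hwvec_ext _ _ V) => // -[|t] /=.
  by rewrite -el -(hw_u0 H V) mulrC mulKf // qqV_neq0.
by have := eu t.+1; rewrite /psi_seq => /(mulfI (qqV_neq0 hq0 hq)).
Qed.

Lemma psi_full w : psi_seq q (full_weight w) =1 psi_seq q w.2.
Proof. by case. Qed.

Lemma roots_ofE (phi : {poly R[i]}) :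
  phi = lead_coef phi *: \prod_(x <- roots_of phi) ('X - x%:P).
Proof. by rewrite /roots_of; case: closed_field_poly_normal. Qed.

Lemma u0_weight (phi : {poly R[i]}) : (u0 q phi).1 = lead_coef phi * q ^+ size (roots_of phi).
Proof. by rewrite /u0; case: eqP => // ->; rewrite mulr1. Qed.

Lemma u0_qdiff (phi : {poly R[i]}) :
  qdiff c (fun j => (revpoly (roots_of phi))`_j) (psi_seq q (u0 q phi).2).
Proof.
have e : psi_seq q (u0 q phi).2 =1 wseries c (roots_of phi).
  rewrite /u0; case: eqP => [/size0nil ->|_] [|t] /=.
  - by rewrite /psi_seq /wseries big_nil coef1.
  - by rewrite /psi_seq mulr0 /wseries big_nil coef1.
  - rewrite /psi_seq /wseries; elim: (roots_of phi) => [|x s IH]; first by rewrite big_nil coef1.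
    by rewrite big_cons coefM big_ord1 -IH mulr1 wpoly_coef.
  - rewrite /psi_seq ptq_wseries //; congr (wseries _ _ _).
    apply: (@eq_from_nth _ 0); rewrite size_map size_enum_ord // => i isz.
    by rewrite (nth_map (Ordinal isz)) ?size_enum_ord // nth_enum_ord.
move=> r; rewrite -(qdiff_wseries c (roots_of phi) r).
by apply: eq_bigr => j _; rewrite e.
Qed.

Lemma lead2 (phi : {poly R[i]}) : in_Cx0 phi -> lead_coef phi ^+ 2 = 1.
Proof. by case/orP => /eqP ->; rewrite ?expr1n // sqrrN expr1n. Qed.

Lemma L_exists (phi : {poly R[i]}) : in_Cx0 phi ->
  exists (n : nat) (r : ops R n), is_module q r /\ is_L r (u0 q phi).
Proof.
move=> /lead2 be2; pose s := roots_of phi.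
have [n0 [rho0 [v0 [u [H0 V0 qd]]]]] :=
  exists_hw_module hq0 hq (fun i : 'I_(size s) => s`_i) be2.
have [n [rho [v [H S V]]]] := simple_of_hw hq0 H0 V0.
have es : [seq s`_i | i : 'I_(size s) <- enum 'I_(size s)] = s.
  apply: (@eq_from_nth _ 0); rewrite size_map size_enum_ord // => i isz.
  by rewrite (nth_map (Ordinal isz)) ?size_enum_ord // nth_enum_ord.
have M : is_module q (ops_of rho) by apply/is_module_rep; rewrite rep_of_ops.
exists n, (ops_of rho); split=> //; split; first by apply/simple_rep; rewrite rep_of_ops.
apply/has_hwP => //; exists v; rewrite rep_of_ops; apply: (hwvec_full H V).
  by rewrite u0_weight.
rewrite es in qd; apply: qdiff_psi_unique qd (u0_qdiff phi).
exact: revpoly0.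
Qed.

Lemma L_unique (phi : {poly R[i]}) (n1 n2 : nat) (r1 : ops R n1) (r2 : ops R n2) :
  is_module q r1 -> is_module q r2 ->
  is_L r1 (u0 q phi) -> is_L r2 (u0 q phi) -> iso r1 r2.
Proof.
move=> M1 M2 [/simple_rep S1 /(has_hwP _ M1)[v1 V1]] [/simple_rep S2 /(has_hwP _ M2)[v2 V2]].
have [P [Q [PQ QP h]]] := hw_simple_iso hq0 hq ((is_module_rep r1).1 M1)
  ((is_module_rep r2).1 M2) S1 S2 V1 V2.
exists P, Q; split=> //.
- by split; [exact: (h gK)|exact: (h gKm)].
- by move=> t; exact: (h (gX true t)).
- by move=> t; exact: (h (gX false t)).
- by move=> t; exact: (h (gJ t)).
Qed.

(** Transport along the isomorphism puts both highest weights into one simple module. The square of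
    the K-weight gives the number of roots, the K-weight itself then the leading coefficient, and
    psi determines D. *)
Lemma L_inj (phi1 phi2 : {poly R[i]}) (n1 n2 : nat) (r1 : ops R n1) (r2 : ops R n2) :
  in_Cx0 phi1 -> in_Cx0 phi2 -> is_module q r1 -> is_module q r2 ->
  is_L r1 (u0 q phi1) -> is_L r2 (u0 q phi2) -> iso r1 r2 -> phi1 = phi2.
Proof.
move=> P1 P2 M1 M2 [_ /(has_hwP _ M1)[v1 [v10 Xv1 Kv1 Jv1]]] [/simple_rep S2 /(has_hwP _ M2)[v2 V2]].
move=> [P [Q [[PQ QP] [hK _] hXp _ hJ]]].
have V1 : hwvec (rep_of r2) (P *m v1) (u0 q phi1).1 (full_weight (u0 q phi1)).
  split=> [|t||t] /=.
  - by apply: contra v10 => /eqP e; rewrite -[v1]mul1mx -QP -mulmxA e mulmx0.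
  - by rewrite mulmxA -hXp -mulmxA [_ *m v1](Xv1 t) mulmx0.
  - by rewrite mulmxA -hK -mulmxA [_ *m v1]Kv1 scalemxAr.
  - by rewrite mulmxA -hJ -mulmxA [_ *m v1](Jv1 t) scalemxAr.
have [el eu] := hw_unique hq0 hq ((is_module_rep r2).1 M2) S2 V1 V2.
have epsi : psi_seq q (u0 q phi1).2 =1 psi_seq q (u0 q phi2).2.
  by move=> t; rewrite -!psi_full; case: t => [//|t]; rewrite /psi_seq eu.
have L1 := lead2 P1; have L2 := lead2 P2.
have es : size (roots_of phi1) = size (roots_of phi2).
  move: el; rewrite !u0_weight => /(congr1 (fun x => x ^+ 2)).
  rewrite !exprMn L1 L2 !mul1r -!exprM => /(qexp_inj hq0 hq) /eqP.
  by rewrite eqn_pmul2r // => /eqP.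
have lead : lead_coef phi1 = lead_coef phi2.
  by move: el; rewrite !u0_weight es => /(mulIf (expf_neq0 _ hq0)).
rewrite (roots_ofE phi1) (roots_ofE phi2) lead; congr (_ *: _).
apply: revpoly_inj => //; apply: (@qdiff_D_unique _ c _ _ (psi_seq q (u0 q phi1).2)).
- by move=> r r0; exact: cX_exp_neq1.
- by [].
- exact: revpoly0.
- exact: revpoly0.
- exact: u0_qdiff.
- by move=> r; rewrite -(u0_qdiff phi2 r); apply: eq_bigr => j _; rewrite epsi.
Qed.

Lemma L_surj (n : nat) (r : ops R n) : is_module q r -> simple r ->
  exists phi : {poly R[i]}, in_Cx0 phi /\ is_L r (u0 q phi).
Proof.
move=> M S; have H := (is_module_rep r).1 M; have Sr := (simple_rep r).1 S.
have [v [lam [u V]]] := exists_hwvec hq0 hq H Sr.1.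
have [k [D [lk D0 Dk qd]]] := drinfeld_data hq0 hq H V.
(* The reversal makes D_0 = 1 the leading coefficient; if D has degree below k, the missing roots
   are 0. *)
pose P : {poly R[i]} := \poly_(j < k.+1) D (k - j)%N.
have szP : size P = k.+1 by rewrite size_poly_eq // subnn D0 oner_neq0.
have lP : lead_coef P = 1 by rewrite lead_coefE szP coef_poly ltnSn subnn D0.
(* As lam^2 = q^(2k), this is a sign; it becomes the leading coefficient. *)
pose be := lam / q ^+ k.
have be2 : be ^+ 2 = 1.
  rewrite /be expr_div_n lk -exprM cXN /= /cX -exprM mulnC.
  by rewrite mulfV // expf_neq0.
have beS : (be == 1) || (be == -1) by rewrite -sqrf_eq1 be2.
have be0 : be != 0 by apply/eqP => b0; move: be2; rewrite b0 expr0n => /esym/eqP; rewrite oner_eq0.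
pose phi := be *: P.
have lphi : lead_coef phi = be by rewrite lead_coefZ lP mulr1.
have prodE : \prod_(x <- roots_of phi) ('X - x%:P) = P.
  by apply: (scalerI be0); rewrite -{1}lphi -roots_ofE.
have sz : size (roots_of phi) = k.
  by have := size_prod_XsubC (roots_of phi) id; rewrite prodE szP => -[].
have Drev j : (revpoly (roots_of phi))`_j = D j.
  case: (leqP j k) => jk; last by rewrite revpoly_big ?sz // Dk.
  by rewrite revpolyE ?sz // prodE coef_poly ltnS leq_subr subKn.
exists phi; split; first by rewrite /in_Cx0 lphi.
split=> //; apply/has_hwP => //; exists v; apply: (hwvec_full H V).
  by rewrite u0_weight lphi sz /be divfK // expf_neq0.
apply: (qdiff_psi_unique D0 qd) => t; rewrite -Drev -(u0_qdiff phi t).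
by apply: eq_bigr => j _; rewrite Drev.
Qed.
End Bridge.

Theorem mainTheorem9 (R : realType) (q : R[i])
  (hq0 : q != 0) (hq : forall m : nat, (0 < m)%N -> q ^+ m != 1) :
  [/\ (forall phi : {poly R[i]}, in_Cx0 phi ->
         exists (n : nat) (r : ops R n), is_module q r /\ is_L r (u0 q phi)),
      (forall (phi : {poly R[i]}) (n1 n2 : nat) (r1 : ops R n1) (r2 : ops R n2),
         in_Cx0 phi -> is_module q r1 -> is_module q r2 ->
         is_L r1 (u0 q phi) -> is_L r2 (u0 q phi) -> iso r1 r2),
      (forall (phi1 phi2 : {poly R[i]}) (n1 n2 : nat) (r1 : ops R n1) (r2 : ops R n2),
         in_Cx0 phi1 -> in_Cx0 phi2 -> is_module q r1 -> is_module q r2 ->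
         is_L r1 (u0 q phi1) -> is_L r2 (u0 q phi2) -> iso r1 r2 -> phi1 = phi2)
    & (forall (n : nat) (r : ops R n), is_module q r -> simple r ->
         exists phi : {poly R[i]}, in_Cx0 phi /\ is_L r (u0 q phi))].
Proof.
split.
- exact: L_exists.
- by move=> phi n1 n2 r1 r2 _; exact: L_unique.
- exact: L_inj.
- exact: L_surj.
Qed.
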